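(* Let $m>0$ and $b=(b_1,\dots,b_d)\in\mathbb{R}^d$ be constants, and let $f$ be piecewise constant on the mesh $\mathcal{T}_H$ of $\Omega\subset\mathbb{R}^d$. Consider the Adv-MsFEM-lin problem: find $u_H^{\mathrm{adv}}\in V_H^{\mathrm{adv}}$ such that $a(u_H^{\mathrm{adv}},v)=\int_\Omega f\,v$ for all $v\in V_H^{\mathrm{adv}}$. Writing $$u_H^{\mathrm{adv}}=u_H+\sum_{K\in\mathcal{T}_H}\sum_{\alpha=1}^d\partial_\alpha(u_H|_K)\,\chi_K^{\alpha}\qquad\text{with } u_H\in V_H,$$ this problem is equivalent to: find $u_H\in V_H$ such that $$\forall v_H\in V_H,\quad\sum_{K\in\mathcal{T}_H}\int_K m\,\nabla u_H\cdot\nabla v_H+v_H\,b\cdot\nabla u_H+\tau^B\,(b\cdot\nabla u_H)(b\cdot\nabla v_H)=\int_\Omega f\,v_H-\tau^B f\,b\cdot\nabla v_H,$$ with the piecewise constant parameter $\tau^B|_K=\frac{1}{|K|}\int_K B_K$ for all $K\in\mathcal{T}_H$.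
   Context: $\Omega\subset\mathbb{R}^d$ is an open bounded polytope and $\mathcal{T}_H$ is a regular conforming simplicial mesh of $\Omega$. $V_H$ is the space of continuous functions on $\Omega$ that are affine on each $K\in\mathcal{T}_H$ and vanish on $\partial\Omega$; $\phi_1^{\mathbb{P}_1},\dots,\phi_N^{\mathbb{P}_1}$ is its standard nodal basis (associated with the internal vertices). The operator is $\mathcal{L}u=-m\,\Delta u+b\cdot\nabla u$ with bilinear form $a(u,v)=\int_\Omega m\,\nabla u\cdot\nabla v+v\,b\cdot\nabla u$. Basis functions: for $1\le i\le N$, $\phi_i^{\mathrm{adv}}\in H^1_0(\Omega)$ is the unique function such that, for every $K\in\mathcal{T}_H$, $\mathcal{L}\phi_i^{\mathrm{adv}}=0$ weakly in $K$ and $\phi_i^{\mathrm{adv}}=\phi_i^{\mathbb{P}_1}$ on $\partial K$. The Adv-MsFEM-lin space is $V_H^{\mathrm{adv}}=\operatorname{Span}\{\phi_i^{\mathrm{adv}},\ 1\le i\le N\}$. Bubbles: $B_K\in H^1_0(K)$ is the unique weak solution to $\mathcal{L}B_K=1$ in $K$, $B_K=0$ on $\partial K$. Numerical correctors: for $1\le\alpha\le d$, $\chi_K^\alpha\in H^1_0(K)$ is the unique weak solution to $\mathcal{L}\chi_K^\alpha=-\mathcal{L}x^\alpha$ in $K$, $\chi_K^\alpha=0$ on $\partial K$, where $x^\alpha$ is the $\alpha$-th coordinate function; it is extended by $0$ outside $K$. Every element of $V_H^{\mathrm{adv}}$ can be written in a unique way as $u_H+\sum_{K}\sum_{\alpha}\partial_\alpha(u_H|_K)\chi_K^\alpha$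 with $u_H\in V_H$. *)

(* Defs.v *)
From HB Require Import structures.
From mathcomp Require Import all_boot all_order all_algebra.
From mathcomp Require Import all_classical all_reals all_analysis.
Import Order.TTheory GRing.Theory Num.Theory.
Import numFieldNormedType.Exports.

Set Implicit Arguments.
Unset Strict Implicit.
Unset Printing Implicit Defensive.

Local Open Scope classical_set_scope.
Local Open Scope ring_scope.

Fact rV_display : measure_display. Proof. exact: default_measure_display. Qed.

(* The sigma-algebra on R^n generated by the coordinates, i.e. the Borel
   sigma-algebra. *)
Section measurable_rV.
Variables (R : realType) (n : nat).

Definition rV_coord (i : 'I_n) (x : 'rV[R]_n) : R := x 0 i.

Let rV_set0 : g_sigma_preimage rV_coord set0.
Proof. exact: sigma_algebra0. Qed.

Let rV_setC A : g_sigma_preimage rV_coord A -> g_sigma_preimage rV_coord (~` A).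
Proof. exact: sigma_algebraC. Qed.

Let rV_bigcup (F : (set 'rV[R]_n)^nat) :
  (forall i, g_sigma_preimage rV_coord (F i)) ->
  g_sigma_preimage rV_coord (\bigcup_i (F i)).
Proof. exact: sigma_algebra_bigcup. Qed.

HB.instance Definition _ := @isMeasurable.Build rV_display
  'rV[R]_n (g_sigma_preimage rV_coord) rV_set0 rV_setC rV_bigcup.

Lemma measurable_rV_coord i : measurable_fun [set: 'rV[R]_n] (rV_coord i).
Proof.
move=> _ Y mY; rewrite setTI; apply: sub_sigma_algebra => /=.
rewrite -bigcup_seq/=; exists i => /=; first by rewrite mem_index_enum.
by exists Y => //; rewrite setTI.
Qed.

Lemma measurable_fun_rV d' (T : measurableType d') (h : T -> 'rV[R]_n) :
  (forall i, measurable_fun [set: T] (rV_coord i \o h)) ->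
  measurable_fun [set: T] h.
Proof.
move=> mh _ A mA; rewrite setTI.
suff : g_sigma_preimage rV_coord `<=` [set B | measurable (h @^-1` B)].
  by apply; exact: mA.
apply: smallest_sub.
  split => /=.
  - by rewrite preimage_set0.
  - by move=> B mB; rewrite setTD -preimage_setC; exact: measurableC.
  - by move=> F mF; rewrite preimage_bigcup; exact: bigcup_measurable.
move=> B; rewrite -bigcup_seq /= => -[i _ [C mC <-]] /=.
rewrite setTI -comp_preimage -[X in measurable X]setTI.
exact: mh.
Qed.

End measurable_rV.

Section rV_cons.
Variables (R : realType) (n : nat).

Definition rV_cons (p : R * 'rV[R]_n) : 'rV[R]_n.+1 :=
  \row_i (if unlift ord0 i is Some j then p.2 0 j else p.1).

Definition rV_uncons (x : 'rV[R]_n.+1) : R * 'rV[R]_n :=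
  (x 0 ord0, \row_j x 0 (lift ord0 j)).

Lemma rV_consK : cancel rV_cons rV_uncons.
Proof.
move=> [a y]; congr pair; first by rewrite mxE unlift_none.
by apply/rowP => j; rewrite !mxE liftK.
Qed.

Lemma rV_unconsK : cancel rV_uncons rV_cons.
Proof.
move=> x; apply/rowP => i; rewrite mxE.
by case: unliftP => [j ->|->] //=; rewrite mxE.
Qed.

Lemma measurable_rV_cons : measurable_fun [set: R * 'rV[R]_n] rV_cons.
Proof.
apply: measurable_fun_rV => i.
have [[j ij]|i0] : (exists j, i = lift ord0 j) \/ i = ord0.
- by case: (unliftP ord0 i) => [j ->|->]; [left; exists j|right].
- rewrite (_ : _ \o _ = @rV_coord R n j \o snd).
    by apply: measurableT_comp => //; exact: measurable_rV_coord.
  by apply/funext => p; rewrite /rV_coord /= mxE ij liftK.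
- rewrite (_ : _ \o _ = fst) //.
  by apply/funext => p; rewrite /rV_coord /= mxE i0 unlift_none.
Qed.

Lemma measurable_rV_uncons : measurable_fun [set: 'rV[R]_n.+1] rV_uncons.
Proof.
apply/measurable_fun_pairP; split; first exact: measurable_rV_coord.
apply: measurable_fun_rV => j.
rewrite (_ : _ \o _ = @rV_coord R n.+1 (lift ord0 j)).
  exact: measurable_rV_coord.
by apply/funext => x; rewrite /rV_coord /= mxE.
Qed.

Variable mu : {sigma_finite_measure set 'rV[R]_n -> \bar R}.

Definition lebesgueS : set 'rV[R]_n.+1 -> \bar R :=
  pushforward (lebesgue_measure \x mu)%E rV_cons.

Let lebesgueS_pre A : measurable A -> measurable (rV_cons @^-1` A).
Proof. by move=> mA; rewrite -[X in measurable X]setTI; exact: measurable_rV_cons. Qed.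

Let lebesgueS0 : lebesgueS set0 = 0%E.
Proof. by rewrite /lebesgueS /pushforward preimage_set0 measure0. Qed.

Let lebesgueS_ge0 A : (0 <= lebesgueS A)%E.
Proof. by rewrite /lebesgueS /pushforward; exact: measure_ge0. Qed.

Let lebesgueS_sigma_additive : semi_sigma_additive lebesgueS.
Proof.
move=> F mF tF mUF; rewrite /lebesgueS /pushforward preimage_bigcup.
apply: measure_semi_sigma_additive.
- by move=> k; exact: lebesgueS_pre.
- apply/trivIsetP => /= i j _ _ ij; rewrite -preimage_setI.
  by move/trivIsetP : tF => /(_ _ _ _ _ ij) ->//; rewrite preimage_set0.
- by rewrite -preimage_bigcup; exact: lebesgueS_pre.
Qed.

HB.instance Definition _ := isMeasure.Build _ _ _ lebesgueS
  lebesgueS0 lebesgueS_ge0 lebesgueS_sigma_additive.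

Let lebesgueS_sigma_finite : sigma_finite setT lebesgueS.
Proof.
have /sigma_finiteP[F [TF ndF Foo]] := sigma_finiteT (@lebesgue_measure R).
have /sigma_finiteP[G [TG ndG Goo]] := sigma_finiteT mu.
exists (fun k => rV_uncons @^-1` (F k `*` G k)).
  rewrite -preimage_bigcup (_ : \bigcup_k _ = setT) ?preimage_setT//.
  rewrite -setXTT TF TG predeqE => -[x y]; split.
    by move=> [k _ []/= ? ?]; split; exists k.
  move=> [/= [k _ Fkx] [l _ Gly]]; exists (maxn k l) => //; split.
  - by move: x Fkx; exact/subsetPset/ndF/leq_maxl.
  - by move: y Gly; exact/subsetPset/ndG/leq_maxr.
move=> k; have [mF Fk] := Foo k; have [mG Gk] := Goo k; split.
  rewrite -[X in measurable X]setTI; apply: measurable_rV_uncons => //.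
  exact: measurableX.
rewrite /lebesgueS /pushforward -comp_preimage.
rewrite (_ : rV_uncons \o rV_cons = id) ?preimage_id; last first.
  by apply/funext => p; exact: rV_consK.
by rewrite product_measure1E// lte_mul_pinfty// ge0_fin_numE.
Qed.

HB.instance Definition _ := Measure_isSigmaFinite.Build _ _ _ lebesgueS
  lebesgueS_sigma_finite.

End rV_cons.

Section lebesgue_rV.
Variable R : realType.

(* Lebesgue measure on R^n, as an iterated product. *)
Fixpoint lebesgue n : {sigma_finite_measure set 'rV[R]_n -> \bar R} :=
  match n with
  | 0 => @dirac _ _ (0 : 'rV[R]_0) R
  | k.+1 => lebesgueS (lebesgue k)
  end.

End lebesgue_rV.
Arguments lebesgue {R n}.

Section sobolev.
Variables (R : realType) (d : nat).
Local Notation rV := 'rV[R]_d.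
Implicit Types (D C : set rV) (u v g phi : rV -> R).

Definition dot (x y : rV) : R := \sum_(i < d) x 0 i * y 0 i.

Definition partial (i : 'I_d) u : rV -> R := 'D_(delta_mx 0 i) u.

Definition smooth u := forall (s : seq 'I_d) (x : rV),
  differentiable (foldr partial u s) x.

(* C_c^oo(D) *)
Definition test_fun D phi := smooth phi /\
  exists C, [/\ compact C, C `<=` D & forall x, ~ C x -> phi x = 0].

Definition sqint D u : \bar R := (\int[lebesgue]_(x in D) ((u x) ^+ 2)%:E)%E.

Definition L2 D u := measurable_fun D u /\ (sqint D u < +oo)%E.

Definition is_weak_partial D (i : 'I_d) u g := L2 D g /\
  forall phi, test_fun D phi ->
    \int[lebesgue]_(x in D) (u x * partial i phi x) =
    - \int[lebesgue]_(x in D) (g x * phi x).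

(* A representative of the weak derivative of u|_D, which is determined up to a
   null set of D; meaningful when u is in H^1(D). *)
Definition weak_partial D (i : 'I_d) u : rV -> R :=
  xget (cst 0) [set g | is_weak_partial D i u g].

Definition weak_grad D u (x : rV) : rV := \row_i weak_partial D i u x.

Definition H1 D u := L2 D u /\ forall i, exists g, is_weak_partial D i u g.

(* The square of the norm of H^1(D). *)
Definition H1_sqnorm D u : \bar R :=
  (sqint D u + \sum_(i < d) sqint D (weak_partial D i u))%E.

(* H^1_0(D) is the closure of C_c^oo(D) in H^1(D). Elements are functions on
   the whole space of which only the restriction to D matters. *)
Definition H10 D u := H1 D u /\
  forall e : R, 0 < e ->
    exists2 phi, test_fun D phi & (H1_sqnorm D (u \- phi)%R < e%:E)%E.

(* The bilinear form of -m Delta + b . grad on D. *)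
Definition bilin (m : R) (b : rV) D u v : R :=
  \int[lebesgue]_(x in D)
    (m * dot (weak_grad D u x) (weak_grad D v x)
     + v x * dot b (weak_grad D u x)).

End sobolev.

Section mesh.
Variables (R : realType) (d : nat).
Local Notation rV := 'rV[R]_d.
Implicit Types (Omega : set rV) (v : rV -> R).

Definition hull n (p : 'I_n -> rV) (S : {set 'I_n}) : set rV :=
  [set x | exists w : 'I_n -> R, [/\ forall i, 0 <= w i,
     forall i, i \notin S -> w i = 0, \sum_i w i = 1 &
     x = \sum_i w i *: p i]].

Definition affinely_independent n (p : 'I_n -> rV) (S : {set 'I_n}) :=
  forall w : 'I_n -> R, (forall i, i \notin S -> w i = 0) ->
    \sum_i w i = 0 -> \sum_i w i *: p i = 0 -> forall i, w i = 0.

(* The polytope need not be convex; it is automatically open and bounded. *)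
Definition open_bounded_polytope Omega :=
  exists (n : nat) (p : 'I_n -> rV) (F : {set {set 'I_n}}),
    Omega = (\bigcup_(S in [set` F]) hull p S)°.

(* An element is given by the set of (the indices of) its vertices. *)
Record mesh := Mesh {
  nvert : nat;
  vert : 'I_nvert -> rV;
  elements : {set {set 'I_nvert}} }.

Definition closed_elt (T : mesh) (K : {set 'I_(nvert T)}) : set rV :=
  hull (@vert T) K.

Definition elt (T : mesh) (K : {set 'I_(nvert T)}) : set rV :=
  (closed_elt K)°.

Definition conforming_simplicial_mesh Omega (T : mesh) :=
  [/\ injective (@vert T),
      forall i, exists2 K, K \in elements T & i \in K,
      forall K, K \in elements T ->
        #|K| = d.+1 /\ affinely_independent (@vert T) K,
      closure Omega = \bigcup_(K in [set` elements T]) closed_elt K &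
      forall K K', K \in elements T -> K' \in elements T ->
        closed_elt K `&` closed_elt K' = closed_elt (K :&: K')].

Definition affine_on (D : set rV) v :=
  exists (g : rV) (c : R), forall x, D x -> v x = dot g x + c.

(* V_H; only the restriction of v to the closure of Omega matters. *)
Definition P1_space Omega (T : mesh) v :=
  [/\ {within closure Omega, continuous v},
      forall K, K \in elements T -> affine_on (closed_elt K) v &
      forall x, (closure Omega `\` Omega) x -> v x = 0].

Definition piecewise_constant Omega (T : mesh) (f : rV -> R) :=
  measurable_fun Omega f /\
  forall K, K \in elements T -> exists c, forall x, elt K x -> f x = c.

(* The basis functions are indexed by vertices, and only those at internal
   vertices are meaningful. *)
Definition nodal_basis Omega (T : mesh) (phi : 'I_(nvert T) -> rV -> R) :=
  forall i, Omega (vert i) -> P1_space Omega T (phi i) /\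
    forall j, Omega (vert j) -> phi i (vert j) = (i == j)%:R.

End mesh.

Section msfem.
Variables (R : realType) (d : nat) (m : R) (b : 'rV[R]_d).
Variables (Omega : set 'rV[R]_d) (T : mesh R d).
Local Notation rV := 'rV[R]_d.
Local Notation elts := (elements T).
Implicit Types (K : {set 'I_(nvert T)}) (u v f : rV -> R).

(* w is phi^adv for the nodal function phi; the condition w = phi on the
   boundary of K is expressed by w - phi being in H^1_0(K). *)
Definition is_adv_basis_fun (phi w : rV -> R) :=
  H10 Omega w /\ forall K, K \in elts ->
    H10 (elt K) (w \- phi) /\
    forall v, H10 (elt K) v -> bilin m b (elt K) w v = 0.

(* L B = 1 in K, B = 0 on the boundary of K *)
Definition is_bubble K (B : rV -> R) :=
  H10 (elt K) B /\ forall v, H10 (elt K) v ->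
    bilin m b (elt K) B v = \int[lebesgue]_(x in elt K) v x.

(* L chi = - L x^i in K, chi = 0 on the boundary of K and outside K *)
Definition is_corrector K (i : 'I_d) (chi : rV -> R) :=
  [/\ H10 (elt K) chi,
      forall v, H10 (elt K) v ->
        bilin m b (elt K) chi v = - bilin m b (elt K) (fun x => x 0 i) v &
      forall x, ~ elt K x -> chi x = 0].

(* V_H^adv, the span of the phi^adv at internal vertices; as in Sobolev spaces,
   functions are identified when they agree almost everywhere on Omega. *)
Definition adv_space (phiadv : 'I_(nvert T) -> rV -> R) u :=
  measurable_fun Omega u /\ exists c : 'I_(nvert T) -> R,
    u = (fun x => \sum_(i < nvert T | vert i \in Omega) c i * phiadv i x)
      %[ae lebesgue in Omega].

Definition adv_msfem_lin_solution (phiadv : 'I_(nvert T) -> rV -> R) f u :=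
  adv_space phiadv u /\ forall v, adv_space phiadv v ->
    bilin m b Omega u v = \int[lebesgue]_(x in Omega) (f x * v x).

(* u_H + sum_K sum_i (partial_i u_H|_K) chi_K^i *)
Definition add_correctors (chi : {set 'I_(nvert T)} -> 'I_d -> rV -> R) u
    (x : rV) : R :=
  u x + \sum_(K in elts) \sum_(i < d) weak_partial (elt K) i u x * chi K i x.

Definition tauB (B : {set 'I_(nvert T)} -> rV -> R) (x : rV) : R :=
  \sum_(K in elts)
    (\int[lebesgue]_(y in elt K) B K y / fine (lebesgue (elt K)))
      * \1_(elt K) x.

Definition stabilized_P1_solution (tau : rV -> R) f u :=
  P1_space Omega T u /\ forall v, P1_space Omega T v ->
    \sum_(K in elts) \int[lebesgue]_(x in elt K)
      (m * dot (weak_grad (elt K) u x) (weak_grad (elt K) v x)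
       + v x * dot b (weak_grad (elt K) u x)
       + tau x * dot b (weak_grad (elt K) u x) * dot b (weak_grad (elt K) v x))
    = \int[lebesgue]_(x in Omega)
        (f x * v x - tau x * f x * dot b (weak_grad Omega v x)).

End msfem.

(* Main.v *)
Require Import Defs.
From HB Require Import structures.
From mathcomp Require Import all_boot all_order all_algebra.
From mathcomp Require Import all_classical all_reals all_analysis.
From mathcomp Require Import measurable_realfun ring lra.
Import Order.TTheory GRing.Theory Num.Theory.
Import numFieldNormedType.Exports.

Set Implicit Arguments.
Unset Strict Implicit.
Unset Printing Implicit Defensive.

Local Open Scope classical_set_scope.
Local Open Scope ring_scope.

(** On an element K a multiscale function is u = p + sum_i g_i chi_i, where p is
    affine with gradient g ([corrected]).  The correctors are made so that
    a_K(u, w) = 0 for every w in H^1_0(K) ([corrected_harmonic]).  Hence, for a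
    test function v = q + sum_i h_i chi_i, the corrector part of v contributes
    nothing and a_K(u, v) = a_K(p, q) + sum_i g_i a_K(chi_i, q).  In
    a_K(chi_i, q) the diffusion term vanishes because the gradient h of q is
    constant and chi_i vanishes on the boundary, and the advection term is
    - (b . h) int_K chi_i by integration by parts.  The coefficients being
    constant, L chi_i = - b_i = L (- b_i B_K), so chi_i = - b_i B_K and the
    integral of chi_i is - b_i int_K B_K ([chi_bubble]).  This is the
    stabilization term (b . g) (b . h) int_K B_K ([bilin_corrected]), and the
    same substitution in int_K f v gives the modified right-hand side
    ([integral_corrected]).  Summing over the elements yields
    [bilin_stabilized] and [rhs_stabilized].

    The two discrete spaces correspond to each other: on K the difference
    between phi_i^adv and the corrected nodal function is in H^1_0(K) and is
    a_K-orthogonal to H^1_0(K), so it vanishes ([phiadv_corrected]); and an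
    affine function which is in H^1_0(K) is zero ([affine_H10_eq0]), so that the
    affine parts can be read off the multiscale function
    ([corrected_rep_uniq]).

    Membership in H^1_0(K) is used through integration by parts, which passes to
    the limit from test functions ([ip_by_parts]).  In particular, a function in H^1_0(K) extended by zero is
    in H^1(Omega) ([H10_grad_patch]), and phi_i belongs to H^1(Omega) because
    it differs from phi_i^adv by such extensions ([phi_grad]).  The statements
    about weak gradients make sense because weak derivatives are unique
    ([weak_partial_uniq]), which follows from the fundamental lemma of the
    calculus of variations ([fundamental_lemma]). *)

(** * Boxes *)
Section boxes.
Variables (R : realType) (n : nat).
Implicit Types (a c x : 'rV[R]_n) (U : set 'rV[R]_n).

Definition box a c : set 'rV[R]_n := [set x | forall i, a 0 i < x 0 i < c 0 i].

Definition cbox a c : set 'rV[R]_n :=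
  [set x | forall i, a 0 i <= x 0 i <= c 0 i].

Lemma box_cbox a c : box a c `<=` cbox a c.
Proof. by move=> x xac i; have /andP[/ltW -> /ltW ->] := xac i. Qed.

Lemma measurable_coord i (Y : set R) : measurable Y ->
  measurable [set x : 'rV[R]_n | Y (x 0 i)].
Proof.
move=> mY; rewrite -[X in measurable X]setTI.
exact: (@measurable_rV_coord R n i).
Qed.

Lemma measurable_forall_coord (Y : 'I_n -> set R) :
  (forall i, measurable (Y i)) ->
  measurable [set x : 'rV[R]_n | forall i, Y i (x 0 i)].
Proof.
move=> mY.
rewrite (_ : [set x | _] =
  \bigcap_(i in [set` finset.setT]) [set x : 'rV[R]_n | Y i (x 0 i)]).
  by apply: fin_bigcap_measurable => // i _; exact: measurable_coord.
by apply/seteqP; split => [x h i _|x h i]; [exact: h|apply: h; rewrite /= inE].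
Qed.

Lemma measurable_box a c : measurable (box a c).
Proof.
rewrite (_ : box a c = [set x | forall i, `]a 0 i, c 0 i[%classic (x 0 i)]).
  by apply: (measurable_forall_coord (Y := fun i => `]a 0 i, c 0 i[%classic)) => i;
    exact: measurable_itv.
by apply/seteqP; split => x h i; have := h i; rewrite /= in_itv.
Qed.

Lemma cbox_compact a c : compact (cbox a c).
Proof.
rewrite (_ : cbox a c = [set x | forall i, `[a 0 i, c 0 i]%classic (x ord0 i)]).
  by apply: (rV_compact (A := fun i => `[a 0 i, c 0 i]%classic)) => i;
    exact: segment_compact.
by apply/seteqP; split => x h i; have := h i; rewrite /= in_itv.
Qed.

Definition ratbox (p : 'rV[rat]_n * 'rV[rat]_n) : set 'rV[R]_n :=
  box (map_mx ratr p.1) (map_mx ratr p.2).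

(** The closed box also lies in U, so that bump functions supported in it are
    test functions in U. *)
Lemma open_ratbox U x : open U -> U x ->
  exists p : 'rV[rat]_n * 'rV[rat]_n,
    ratbox p x /\ cbox (map_mx ratr p.1) (map_mx ratr p.2) `<=` U.
Proof.
move=> oU Ux; have /nbhs_ballP[e /= e0 eU] : nbhs x U by exact: open_nbhs_nbhs.
have lt1 i : x 0 i - e < x 0 i by rewrite ltrBlDr ltrDl.
have lt2 i : x 0 i < x 0 i + e by rewrite ltrDl.
pose q1 i := sval (cid (rat_in_itvoo (lt1 i))).
pose q2 i := sval (cid (rat_in_itvoo (lt2 i))).
have q1P i : x 0 i - e < ratr (q1 i) < x 0 i.
  by rewrite /q1; case: cid => /= q; rewrite in_itv.
have q2P i : x 0 i < ratr (q2 i) < x 0 i + e.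
  by rewrite /q2; case: cid => /= q; rewrite in_itv.
exists (\row_i q1 i, \row_i q2 i); split => /=.
  move=> i; rewrite /= !mxE.
  by have /andP[_ ->] := q1P i; have /andP[-> _] := q2P i.
move=> y yq; apply: eU; split => // i j; rewrite !ord1.
have := yq j; rewrite !mxE => /andP[y1 y2].
have /andP[q11 q12] := q1P j; have /andP[q21 q22] := q2P j.
rewrite -ball_normE /= ltr_norml; lra.
Qed.

Lemma open_measurable_rV U : open U -> measurable U.
Proof.
move=> oU.
pose P := [set p | ratbox p `<=` U].
rewrite (_ : U = \bigcup_(p in P) ratbox p).
  rewrite bigcup_mkcond; apply: countable_bigcupT_measurable => // p.
  by case: ifP => // _; exact: measurable_box.
apply/seteqP; split => [x Ux|x [p]]; last by move=> Pp /Pp.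
have [p [px pU]] := open_ratbox oU Ux.
by exists p => //; exact: subset_trans (@box_cbox _ _) pU.
Qed.

Lemma closed_measurable_rV U : closed U -> measurable U.
Proof.
by move=> cU; rewrite -(setCK U); apply: measurableC;
  exact: open_measurable_rV (closed_openC cU).
Qed.

Lemma continuous_measurable_rV (f : 'rV[R]_n -> R) : continuous f ->
  forall D : set 'rV[R]_n, measurable_fun D f.
Proof.
move=> cf D; apply: (@measurable_funS _ _ _ _ setT) => //.
apply: (measurability _ (measurable_realfun.RGenOpens.measurableE R)).
move=> _ [_ [a [c ->] <-]]; rewrite setTI; apply: open_measurable_rV.
by apply: open_comp => // x _; exact: cf.
Qed.

End boxes.

(** By induction on the dimension: a box is the product of an interval and of a
    box of lower dimension. *)
Lemma lebesgue_box (R : realType) n (a c : 'rV[R]_n) :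
  (forall i, a 0 i <= c 0 i) ->
  lebesgue (box a c) = (\prod_i (c 0 i - a 0 i))%:E.
Proof.
elim: n a c => [|n IH] a c ac.
  by rewrite big_ord0 /= diracE mem_set// => -[].
pose tl (z : 'rV[R]_n.+1) : 'rV[R]_n := \row_j z 0 (lift ord0 j).
rewrite /= /lebesgueS /pushforward.
rewrite (_ : _ @^-1` _ = `]a 0 ord0, c 0 ord0[ `*` box (tl a) (tl c)); last first.
  apply/seteqP; split => [[x y]/= h|[x y]/= [h1 h2] i].
    split; first by have := h ord0; rewrite mxE unlift_none in_itv.
    by move=> i; have := h (lift ord0 i); rewrite !mxE liftK.
  rewrite mxE; case: unliftP => [j ->|->] //=.
    by have := h2 j; rewrite !mxE.
rewrite product_measure1E//; last exact: measurable_box.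
rewrite [X in (X * _)%E]lebesgue_measure_itv/= lte_fin big_ord_recl EFinM.
rewrite IH; last first.
  by move=> i; rewrite !mxE.
under [in RHS]eq_bigr do [].
have := ac ord0; rewrite le_eqVlt => /orP[/eqP ->|->].
  by rewrite ltxx subrr !mul0e.
by congr (_ * _)%E; congr EFin; apply: eq_bigr => i _; rewrite !mxE.
Qed.

Lemma lebesgue_box_lty (R : realType) n (a c : 'rV[R]_n) :
  (lebesgue (box a c) < +oo)%E.
Proof.
have [ac|] := pselect (forall i, a 0 i <= c 0 i).
  by rewrite lebesgue_box// ltry.
move=> /existsNP[i /negP]; rewrite -ltNge => ca.
rewrite (_ : box a c = set0) ?measure0//; apply/seteqP; split => // x /(_ i).
by move=> /andP[h1 h2]; have := lt_trans (lt_trans h1 h2) ca; rewrite ltxx.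
Qed.

Lemma lebesgue_open_gt0 (R : realType) n (U : set 'rV[R]_n) :
  open U -> U !=set0 -> (0 < lebesgue U)%E.
Proof.
move=> oU [x Ux]; have [p [px pU]] := open_ratbox oU Ux.
have p0 : (0 < lebesgue (@ratbox R n p))%E.
  rewrite lebesgue_box; last first.
    by move=> i; have /andP[h1 h2] := px i; exact: ltW (lt_trans h1 h2).
  rewrite lte_fin; apply: prodr_gt0 => i _; rewrite subr_gt0.
  by have /andP[h1 h2] := px i; exact: lt_trans h1 h2.
apply: (lt_le_trans p0).
apply: le_measure; rewrite ?inE.
- exact: measurable_box.
- exact: open_measurable_rV.
- exact: subset_trans (@box_cbox _ _ _ _) pU.
Qed.

(** * Slices, hyperplanes and integrability *)
Section slices.
Variables (R : realType) (n : nat).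

(** Tonelli's theorem.  The exceptional slice t0 serves for hyperplanes
    orthogonal to the first axis. *)
Lemma null_slices (A : set 'rV[R]_n.+1) (t0 : R) : measurable A ->
  (forall t, t != t0 -> lebesgue [set y | A (rV_cons (t, y))] = 0%E) ->
  lebesgue A = 0%E.
Proof.
move=> mA A0; rewrite /= /lebesgueS /pushforward.
have mA' : measurable (@rV_cons R n @^-1` A : set (R * 'rV[R]_n)).
  by rewrite -[X in measurable X]setTI; exact: measurable_rV_cons.
rewrite /product_measure1 -[RHS](@integral0 _ _ R (@lebesgue_measure R) setT).
apply: ge0_ae_eq_integral => //.
  exact: measurable_fun_xsection.
exists [set t0]; split; first exact: measurable_set1.
  exact: lebesgue_measure_set1.
move=> t /=; apply: contra_notP => /eqP tt0 _.
by rewrite -(A0 t tt0); congr (lebesgue _); apply/seteqP; split => y /=;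
  rewrite /xsection /= inE.
Qed.

Variable f : 'rV[R]_n.+1 -> \bar R.
Hypothesis If : (@lebesgue R n.+1).-integrable setT f.

Let mf : measurable_fun [set: 'rV[R]_n.+1] f. Proof. by case/integrableP : If. Qed.

(** Lebesgue measure on R lives on the copy measurableTypeR of R. *)
Let RrV := (measurableTypeR R * 'rV[R]_n)%type.

Let mcons : measurable_fun [set: RrV] (@rV_cons R n).
Proof. exact: measurable_rV_cons. Qed.

Let prodm : {measure set RrV -> \bar R} :=
  (@lebesgue_measure R \x @lebesgue R n)%E.

Let If' : prodm.-integrable setT (f \o @rV_cons R n).
Proof.
apply/integrableP; split; first exact: measurableT_comp mf mcons.
case/integrableP : If => _.
rewrite (ge0_integral_pushforward mcons prodm _ (f := abse \o f))//.
  exact: measurableT_comp.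
by move=> y _; exact: abse_ge0.
Qed.

Lemma integral_slice12 : (\int[lebesgue]_x f x
   = \int[lebesgue_measure]_t \int[lebesgue]_y f (rV_cons (t, y)))%E.
Proof.
rewrite (integral12_prod_meas1 If').
exact: (integral_pushforward mcons mf If' measurableT).
Qed.

Lemma integral_slice21 : (\int[lebesgue]_x f x
   = \int[lebesgue]_y \int[lebesgue_measure]_t f (rV_cons (t, y)))%E.
Proof.
rewrite (integral21_prod_meas1 If').
exact: (integral_pushforward mcons mf If' measurableT).
Qed.

End slices.

Lemma differentiable_dot (R : realType) n (g x : 'rV[R]_n) :
  differentiable (dot g) x.
Proof.
rewrite (_ : dot g = \sum_(i < n) (fun y : 'rV[R]_n => g 0 i * y 0 i)); last first.
  by apply/funext => y; rewrite fct_sumE.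
apply: differentiable_sum => i; apply: differentiableM => //.
exact: differentiable_coord.
Qed.

Lemma continuous_dot (R : realType) n (g : 'rV[R]_n) : continuous (dot g).
Proof. by move=> x; exact/differentiable_continuous/differentiable_dot. Qed.

(** By induction on the dimension: the slices are hyperplanes of lower dimension
    or, if the normal is along the first axis, all empty except one. *)
Lemma null_hyperplane (R : realType) n (g : 'rV[R]_n) (c : R) :
  g != 0 -> lebesgue [set x | dot g x = c] = 0%E.
Proof.
elim: n g c => [|n IH] g c g0; first by rewrite (thinmx0 g) eqxx in g0.
have mH : measurable [set x | dot g x = c].
  apply: closed_measurable_rV.
  rewrite (_ : mkset _ = dot g @^-1` [set c])//.
  by apply: preimage_closed => [x _|]; [exact: continuous_dot|exact: closed_eq].
pose h : 'rV[R]_n := \row_j g 0 (lift ord0 j).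
have dotE t y : dot g (rV_cons (t, y)) = g 0 ord0 * t + dot h y.
  rewrite /dot big_ord_recl !mxE unlift_none; congr (_ + _).
  by apply: eq_bigr => i _; rewrite !mxE liftK.
apply: (@null_slices _ _ _ (c / g 0 ord0)) => // t tc.
have [h0|h0] := eqVneq h 0; last first.
  rewrite -[RHS](IH h (c - g 0 ord0 * t) h0); congr (lebesgue _).
  by apply/seteqP; split => y /=; rewrite dotE; lra.
have g00 : g 0 ord0 != 0.
  apply: contra g0 => /eqP g00; apply/eqP/rowP => i; rewrite mxE.
  case: (unliftP ord0 i) => [j ->|-> //].
  by have /rowP/(_ j) := h0; rewrite !mxE.
rewrite (_ : mkset _ = set0) ?measure0//; apply/seteqP; split => // y /=.
rewrite dotE /dot big1 ?addr0; last by move=> i _; rewrite h0 mxE mul0r.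
by move=> gt; move/eqP: tc; apply; rewrite -gt mulrAC divff ?mul1r.
Qed.

Lemma continuous_cbox_bounded (R : realType) n (f : 'rV[R]_n -> R) a c :
  continuous f -> exists2 M, 0 <= M & forall x, cbox a c x -> `|f x| <= M.
Proof.
move=> cf.
have /compact_bounded[M [_ Mf]] : compact (f @` cbox a c).
  apply: continuous_compact; last exact: cbox_compact.
  exact: continuous_subspaceT.
exists (`|M| + 1) => [|x xac]; first by rewrite addr_ge0.
by apply: Mf; [rewrite ltr_pwDr// ler_norm|exists x].
Qed.

Lemma continuous_box_integrable (R : realType) n (f : 'rV[R]_n -> R) a c :
  continuous f -> (forall x, ~ box a c x -> f x = 0) ->
  (@lebesgue R n).-integrable setT (EFin \o f).
Proof.
move=> cf f0.
rewrite (_ : EFin \o f = (EFin \o f : 'rV[R]_n -> \bar R) \_ (box a c)); last first.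
  apply/funext => x; rewrite patchE; case: ifPn => // xac /=.
  by rewrite f0// => xac'; rewrite mem_set in xac.
apply/(integrable_mkcond _ (measurable_box a c)).
apply: measurable_bounded_integrable.
- exact: measurable_box.
- exact: lebesgue_box_lty.
- exact: continuous_measurable_rV.
- have [M _ Mf] := continuous_cbox_bounded a c cf.
  exists M; split; rewrite ?num_real// => y My x xac.
  by apply: le_trans (ltW My); apply: Mf; exact: box_cbox.
Qed.

(** * The integral of a derivative *)
Section slice_derivatives.
Variables (R : realType) (n : nat).
Implicit Types (f : 'rV[R]_n.+1 -> R) (t : R) (y : 'rV[R]_n).

Lemma rV_cons_shift_lift h j t y :
  h *: delta_mx 0 (lift ord0 j) + rV_cons (t, y)
  = rV_cons (t, h *: delta_mx 0 j + y).
Proof.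
apply/rowP => i; rewrite !mxE /=; case: unliftP => [k ->|->] /=.
  by rewrite !mxE /= (inj_eq (@lift_inj _ _)).
by rewrite mulr0 add0r.
Qed.

Lemma rV_cons_shift0 h t y :
  h *: delta_mx 0 ord0 + rV_cons (t, y) = rV_cons (h *: 1 + t, y).
Proof.
apply/rowP => i; rewrite !mxE /=; case: unliftP => [k ->|->] /=.
  by rewrite mulr0 add0r.
by [].
Qed.

Lemma slice_lift f t j y :
  (fun h => h^-1 *: ((f \o shift (rV_cons (t, y)))
                       (h *: delta_mx 0 (lift ord0 j)) - f (rV_cons (t, y))))
  = (fun h => h^-1 *: (((fun z => f (rV_cons (t, z))) \o shift y)
                       (h *: delta_mx 0 j) - f (rV_cons (t, y)))).
Proof. by apply/funext => h; rewrite /= rV_cons_shift_lift. Qed.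

Lemma slice0 f t y :
  (fun h => h^-1 *: ((f \o shift (rV_cons (t, y)))
                       (h *: delta_mx 0 ord0) - f (rV_cons (t, y))))
  = (fun h : R => h^-1 *: (((fun s => f (rV_cons (s, y))) \o shift t)
                       (h *: 1) - f (rV_cons (t, y)))).
Proof. by apply/funext => h; rewrite /= rV_cons_shift0. Qed.

Lemma partial_slice_lift f t j y :
  partial (lift ord0 j) f (rV_cons (t, y))
  = partial j (fun z => f (rV_cons (t, z))) y.
Proof. by rewrite /partial /derive slice_lift. Qed.

Lemma derivable_slice_lift f t j y :
  derivable f (rV_cons (t, y)) (delta_mx 0 (lift ord0 j)) ->
  derivable (fun z => f (rV_cons (t, z))) y (delta_mx 0 j).
Proof. by rewrite /derivable slice_lift. Qed.

Lemma partial_slice0 f t y :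
  partial ord0 f (rV_cons (t, y)) = 'D_1 (fun s => f (rV_cons (s, y))) t.
Proof. by rewrite /partial /derive slice0. Qed.

Lemma derivable_slice0 f t y :
  derivable f (rV_cons (t, y)) (delta_mx 0 ord0) ->
  derivable (fun s => f (rV_cons (s, y))) t 1.
Proof. by rewrite /derivable slice0. Qed.

Lemma continuous_rV_cons_r t : continuous (fun y => rV_cons (t, y)).
Proof.
move=> y U /nbhs_ballP[e /= e0 eU]; apply/nbhs_ballP; exists e => //= z [_ yz].
apply: eU; split => // i k; rewrite !mxE.
by case: unliftP => [j _|_] /=; [exact: yz|exact: ballxx].
Qed.

Lemma continuous_rV_cons_l y : continuous (fun t => rV_cons (t, y)).
Proof.
move=> t U /nbhs_ballP[e /= e0 eU]; apply/nbhs_ballP; exists e => //= s ts.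
apply: eU; split => // i k; rewrite !mxE.
by case: unliftP => [j _|_] /=; [exact: ballxx|exact: ts].
Qed.

End slice_derivatives.

(** The fundamental theorem of calculus on an interval larger than the support. *)
Lemma integral_derive1_eq0 (R : realType) (f : R -> R) (M : R) :
  (forall t, derivable f t 1) -> continuous ('D_1 f) ->
  (forall t, M <= `|t| -> f t = 0) ->
  (forall t, M <= `|t| -> 'D_1 f t = 0) ->
  (\int[lebesgue_measure]_t ('D_1 f t)%:E = 0)%E.
Proof.
move=> df cf' f0 f'0; pose N := `|M| + 1.
have N0 : 0 < N by rewrite /N ltr_wpDl.
have MN t : N <= `|t| -> M <= `|t|.
  by apply: le_trans; rewrite /N (le_trans (ler_norm M))// lerDl.
have cf : continuous f.
  by move=> t; apply: differentiable_continuous; exact/derivable1_diffP.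
transitivity (\int[lebesgue_measure]_(t in `[(- N)%R, N]) ('D_1 f t)%:E)%E.
  rewrite [RHS]integral_mkcond; apply: eq_integral => t _.
  rewrite patchE; case: ifPn => // /negP tN; rewrite f'0//; apply: MN.
  rewrite leNgt; apply/negP => tN'; apply: tN.
  by rewrite inE /= in_itv /= -ler_norml ltW.
rewrite (@continuous_FTC2 _ _ f)//.
- by rewrite !f0 ?subee//; apply: MN; rewrite ?normrN ger0_norm// ltW.
- by rewrite gtrN.
- exact: continuous_subspaceT.
- split => [t _|//|].
  + exact: df.
  + by apply: cvg_at_right_filter; exact: cf.
  + by apply: cvg_at_left_filter; exact: cf.
- by move=> t _; rewrite derive1E.
Qed.

(** Fubini's theorem brings the derivative to the innermost integral, after an
    induction on the dimension that reaches the i-th coordinate. *)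
Lemma integral_partial_eq0 (R : realType) n (f : 'rV[R]_n -> R) i (M : R) :
  (forall x, derivable f x (delta_mx 0 i)) -> continuous (partial i f) ->
  (forall x : 'rV[R]_n, (exists j, M <= `|x 0 j|) -> f x = 0) ->
  (forall x : 'rV[R]_n, (exists j, M <= `|x 0 j|) -> partial i f x = 0) ->
  (\int[@lebesgue R n]_x (partial i f x)%:E = 0)%E.
Proof.
elim: n f i => [f []//|n IH f i] df cf' f0 f'0.
have If : (@lebesgue R n.+1).-integrable setT (EFin \o partial i f).
  apply: (@continuous_box_integrable _ _ _ (const_mx (- M)) (const_mx M)) => //.
  move=> x /existsNP[j /negP]; rewrite !mxE -ltr_norml -leNgt => Mx.
  by apply: f'0; exists j.
case: (unliftP ord0 i) => [j ij|i0].
  rewrite (integral_slice12 If); apply: integral0_eq => t _ /=.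
  rewrite (eq_integral (fun y => (partial j (fun z => f (rV_cons (t, z))) y)%:E));
    last by move=> y _; rewrite ij partial_slice_lift.
  have out (y : 'rV[R]_n) : (exists k, M <= `|y 0 k|) ->
      exists k, M <= `|rV_cons (t, y) 0 k|.
    by move=> [k Mk]; exists (lift ord0 k); rewrite mxE liftK.
  apply: IH.
  - by move=> y; apply: derivable_slice_lift; rewrite -ij.
  - rewrite (_ : partial j _ = partial i f \o (fun y => rV_cons (t, y))).
      move=> y; apply: continuous_comp; first exact: continuous_rV_cons_r.
      exact: cf'.
    by apply/funext => y; rewrite -partial_slice_lift ij.
  - by move=> y /out/f0.
  - by move=> y /out/f'0; rewrite -partial_slice_lift ij.
rewrite (integral_slice21 If); apply: integral0_eq => y _ /=.
rewrite (eq_integral (fun t : measurableTypeR R =>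
    ('D_1 (fun s : R => f (rV_cons (s, y))) (t : R))%:E));
  last by move=> t _; rewrite i0 partial_slice0.
have out (t : R) : M <= `|t| -> exists k, M <= `|rV_cons (t, y) 0 k|.
  by move=> Mt; exists ord0; rewrite mxE unlift_none.
apply: (@integral_derive1_eq0 _ _ M).
- by move=> t; apply: derivable_slice0; rewrite -i0.
- rewrite (_ : 'D_1 (fun s : R => f (rV_cons (s, y)))
            = partial i f \o (fun t : R => rV_cons (t, y))).
    move=> t; apply: continuous_comp; first exact: continuous_rV_cons_l.
    exact: cf'.
  by apply/funext => t; rewrite -partial_slice0 i0.
- by move=> t /out/f0.
- by move=> t /out/f'0; rewrite -partial_slice0 i0.
Qed.

(** * The flat function exp(-1/t) *)
Section expinv.
Variable R : realType.
Implicit Types (t : R) (k : nat).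

(** The functions exp(-1/t) / t^k, extended by 0 for t <= 0.  The derivative of
    the k-th one is a combination of the next two, so that all of them are smooth
    and a single induction treats all orders of differentiation. *)
Definition expinv k t : R := if 0 < t then t^-1 ^+ k * expR (- t^-1) else 0.

Lemma expinv_le0 k t : t <= 0 -> expinv k t = 0.
Proof. by rewrite /expinv leNgt => /negbTE ->. Qed.

Lemma expinv_ge0 k t : 0 <= expinv k t.
Proof.
rewrite /expinv; case: ifPn => // t0.
by rewrite mulr_ge0 ?expR_ge0// exprn_ge0// invr_ge0 ltW.
Qed.

(** With y = 1/t, from exp y >= y^(k+1) / (k+1)!. *)
Lemma expinv_le k t : `|expinv k t| <= (k.+1)`!%:R * `|t|.
Proof.
have [t0|t0] := ltP 0 t; last by rewrite expinv_le0// normr0 mulr_ge0.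
rewrite ger0_norm ?expinv_ge0// gtr0_norm// /expinv t0.
set y := t^-1; have y0 : 0 < y by rewrite invr_gt0.
have := expR_ge1Dxn k (ltW y0); rewrite -/y => h.
have {}h : y ^+ k.+1 / (k.+1)`!%:R <= expR y.
  by apply: le_trans h; rewrite lerDr.
rewrite ler_pdivrMr ?ltr0n ?fact_gt0// in h.
rewrite expRN ler_pdivrMr ?expR_gt0//.
have -> : y ^+ k = y ^+ k.+1 * t by rewrite exprSr -mulrA mulVf ?mulr1// gt_eqF.
by rewrite -mulrA [_ * expR y]mulrC mulrA ler_pM2r// mulrC.
Qed.

Lemma expinv_cvg0 k : expinv k t @[t --> 0] --> 0.
Proof.
apply/cvgr0Pnorm_le => e e0; near=> t.
apply: (le_trans (expinv_le k t)).
rewrite mulrC -ler_pdivlMr ?ltr0n ?fact_gt0//.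
near: t; apply: cvgr0_norm_le => //.
by rewrite divr_gt0// ltr0n fact_gt0.
Unshelve. all: by end_near. Qed.

(** At t = 0 the difference quotient of the k-th function is the (k+1)-st one,
    which tends to 0. *)
Lemma is_derive_expinv k t :
  is_derive t 1 (expinv k) (expinv k.+2 t - k%:R * expinv k.+1 t).
Proof.
have [t0|t0|->] := ltgtP t 0.
- rewrite !expinv_le0 ?ltW// mulr0 subr0.
  apply: (near_eq_is_derive _ (is_derive_cst 0 t 1)).
  by near=> s; rewrite expinv_le0// ltW//; near: s; exact: lt_nbhsl.
- pose f : R -> R := fun s => s^-1 ^+ k * expR (- s^-1).
  have df : is_derive t 1 f (expinv k.+2 t - k%:R * expinv k.+1 t).
    have tn0 : t != 0 by rewrite gt_eqF.
    have di := is_deriveV tn0 (is_derive_id t (1 : R)).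
    have dX := is_deriveX k di.
    have dN := is_deriveN di.
    have dE := is_derive1_comp (is_derive_expR _) dN.
    have dM := is_deriveM dX dE.
    rewrite exprfctE in dM.
    refine (@is_derive_eq _ _ _ f _ _ _ _ dM _) => /=.
    rewrite /expinv t0 /GRing.scale /= !mulr1.
    set e := expR _; rewrite exprVn.
    case: (k) => [|j] /=; first by rewrite !expr0 !mul0r !mul1r; field.
    rewrite !exprVn !exprS; field.
    by rewrite expf_neq0// tn0.
  apply: (near_eq_is_derive _ df).
  near=> s; rewrite /f /expinv ifT//; near: s; exact: lt_nbhsr.
- rewrite !expinv_le0// mulr0 subr0.
  have E : (h^-1 *: ((expinv k \o shift 0) (h *: 1) - expinv k 0))
       @[h --> 0^'] --> (0 : R).
    apply: (@cvg_trans _ (expinv k.+1 h @[h --> 0^'])); last first.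
      by apply: cvg_within_filter; exact: expinv_cvg0.
    apply: near_eq_cvg; near=> h.
    have h0 : h != 0 by near: h; exact: nbhs_dnbhs_neq.
    rewrite /= addr0 {1}/GRing.scale /= {1}/GRing.scale /= mulr1.
    rewrite (expinv_le0 k (lexx 0)) subr0 /expinv.
    by case: ifP => _; rewrite ?mulr0// mulrA -exprS.
  split; first by apply/cvg_ex; exists 0.
  exact/cvg_lim.
Unshelve. all: by end_near. Qed.

Lemma differentiable_expinv k t : differentiable (expinv k) t.
Proof.
by apply/derivable1_diffP; have [] := is_derive_expinv k t.
Qed.

Lemma derive1_expinv k t :
  derive1 (expinv k) t = expinv k.+2 t - k%:R * expinv k.+1 t.
Proof. by rewrite derive1E; have [_ ->] := is_derive_expinv k t. Qed.

Lemma expinv0_le1 t : expinv 0 t <= 1.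
Proof.
rewrite /expinv; case: ifPn => // t0.
by rewrite mul1r -expR0 ler_expR oppr_le0 invr_ge0 ltW.
Qed.

(** Dilation turns exp(-1/t) into an approximation of the indicator of the
    positive half-line, which is bounded by 1. *)
Lemma expinv0_dilate_cvg t : 0 < t -> expinv 0 (t *+ n) @[n --> \oo] --> (1 : R).
Proof.
move=> t0; rewrite -(@cvg_shiftS _ (fun n => expinv 0 (t *+ n))) /=.
rewrite (_ : (fun n => _) = expR \o (fun n : nat => - (t^-1 * n.+1%:R^-1))); last first.
  apply/funext => n; rewrite /expinv pmulrn_lgt0// t0 expr0 mul1r /=.
  by rewrite -[t *+ n.+1]mulr_natr invfM.
have : expR (- (t^-1 * n.+1%:R^-1)) @[n --> \oo] --> expR (- (t^-1 * 0)).
  apply: continuous_cvg; first exact: continuous_expR.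
  by apply: cvgN; apply: cvgM; [exact: cvg_cst|exact: cvg_harmonic].
by rewrite mulr0 oppr0 expR0.
Qed.

End expinv.

(** * Smooth functions and test functions *)
Section smooth.
Variables (R : realType) (d : nat).
Local Notation rV := 'rV[R]_d.
Implicit Types (u v : rV -> R) (g x : rV) (G : (rV -> R) -> Prop).

(** The algebra generated by a family of functions.  It is used to prove
    smoothness: a family whose partial derivatives remain in the algebra consists
    of smooth functions. *)
Inductive alg_closure G : (rV -> R) -> Prop :=
| alg_gen u : G u -> alg_closure G u
| alg_cst c : alg_closure G (cst c)
| alg_add u v : alg_closure G u -> alg_closure G v -> alg_closure G (u + v)
| alg_mul u v : alg_closure G u -> alg_closure G v -> alg_closure G (u * v).

Lemma partialD i u v : (forall x, differentiable u x) ->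
  (forall x, differentiable v x) ->
  partial i (u + v) = partial i u + partial i v.
Proof.
by move=> du dv; apply/funext => x; rewrite /partial deriveD//;
  exact: diff_derivable.
Qed.

Lemma partialM i u v : (forall x, differentiable u x) ->
  (forall x, differentiable v x) ->
  partial i (u * v) = u * partial i v + v * partial i u.
Proof.
by move=> du dv; apply/funext => x; rewrite /partial deriveM//;
  exact: diff_derivable.
Qed.

Lemma partial_cst i (c : R) : partial i (cst c : rV -> R) = cst 0.
Proof. by apply/funext => x; rewrite /partial derive_cst. Qed.

(** By the sum and product rules the algebra is stable under differentiation. *)
Lemma alg_closure_smooth G :
  (forall u, G u -> forall x, differentiable u x) ->
  (forall u i, G u -> alg_closure G (partial i u)) ->
  forall u, alg_closure G u -> smooth u.
Proof.
move=> dG pG.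
have dA u : alg_closure G u -> forall x, differentiable u x.
  elim=> [{}u /dG//|c x|{}u v _ du _ dv x|{}u v _ du _ dv x] //.
  - exact: differentiableD.
  - exact: differentiableM.
have pA u i : alg_closure G u -> alg_closure G (partial i u).
  elim=> [{}u /pG//|c|{}u v Au pu Av pv|{}u v Au pu Av pv].
  - by rewrite partial_cst; exact: alg_cst.
  - by rewrite partialD; [exact: alg_add|exact: dA|exact: dA].
  - by rewrite partialM; [apply: alg_add; exact: alg_mul|exact: dA|exact: dA].
move=> u Au s; suff : alg_closure G (foldr (@partial R d) u s) by exact: dA.
by elim: s => //= i s IH; exact: pA.
Qed.

Lemma smooth_diff u x : smooth u -> differentiable u x.
Proof. by move=> /(_ [::]); exact. Qed.

Lemma smooth_continuous u : smooth u -> continuous u.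
Proof. by move=> su x; exact/differentiable_continuous/smooth_diff. Qed.

Lemma smooth_partial i u : smooth u -> smooth (partial i u).
Proof. by move=> su s x; have := su (rcons s i) x; rewrite foldr_rcons. Qed.

Lemma smooth_closure u : alg_closure (@smooth R d) u -> smooth u.
Proof.
apply: alg_closure_smooth => [{}u su x|{}u i su]; first exact: smooth_diff.
by apply: alg_gen; exact: smooth_partial.
Qed.

Lemma smoothD u v : smooth u -> smooth v -> smooth (u + v).
Proof.
by move=> su sv; apply: smooth_closure; apply: alg_add; exact: alg_gen.
Qed.

Lemma smoothM u v : smooth u -> smooth v -> smooth (u * v).
Proof.
by move=> su sv; apply: smooth_closure; apply: alg_mul; exact: alg_gen.
Qed.

Lemma smooth_cst (c : R) : smooth (cst c : rV -> R).
Proof. by apply: smooth_closure; exact: alg_cst. Qed.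

Lemma smooth_prod (I : Type) (r : seq I) (F : I -> rV -> R) :
  (forall i, smooth (F i)) -> smooth (\prod_(i <- r) F i).
Proof.
move=> sF; elim/big_rec : _ => [|i u _ su]; first exact: smooth_cst.
exact: smoothM.
Qed.

Lemma dotDr g x y : dot g (x + y) = dot g x + dot g y.
Proof.
by rewrite /dot -big_split; apply: eq_bigr => i _; rewrite !mxE mulrDr.
Qed.

Lemma dotZr g (h : R) x : dot g (h *: x) = h * dot g x.
Proof.
by rewrite /dot mulr_sumr; apply: eq_bigr => i _; rewrite !mxE mulrCA.
Qed.

Lemma dotDZl (c : R) g g' x : dot (c *: g + g') x = c * dot g x + dot g' x.
Proof.
rewrite /dot mulr_sumr -big_split; apply: eq_bigr => i _.
by rewrite !mxE mulrDl mulrA.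
Qed.

Lemma dot_delta g i : dot g (delta_mx 0 i) = g 0 i.
Proof.
rewrite /dot (bigD1 i)//= !mxE !eqxx mulr1 big1 ?addr0// => j ji.
by rewrite mxE (negbTE ji) andbF mulr0.
Qed.

Definition affine g (c : R) : rV -> R := fun x => dot g x + c.

Lemma affine_diff g c x : differentiable (affine g c) x.
Proof.
by rewrite /affine; apply: differentiableD => //; exact: differentiable_dot.
Qed.

Lemma partial_affine g c i : partial i (affine g c) = cst (g 0 i).
Proof.
apply/funext => x; rewrite /partial /derive; apply/cvg_lim => //.
apply: (@cvg_trans _ ((cst (g 0 i) : R -> R) @ 0^')); last exact: cvg_cst.
apply: near_eq_cvg; near=> h.
have h0 : h != 0 by near: h; exact: nbhs_dnbhs_neq.
rewrite /affine /= dotDr dotZr dot_delta opprD addrACA subrr addr0 addrK.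
by rewrite /GRing.scale /= mulrA mulVf// mul1r.
Unshelve. all: by end_near. Qed.

Lemma smooth_affine g c : smooth (affine g c).
Proof.
apply: (@alg_closure_smooth (fun u => u = affine g c)); last exact: alg_gen.
- by move=> u -> x; exact: affine_diff.
- by move=> u i ->; rewrite partial_affine; exact: alg_cst.
Qed.

(** The ridge functions of all orders k are taken together as generators: the
    derivative of the one of order k involves those of orders k.+1 and k.+2. *)
Lemma smooth_expinv g c k : smooth (expinv k \o affine g c).
Proof.
apply: (@alg_closure_smooth (fun u => exists k, u = expinv k \o affine g c));
  last by apply: alg_gen; exists k.
- move=> u [{}k ->] x.
  by apply: differentiable_comp; [exact: affine_diff|exact: differentiable_expinv].
- move=> u i [{}k ->].
  rewrite (_ : partial i _ = cst (g 0 i) * ((expinv k.+2 \o affine g c)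
    + cst (- k%:R) * (expinv k.+1 \o affine g c))).
    apply: alg_mul; first exact: alg_cst.
    apply: alg_add; first by apply: alg_gen; exists k.+2.
    by apply: alg_mul; [exact: alg_cst|apply: alg_gen; exists k.+1].
  apply/funext => x; rewrite /partial deriveE; last first.
    by apply: differentiable_comp; [exact: affine_diff|exact: differentiable_expinv].
  rewrite diff_comp; [|exact: affine_diff|exact: differentiable_expinv].
  rewrite /= diff1E; last exact: differentiable_expinv.
  rewrite derive1_expinv -deriveE; last exact: affine_diff.
  have := congr1 (@^~ x) (partial_affine g c i); rewrite /partial => ->.
  by rewrite /GRing.scale /= mulNr.
Qed.

End smooth.

Section test_functions.
Variables (R : realType) (d : nat).
Local Notation rV := 'rV[R]_d.
Implicit Types (D C : set rV) (phi psi : rV -> R).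

Lemma test_funS D E phi : D `<=` E -> test_fun D phi -> test_fun E phi.
Proof.
move=> DE [sphi [C [cC CD C0]]]; split => //.
by exists C; split => //; exact: subset_trans DE.
Qed.

Lemma test_fun_notin D phi x : test_fun D phi -> ~ D x -> phi x = 0.
Proof. by move=> [_ [C [_ CD C0]]] nDx; apply: C0 => /CD. Qed.

Lemma test_fun_mul D phi psi : smooth psi -> test_fun D phi ->
  test_fun D (psi * phi).
Proof.
move=> spsi [sphi [C [cC CD C0]]]; split; first exact: smoothM.
by exists C; split => // x /C0 phi0; rewrite /GRing.mul /= phi0 mulr0.
Qed.

Lemma test_funD D phi psi : test_fun D phi -> test_fun D psi ->
  test_fun D (phi + psi).
Proof.
move=> [sphi [C [cC CD C0]]] [spsi [E [cE ED E0]]]; split; first exact: smoothD.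
exists (C `|` E); split; first exact: compactU.
- by move=> x [/CD|/ED].
- move=> x /not_orP[nC nE].
  by rewrite /GRing.add /= C0// E0// addr0.
Qed.

Lemma rV_hausdorff : hausdorff_space rV.
Proof. exact: norm_hausdorff. Qed.

Lemma partial_notin C phi i x : closed C -> (forall y, ~ C y -> phi y = 0) ->
  ~ C x -> partial i phi x = 0.
Proof.
move=> cC C0 nCx.
rewrite /partial (@near_eq_derive _ _ _ _ (cst 0)) ?derive_cst//.
have : nbhs x (~` C) by apply: open_nbhs_nbhs; split => //; exact: closed_openC.
by apply: filterS => y /C0.
Qed.

Lemma test_fun_partial D phi i : test_fun D phi -> test_fun D (partial i phi).
Proof.
move=> [sphi [C [cC CD C0]]]; split; first exact: smooth_partial.
exists C; split => // x; apply: partial_notin => //.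
exact: compact_closed rV_hausdorff cC.
Qed.

Lemma compact_in_box C : compact C ->
  exists2 M : R, 0 < M & forall x, C x -> forall i, `|x 0 i| < M.
Proof.
move=> /compact_bounded[M [_ CM]]; exists (`|M| + 2).
  by rewrite ltr_wpDl.
move=> x Cx i; apply: (@le_lt_trans _ _ (`|M| + 1)); last by rewrite ltrD2l; lra.
apply: (@le_trans _ _ `|x|); last first.
  by apply: CM => //; rewrite ltr_pwDr// ler_norm.
rewrite [X in _ <= X]/Num.norm /= mx_normrE.
exact: (le_bigmax _ (fun ij : 'I_1 * 'I_d => `|x ij.1 ij.2|) (0, i)).
Qed.

Lemma test_fun_box D phi : test_fun D phi ->
  exists M : R, forall x : rV, (exists i, M <= `|x 0 i|) -> phi x = 0.
Proof.
move=> [_ [C [cC _ C0]]]; have [M _ CM] := compact_in_box cC.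
exists M => x [i Mx]; apply: C0 => Cx.
by have := CM x Cx i; rewrite ltNge Mx.
Qed.

Lemma integral_partial_test D phi i : test_fun D phi ->
  (\int[lebesgue]_(x in D) (partial i phi x)%:E = 0)%E.
Proof.
move=> tphi; have tphi' := test_fun_partial i tphi.
have [M M0] := test_fun_box tphi; have [M' M'0] := test_fun_box tphi'.
rewrite integral_mkcond.
transitivity (\int[@lebesgue R d]_x (partial i phi x)%:E)%E.
  apply: eq_integral => x _; rewrite patchE; case: ifPn => // /negP.
  by rewrite inE => nDx; rewrite (test_fun_notin tphi').
have [sphi _] := tphi.
apply: (@integral_partial_eq0 _ _ _ _ (Num.max M M')).
- by move=> x; apply: diff_derivable; exact: smooth_diff.
- exact: smooth_continuous (smooth_partial i sphi).
- by move=> x [j]; rewrite ge_max => /andP[Mx _]; apply: M0; exists j.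
- by move=> x [j]; rewrite ge_max => /andP[_ Mx]; apply: M'0; exists j.
Qed.

End test_functions.

(** * The fundamental lemma of the calculus of variations *)
Section box_generators.
Variables (R : realType) (d : nat).
Local Notation rV := 'rV[R]_d.

Definition boxes : set (set rV) := [set A | exists a c, A = box a c].

Definition box_max (a a' : rV) : rV := \row_i Num.max (a 0 i) (a' 0 i).
Definition box_min (a a' : rV) : rV := \row_i Num.min (a 0 i) (a' 0 i).

Lemma box_setI (a c a' c' : rV) :
  box a c `&` box a' c' = box (box_max a a') (box_min c c').
Proof.
apply/seteqP; split => [x [h h'] i|x h].
  rewrite !mxE gt_max lt_min.
  by have /andP[-> ->] := h i; have /andP[-> ->] := h' i.
split => i; have := h i; rewrite !mxE gt_max lt_min => /andP[/andP[? ?] /andP[? ?]];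
  exact/andP.
Qed.

Lemma cbox_sub (a c a' c' : rV) :
  cbox (box_max a a') (box_min c c') `<=` cbox a' c'.
Proof.
move=> x h i; have := h i; rewrite !mxE ge_max le_min.
by move=> /andP[/andP[_ ->] /andP[_ ->]].
Qed.

Lemma boxes_setI_closed : setI_closed boxes.
Proof.
by move=> _ _ [a [c ->]] [a' [c' ->]]; rewrite box_setI; eexists; eexists.
Qed.

Lemma coord_itv_boxes i (s t : R) :
  <<s boxes >> [set x : rV | s < x 0 i < t].
Proof.
pose lo N : rV := \row_j (if j == i then s else - N%:R).
pose hi N : rV := \row_j (if j == i then t else N%:R).
rewrite (_ : [set x : rV | _] = \bigcup_N box (lo N) (hi N)).
  by apply: sigma_algebra_bigcup => N; apply: sub_sigma_algebra; eexists; eexists.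
apply/seteqP; split => [x /= xst|x [N _ /(_ i)]]; last by rewrite !mxE eqxx.
have [N xN] : exists N : nat, forall j : 'I_d, `|x 0%R j| < N%:R.
  exists (\max_(j < d) (Num.truncn `|x 0%R j|).+1)%N => j.
  apply: (lt_le_trans (truncnS_gt _)); rewrite ler_nat.
  exact: (@leq_bigmax _ (fun j : 'I_d => (Num.truncn `|x 0%R j|).+1) j).
exists N => // j; rewrite !mxE; case: eqP => [->//|_].
by have := xN j; rewrite ltr_norml.
Qed.

(** Boxes form a pi-system generating the Borel sets, as required by Dynkin's
    theorem. *)
Lemma measurable_boxesE : (@measurable _ rV) = <<s boxes >>.
Proof.
apply/seteqP; split; last first.
  apply: smallest_sub; first exact: sigma_algebra_measurable.
  by move=> _ [a [c ->]]; exact: measurable_box.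
have mcoord i : measurable_fun [set: g_sigma_algebraType boxes]
    (@rV_coord R d i : g_sigma_algebraType boxes -> R).
  apply: (measurability _ (measurable_realfun.RGenOpens.measurableE R)).
  move=> _ [_ [s [t ->] <-]]; rewrite setTI.
  rewrite (_ : _ @^-1` _ = [set x : rV | s < x 0 i < t]); first exact: coord_itv_boxes.
  by apply/seteqP; split => x; rewrite /= in_itv.
apply: smallest_sub; first exact: smallest_sigma_algebra.
move=> A; rewrite -bigcup_seq /= => -[i _ [C mC <-]] /=.
exact: (mcoord i).
Qed.

End box_generators.

Section bump.
Variables (R : realType) (d : nat).
Local Notation rV := 'rV[R]_d.
Implicit Types (a c x : rV) (n : nat).

(** A product of functions exp(-1/(n s)), one for each face of the box, where s is
    the distance to the face.  It is supported in the closed box, and it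
    increases to the indicator of the open box with n. *)
Definition bump a c n : rV -> R := \prod_(i < d)
  ((expinv 0 \o affine (delta_mx 0 i *+ n) (- (a 0 i *+ n))) *
   (expinv 0 \o affine (- delta_mx 0 i *+ n) (c 0 i *+ n))).

Lemma dot_deltal i x : dot (delta_mx 0 i) x = x 0 i.
Proof.
by rewrite -dot_delta; apply: eq_bigr => j _; rewrite mulrC.
Qed.

Lemma bumpE a c n x : bump a c n x = \prod_(i < d)
  (expinv 0 ((x 0 i - a 0 i) *+ n) * expinv 0 ((c 0 i - x 0 i) *+ n)).
Proof.
rewrite /bump fct_prodE; apply: eq_bigr => i _; rewrite /GRing.mul /= /affine.
have dotMn g : dot (g *+ n) x = dot g x *+ n.
  by rewrite /dot -sumrMnl; apply: eq_bigr => j _; rewrite mulmxnE mulrnAl.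
have dotN g : dot (- g) x = - dot g x.
  by rewrite /dot -sumrN; apply: eq_bigr => j _; rewrite mxE mulNr.
rewrite !dotMn dotN !dot_deltal -mulrnBl -mulrnDl.
by rewrite [- x 0 i + _]addrC.
Qed.

Lemma smooth_bump a c n : smooth (bump a c n).
Proof.
by apply: smooth_prod => i; apply: smoothM; exact: smooth_expinv.
Qed.

Lemma bump_notin a c n x : ~ box a c x -> bump a c n x = 0.
Proof.
move=> /existsNP[i /negP]; rewrite negb_and -!leNgt => ac.
rewrite bumpE (bigD1 i)//=; case/orP: ac => h.
- by rewrite expinv_le0 ?mul0r// mulrn_wle0// subr_le0.
- by rewrite [X in _ * X * _]expinv_le0 ?mulr0 ?mul0r// mulrn_wle0// subr_le0.
Qed.

Lemma bump_ge0 a c n x : 0 <= bump a c n x.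
Proof.
by rewrite bumpE; apply: prodr_ge0 => i _; rewrite mulr_ge0// expinv_ge0.
Qed.

Lemma bump_le1 a c n x : bump a c n x <= 1.
Proof.
rewrite bumpE; apply: prodr_ile1 => i _.
by rewrite mulr_ge0 ?expinv_ge0//= mulr_ile1 ?expinv_ge0 ?expinv0_le1.
Qed.

Lemma cvg_prod1 (I : Type) (r : seq I) (F : I -> R^nat) :
  (forall i, F i n @[n --> \oo] --> (1 : R)) ->
  \prod_(i <- r) F i n @[n --> \oo] --> (1 : R).
Proof.
move=> F1; elim: r => [|i r IH].
  rewrite (_ : (fun n => _) = cst 1); first exact: cvg_cst.
  by apply/funext => n; rewrite big_nil.
rewrite (_ : (fun n => _) = (fun n => F i n * \prod_(j <- r) F j n)).
  by rewrite -[X in _ --> X]mulr1; exact: cvgM.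
by apply/funext => n; rewrite big_cons.
Qed.

Lemma bump_cvg a c x : box a c x -> bump a c n x @[n --> \oo] --> (1 : R).
Proof.
move=> xac; rewrite (_ : bump a c ^~ x = (fun n => \prod_(i < d)
    (expinv 0 ((x 0 i - a 0 i) *+ n) * expinv 0 ((c 0 i - x 0 i) *+ n))));
  last by apply/funext => n; rewrite bumpE.
apply: cvg_prod1 => i; have /andP[xi1 xi2] := xac i.
rewrite -[X in _ --> X]mulr1; apply: cvgM; apply: expinv0_dilate_cvg;
  by rewrite subr_gt0.
Qed.

Lemma test_fun_bump (D : set rV) a c n : cbox a c `<=` D ->
  test_fun D (bump a c n).
Proof.
move=> acD; split; first exact: smooth_bump.
exists (cbox a c); split => //; first exact: cbox_compact.
by move=> x nx; apply: bump_notin => /box_cbox.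
Qed.

End bump.

Section fundamental_lemma.
Variables (R : realType) (d : nat) (D : set 'rV[R]_d) (g : 'rV[R]_d -> R).
Local Notation rV := 'rV[R]_d.
Hypotheses (oD : open D) (mg : measurable_fun D g).
Hypothesis Ig : forall a c, cbox a c `<=` D ->
  (@lebesgue R d).-integrable (box a c) (EFin \o g).
Hypothesis g0 : forall phi, test_fun D phi ->
  \int[lebesgue]_(x in D) (g x * phi x) = 0.

(** The bump functions are test functions which converge boundedly to the
    indicator of the box. *)
Lemma integral_box_eq0 a c : cbox a c `<=` D ->
  (\int[lebesgue]_(x in box a c) (g x)%:E = 0)%E.
Proof.
move=> acD; have mB := measurable_box a c.
have mgB : measurable_fun (box a c) g.
  apply: measurable_funS mg; first exact: open_measurable_rV.
  exact: subset_trans (@box_cbox _ _ _ _) acD.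
have mf n : measurable_fun (box a c) (fun x => g x * bump a c n x).
  apply: measurable_funM => //.
  exact: continuous_measurable_rV (smooth_continuous (smooth_bump a c n)) _.
have If n : (@lebesgue R d).-integrable (box a c)
    (EFin \o (fun x => g x * bump a c n x)).
  apply: le_integrable (Ig acD) => //; first exact/measurable_EFinP.
  move=> x _; rewrite lee_fin normrM ler_piMr//.
  by rewrite ger0_norm ?bump_ge0// bump_le1.
have f0 n : (\int[lebesgue]_(x in box a c) (g x * bump a c n x)%:E = 0)%E.
  have := g0 (test_fun_bump n acD); rewrite Rintegral_mkcond.
  rewrite (_ : _ \_ D = (fun x => g x * bump a c n x) \_ (box a c)).
    rewrite -Rintegral_mkcond /Rintegral => f0.
    rewrite -[LHS]fineK ?f0//.
    by apply: integrable_fin_num => //; exact: If.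
  apply/funext => x; rewrite !patchE.
  case: (pselect (box a c x)) => [xac|nx].
    by rewrite !mem_set//; apply: acD; exact: box_cbox.
  rewrite [in RHS]memNset// bump_notin// mulr0.
  by case: ifP.
have [] := @dominated_convergence _ _ R (@lebesgue R d) (box a c) mB
  (fun n x => (g x * bump a c n x)%:E) (EFin \o g) (fun x => `|g x|%:E).
- by move=> n; exact/measurable_EFinP.
- exact/measurable_EFinP.
- apply: aeW => x xac; apply: cvg_EFin; first exact: nearW.
  rewrite /= -[X in _ --> X]mulr1; apply: cvgM; first exact: cvg_cst.
  exact: bump_cvg.
- exact: (integrable_norm (Ig acD)).
- apply: aeW => x n xac; rewrite lee_fin normrM ler_piMr//.
  by rewrite ger0_norm ?bump_ge0// bump_le1.
move=> _ _; under eq_fun do rewrite f0.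
move=> /cvg_lim <-//; exact: lim_cst.
Qed.

(** By Dynkin's theorem the integral of g vanishes on all Borel subsets of the
    box, among which the sets where g is positive or negative. *)
Lemma ae_box_eq0 a c : cbox a c `<=` D ->
  \forall x \ae (@lebesgue R d), box a c x -> g x = 0.
Proof.
move=> acD; have mB := measurable_box a c.
have IgS S : measurable S ->
    (@lebesgue R d).-integrable (S `&` box a c) (EFin \o g).
  move=> mS; apply: integrableS (Ig acD) => //; exact: measurableI.
have intS S : measurable S ->
    (\int[lebesgue]_(x in S `&` box a c) (g x)%:E = 0)%E.
  rewrite measurable_boxesE.
  apply: (@dynkin_induction _ _ (boxes (R := R) (d := d))
    (fun S => (\int[lebesgue]_(x in S `&` box a c) (g x)%:E = 0)%E)).
  - exact: measurable_boxesE.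
  - exact: boxes_setI_closed.
  - by rewrite setTI; exact: integral_box_eq0.
  - move=> _ [a' [c' ->]]; rewrite box_setI; apply: integral_box_eq0.
    exact: subset_trans (@cbox_sub _ _ _ _ _ _) acD.
  - move=> {}S mS S0; have U : box a c = (S `&` box a c) `|` (~` S `&` box a c).
      by rewrite -setIUl setUv setTI.
    have := integral_box_eq0 acD; rewrite {1}U integral_setU.
    + by rewrite S0 add0e.
    + exact: measurableI.
    + by apply: measurableI => //; exact: measurableC.
    + by rewrite -U; apply: measurable_int; exact: Ig.
    + by apply/disj_setPS => x [[Sx _] [nSx _]].
  - move=> F mF tF F0; rewrite setI_bigcupl integral_bigcup.
    + by rewrite eseries0.
    + by apply: trivIset_setIr.
    + by move=> k; exact: measurableI.
    + rewrite -setI_bigcupl; apply: IgS; exact: bigcupT_measurable.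
have : ae_eq (@lebesgue R d) (box a c) (EFin \o g) (cst 0%E).
  apply: integral_ae_eq => //; first exact: Ig.
  move=> E EB mE; rewrite -[in LHS](setIidl EB) intS//.
  by rewrite integral0_eq.
by apply: filterS => x h xac; have [] := h xac.
Qed.

Lemma fundamental_lemma : g = cst 0 %[ae lebesgue in D].
Proof.
have : forall n, \forall x \ae (@lebesgue R d),
    if unpickle n is Some p then
      cbox (map_mx ratr p.1) (map_mx ratr p.2) `<=` D -> @ratbox R d p x -> g x = 0
    else True.
  move=> n; case: unpickle => [p|]; last exact: aeW.
  have [pD|npD] := pselect (cbox (map_mx ratr p.1) (map_mx ratr p.2) `<=` D).
    by apply: filterS (ae_box_eq0 pD) => x h _; exact: h.
  exact: aeW.
move/ae_foralln; apply: filterS => x h Dx.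
have [p [px pD]] := open_ratbox oD Dx.
by have := h (pickle p); rewrite pickleK; apply.
Qed.

End fundamental_lemma.

(** * Square integrable functions *)
Section L2.
Variables (R : realType) (d : nat) (D : set 'rV[R]_d).
Hypothesis mD : measurable D.
Local Notation rV := 'rV[R]_d.
Local Notation L2 := (L2 D).
Local Notation mu := (@lebesgue R d).
Implicit Types (u v w : rV -> R) (c : R).

(** The scalar product of L^2(D). *)
Definition ip u v : R := \int[lebesgue]_(x in D) (u x * v x).

Lemma L2_sqr_integrable u : L2 u -> mu.-integrable D (fun x => (u x ^+ 2)%:E).
Proof.
move=> [mu_ u2]; apply/integrableP; split.
  by apply/measurable_EFinP; exact: measurable_funX.
rewrite (_ : (\int[_]_(x in D) _)%E = sqint D u)//.
by apply: eq_integral => x _; rewrite gee0_abs// lee_fin sqr_ge0.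
Qed.

Lemma L2_dominated u v w : L2 v -> L2 w -> measurable_fun D u ->
  (forall x, D x -> u x ^+ 2 <= v x ^+ 2 + w x ^+ 2) -> L2 u.
Proof.
move=> Lv Lw mu_ uvw; split => //.
have /integrableP[_] : mu.-integrable D
    (fun x => (v x ^+ 2)%:E + (w x ^+ 2)%:E)%E.
  by apply: integrableD => //; exact: L2_sqr_integrable.
apply: le_lt_trans; apply: ge0_le_integral => //.
- by move=> x _; rewrite lee_fin sqr_ge0.
- by apply/measurable_EFinP; exact: measurable_funX.
- apply: measurableT_comp => //; apply: emeasurable_funD;
    apply/measurable_EFinP; apply: measurable_funX; by [case: Lv|case: Lw].
- by move=> x Dx; rewrite -EFinD abse_EFin lee_fin (le_trans (uvw x Dx))// ler_norm.
Qed.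

Lemma L2_mul_integrable u v : L2 u -> L2 v ->
  mu.-integrable D (EFin \o (fun x => u x * v x)).
Proof.
move=> Lu Lv.
have : mu.-integrable D (fun x => (u x ^+ 2)%:E + (v x ^+ 2)%:E)%E.
  by apply: integrableD => //; exact: L2_sqr_integrable.
apply: le_integrable => //.
  by apply/measurable_EFinP; apply: measurable_funM; [case: Lu|case: Lv].
move=> x _; rewrite -EFinD !abse_EFin lee_fin normrM.
rewrite [leRHS]ger0_norm ?addr_ge0 ?sqr_ge0//.
rewrite -[u x ^+ 2]real_normK ?num_real// -[v x ^+ 2]real_normK ?num_real//.
nra.
Qed.

Lemma L2M_cst c u : L2 u -> L2 (fun x => c * u x).
Proof.
move=> Lu; split; first by apply: measurable_funM => //; case: Lu.
rewrite /sqint.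
have /integrableP[_] : mu.-integrable D (fun x => (c ^+ 2)%:E * (u x ^+ 2)%:E)%E.
  by apply: integrableZl => //; exact: L2_sqr_integrable.
apply: le_lt_trans; apply: ge0_le_integral => //.
- by move=> x _; rewrite lee_fin sqr_ge0.
- apply/measurable_EFinP; apply: measurable_funX.
  by apply: measurable_funM => //; case: Lu.
- apply: measurableT_comp => //; apply: emeasurable_funM => //.
  by apply/measurable_EFinP; apply: measurable_funX; case: Lu.
- by move=> x Dx; rewrite -EFinM abse_EFin lee_fin exprMn ler_norm.
Qed.

Lemma L2D u v : L2 u -> L2 v -> L2 (fun x => u x + v x).
Proof.
move=> Lu Lv; apply: (@L2_dominated _ (fun x => 2 * u x) (fun x => 2 * v x)).
- exact: L2M_cst.
- exact: L2M_cst.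
- by apply: measurable_funD; [case: Lu|case: Lv].
- by move=> x _; have := sqr_ge0 (u x - v x); have := sqr_ge0 (u x); 
    have := sqr_ge0 (v x); nra.
Qed.

Lemma L2N u : L2 u -> L2 (fun x => - u x).
Proof.
move=> /(L2M_cst (-1)); rewrite (_ : (fun x => -1 * u x) = (fun x => - u x))//.
by apply/funext => x; rewrite mulN1r.
Qed.

Lemma L2B u v : L2 u -> L2 v -> L2 (fun x => u x - v x).
Proof. by move=> Lu /L2N; exact: L2D. Qed.

Lemma L2_sum (I : Type) (r : seq I) (P : pred I) (F : I -> rV -> R) :
  (forall i, P i -> L2 (F i)) -> L2 (fun x => \sum_(i <- r | P i) F i x).
Proof.
move=> LF; elim: r => [|i r IH].
  rewrite (_ : (fun x => _) = cst 0).
    split; first exact: measurable_cst.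
    by rewrite /sqint integral0_eq// => x _; rewrite expr0n.
  by apply/funext => x; rewrite big_nil.
have [Pi|nPi] := boolP (P i); last first.
  by rewrite (_ : (fun x => _) = (fun x => \sum_(i <- r | P i) F i x))//;
    apply/funext => x; rewrite big_cons (negbTE nPi).
rewrite (_ : (fun x => _) = (fun x => F i x + \sum_(i <- r | P i) F i x)).
  exact: L2D (LF _ Pi) IH.
by apply/funext => x; rewrite big_cons Pi.
Qed.

Lemma L2_ae u v : L2 u -> measurable_fun D v -> u = v %[ae mu in D] -> L2 v.
Proof.
move=> [mu_ u2] mv uv; split => //; apply: le_lt_trans u2.
rewrite le_eqVlt; apply/orP; left; apply/eqP; apply: ae_eq_integral => //.
- by apply/measurable_EFinP; exact: measurable_funX.
- by apply/measurable_EFinP; exact: measurable_funX.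
- by apply: filterS uv => x h Dx; rewrite h.
Qed.

Lemma ipC u v : ip u v = ip v u.
Proof. by apply: eq_Rintegral => x _; rewrite mulrC. Qed.

Lemma ipDl u v w : L2 u -> L2 v -> L2 w ->
  ip (fun x => u x + v x) w = ip u w + ip v w.
Proof.
move=> Lu Lv Lw; rewrite /ip -RintegralD//; try exact: L2_mul_integrable.
by apply: eq_Rintegral => x _; rewrite mulrDl.
Qed.

Lemma ipZl c u w : L2 u -> L2 w -> ip (fun x => c * u x) w = c * ip u w.
Proof.
move=> Lu Lw; rewrite /ip -RintegralZl//; last exact: L2_mul_integrable.
by apply: eq_Rintegral => x _; rewrite mulrA.
Qed.

Lemma ipNl u w : L2 u -> L2 w -> ip (fun x => - u x) w = - ip u w.
Proof.
move=> Lu Lw; rewrite -mulN1r -ipZl//.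
by apply: eq_Rintegral => x _; rewrite mulN1r.
Qed.

Lemma ipBl u v w : L2 u -> L2 v -> L2 w ->
  ip (fun x => u x - v x) w = ip u w - ip v w.
Proof. by move=> Lu Lv Lw; rewrite ipDl ?ipNl//; exact: L2N. Qed.

Lemma ip0l w : ip (cst 0) w = 0.
Proof.
by rewrite /ip /Rintegral integral0_eq// => x _; rewrite mul0r.
Qed.

Lemma ip_suml (I : Type) (r : seq I) (P : pred I) (F : I -> rV -> R) w :
  (forall i, P i -> L2 (F i)) -> L2 w ->
  ip (fun x => \sum_(i <- r | P i) F i x) w = \sum_(i <- r | P i) ip (F i) w.
Proof.
move=> LF Lw; elim: r => [|i r IH].
  rewrite big_nil -[RHS](ip0l w).
  by apply: eq_Rintegral => x _; rewrite big_nil.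
rewrite big_cons; case: ifPn => [Pi|nPi].
  rewrite -IH -ipDl//; [|exact: LF|exact: L2_sum].
  by apply: eq_Rintegral => x _; rewrite big_cons Pi.
by rewrite -IH; apply: eq_Rintegral => x _; rewrite big_cons (negbTE nPi).
Qed.

Lemma ipDr u v w : L2 u -> L2 v -> L2 w ->
  ip w (fun x => u x + v x) = ip w u + ip w v.
Proof. by move=> *; rewrite ipC ipDl// !(ipC w). Qed.

Lemma ipZr c u w : L2 u -> L2 w -> ip w (fun x => c * u x) = c * ip w u.
Proof. by move=> *; rewrite ipC ipZl// !(ipC w). Qed.

Lemma ipBr u v w : L2 u -> L2 v -> L2 w ->
  ip w (fun x => u x - v x) = ip w u - ip w v.
Proof. by move=> *; rewrite ipC ipBl// !(ipC w). Qed.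

Lemma ip_sumr (I : Type) (r : seq I) (P : pred I) (F : I -> rV -> R) w :
  (forall i, P i -> L2 (F i)) -> L2 w ->
  ip w (fun x => \sum_(i <- r | P i) F i x) = \sum_(i <- r | P i) ip w (F i).
Proof.
by move=> LF Lw; rewrite ipC ip_suml//; apply: eq_bigr => i _; rewrite ipC.
Qed.

Lemma ip_ge0 u : 0 <= ip u u.
Proof. by apply: Rintegral_ge0 => x _; rewrite -expr2 sqr_ge0. Qed.

Lemma sqintE u : L2 u -> sqint D u = (ip u u)%:E.
Proof.
move=> Lu; rewrite /ip /Rintegral fineK; last first.
  exact: integrable_fin_num (L2_mul_integrable Lu Lu).
by apply: eq_integral => x _; rewrite expr2.
Qed.

(** The quadratic polynomial t |-> |u + t v|^2 is nonnegative. *)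
Lemma cauchy_schwarz u v : L2 u -> L2 v -> ip u v ^+ 2 <= ip u u * ip v v.
Proof.
move=> Lu Lv.
have key t : 0 <= ip u u + 2 * t * ip u v + t ^+ 2 * ip v v.
  have := ip_ge0 (fun x => u x + t * v x).
  have Ltv := L2M_cst t Lv; have Lutv := L2D Lu Ltv.
  rewrite ipDl// !ipDr// !ipZl// !ipZr// (ipC v u).
  by move/le_trans; apply; rewrite le_eqVlt; apply/orP; left; apply/eqP; ring.
have := ip_ge0 v; rewrite le_eqVlt => /orP[/eqP C0|C0].
  have [->|B0] := eqVneq (ip u v) 0; first by rewrite expr0n -C0 mulr0.
  (* if |v| = 0 the polynomial has degree one, and is equal to -1 there *)
  have := key (- (ip u u + 1) / (2 * ip u v)); rewrite -C0 mulr0 addr0.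
  rewrite (_ : 2 * _ * _ = - (ip u u + 1)); last by field.
  by rewrite opprD addrA subrr add0r oppr_ge0 leNgt ltr01.
have := key (- ip u v / ip v v).
rewrite (_ : _ + _ = ip u u - ip u v ^+ 2 / ip v v); last first.
  by field; rewrite gt_eqF.
by rewrite subr_ge0 ler_pdivrMr.
Qed.

Lemma ip_ae u v w : L2 u -> L2 v -> L2 w -> u = v %[ae mu in D] ->
  ip u w = ip v w.
Proof.
move=> Lu Lv Lw uv; rewrite /ip /Rintegral; congr fine.
apply: ae_eq_integral => //.
- by apply/measurable_EFinP; apply: measurable_funM; [case: Lu|case: Lw].
- by apply/measurable_EFinP; apply: measurable_funM; [case: Lv|case: Lw].
- by apply: filterS uv => x h Dx; rewrite h.
Qed.

Lemma ip_eq0 u : L2 u -> ip u u = 0 -> u = cst 0 %[ae mu in D].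
Proof.
move=> Lu u0; have : sqint D u = 0%E by rewrite sqintE// u0.
move=> /eqP; rewrite /sqint => /eqP h.
have mu2 : measurable_fun D (fun x => (u x ^+ 2)%:E).
  by apply/measurable_EFinP; apply: measurable_funX; case: Lu.
have : ae_eq mu D (fun x => (u x ^+ 2)%:E) (cst 0%E).
  apply/ae_eq_integral_abs => //.
  rewrite -[RHS]h; apply: eq_integral => x _.
  by rewrite gee0_abs// lee_fin sqr_ge0.
apply: filterS => x h' Dx; have [] := h' Dx.
by move/eqP; rewrite sqrf_eq0 => /eqP.
Qed.

Hypothesis fD : (mu D < +oo)%E.

Lemma L2_bounded u M : measurable_fun D u ->
  (forall x, D x -> `|u x| <= M) -> L2 u.
Proof.
move=> mu_ uM; split => //.
apply: (@le_lt_trans _ _ (\int[mu]_(x in D) (cst (M ^+ 2)%:E x))%E).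
  apply: ge0_le_integral => //.
  - by move=> x _; rewrite lee_fin sqr_ge0.
  - by apply/measurable_EFinP; exact: measurable_funX.
  - move=> x Dx; rewrite lee_fin -[leLHS]real_normK ?num_real// lerXn2r// ?nnegrE//.
      exact: le_trans (uM x Dx).
    exact: uM.
by rewrite integral_cst// lte_mul_pinfty// lee_fin sqr_ge0.
Qed.

Lemma L2_cst c : L2 (cst c).
Proof. by apply: (@L2_bounded _ `|c|). Qed.

Lemma L2_integrable u : L2 u -> mu.-integrable D (EFin \o u).
Proof.
move=> Lu; have := L2_mul_integrable Lu (L2_cst 1).
by apply: eq_integrable => // x _; rewrite /= mulr1.
Qed.

Lemma ip_cstr u : ip u (cst 1) = \int[lebesgue]_(x in D) u x.
Proof. by apply: eq_Rintegral => x _; rewrite mulr1. Qed.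

Lemma ip_cst1 : ip (cst 1) (cst 1) = fine (mu D).
Proof. by rewrite ip_cstr Rintegral_cst// mul1r. Qed.

End L2.

(** * Weak derivatives *)
Section weak_derivatives.
Variables (R : realType) (d : nat) (D : set 'rV[R]_d).
Hypotheses (oD : open D) (fD : (@lebesgue R d D < +oo)%E).
Local Notation rV := 'rV[R]_d.
Local Notation L2 := (L2 D).
Local Notation mu := (@lebesgue R d).
Local Notation wp := (is_weak_partial D).
Implicit Types (u v w g h phi psi : rV -> R) (c : R) (i : 'I_d).

Let mD : measurable D. Proof. exact: open_measurable_rV. Qed.

Lemma test_fun_L2 E phi : test_fun E phi -> L2 phi.
Proof.
move=> tphi; have [M M0] := test_fun_box tphi; have [sphi _] := tphi.
have cphi := smooth_continuous sphi.
have [N N0 phiN] := continuous_cbox_bounded (const_mx (- M)) (const_mx M) cphi.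
apply: (@L2_bounded _ _ _ _ fD _ N) => //.
  exact: continuous_measurable_rV.
move=> x _; have [xM|xM] := pselect (exists i, M <= `|x 0 i|).
  by rewrite M0// normr0.
apply: phiN => i; rewrite !mxE -ler_norml leNgt; apply/negP => Mx.
by apply: xM; exists i; exact: ltW.
Qed.

Lemma weak_partialE i u g phi : wp i u g -> test_fun D phi ->
  ip D u (partial i phi) = - ip D g phi.
Proof. by move=> [_ h] /h. Qed.

(** The difference of two weak derivatives is orthogonal to the test functions. *)
Lemma weak_partial_uniq i u g h : wp i u g -> wp i u h ->
  g = h %[ae mu in D].
Proof.
move=> ug uh; have [Lg _] := ug; have [Lh _] := uh.
have Lgh : L2 (fun x => g x - h x) by exact: L2B.
have : (fun x => g x - h x) = cst 0 %[ae mu in D].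
  apply: fundamental_lemma => //.
  - by case: Lgh.
  - move=> a c acD; apply: (@integrableS _ _ _ _ D) => //.
    + exact: measurable_box.
    + exact: subset_trans (@box_cbox _ _ _ _) acD.
    + exact: L2_integrable.
  - move=> phi tphi; have Lphi := test_fun_L2 tphi.
    have := ipBl mD Lg Lh Lphi; rewrite /ip => ->.
    have := weak_partialE ug tphi; rewrite (weak_partialE uh tphi) /ip => e.
    by apply/eqP; rewrite subr_eq0; apply/eqP/oppr_inj.
by apply: filterS => x e Dx; apply/eqP; rewrite -subr_eq0; apply/eqP/e.
Qed.

(** Functions equal almost everywhere have the same weak derivatives. *)
Lemma weak_partial_ae i u v g h : L2 u -> L2 v -> u = v %[ae mu in D] ->
  g = h %[ae mu in D] -> measurable_fun D h -> wp i u g -> wp i v h.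
Proof.
move=> Lu Lv uv gh mh ug; have [Lg _] := ug.
have Lh : L2 h := L2_ae mD Lg mh gh.
split => // phi tphi; have Lphi := test_fun_L2 tphi.
have Lphi' := test_fun_L2 (test_fun_partial i tphi).
have := weak_partialE ug tphi.
by rewrite (ip_ae mD Lu Lv Lphi' uv) (ip_ae mD Lg Lh Lphi gh).
Qed.

Lemma weak_partialD i u v g h : L2 u -> L2 v -> wp i u g -> wp i v h ->
  wp i (fun x => u x + v x) (fun x => g x + h x).
Proof.
move=> Lu Lv ug vh; have [Lg _] := ug; have [Lh _] := vh.
split; first exact: L2D.
move=> phi tphi; have Lphi := test_fun_L2 tphi.
have Lphi' := test_fun_L2 (test_fun_partial i tphi).
have := ipDl mD Lu Lv Lphi'; have := ipDl mD Lg Lh Lphi.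
rewrite (weak_partialE ug tphi) (weak_partialE vh tphi) /ip => -> ->.
by rewrite opprD.
Qed.

Lemma weak_partialZ i c u g : L2 u -> wp i u g ->
  wp i (fun x => c * u x) (fun x => c * g x).
Proof.
move=> Lu ug; have [Lg _] := ug.
split; first exact: L2M_cst.
move=> phi tphi; have Lphi := test_fun_L2 tphi.
have Lphi' := test_fun_L2 (test_fun_partial i tphi).
have := ipZl mD c Lu Lphi'; have := ipZl mD c Lg Lphi.
by rewrite (weak_partialE ug tphi) /ip => -> ->; rewrite mulrN.
Qed.

Lemma weak_partialN i u g : L2 u -> wp i u g ->
  wp i (fun x => - u x) (fun x => - g x).
Proof.
move=> Lu /(weak_partialZ (-1) Lu).
have E w : (fun x => -1 * w x) = (fun x => - w x).
  by apply/funext => x; rewrite mulN1r.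
by rewrite !E.
Qed.

Lemma weak_partialB i u v g h : L2 u -> L2 v -> wp i u g -> wp i v h ->
  wp i (fun x => u x - v x) (fun x => g x - h x).
Proof.
by move=> Lu Lv ug vh; apply: weak_partialD => //;
  [exact: L2N|exact: weak_partialN].
Qed.

Lemma weak_partial0 i : wp i (cst 0) (cst 0).
Proof.
have L0 : L2 (cst 0) by exact: L2_cst.
split=> // phi _; have := ip0l D (partial i phi); have := ip0l D phi.
by rewrite /ip => -> ->; rewrite oppr0.
Qed.

Lemma weak_partial_sum i (I : Type) (r : seq I) (P : pred I)
    (F G : I -> rV -> R) :
  (forall j, P j -> L2 (F j)) -> (forall j, P j -> wp i (F j) (G j)) ->
  wp i (fun x => \sum_(j <- r | P j) F j x) (fun x => \sum_(j <- r | P j) G j x).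
Proof.
move=> LF FG; elim: r => [|j r IH].
  have E (H : I -> rV -> R) : (fun x => \sum_(j <- [::] | P j) H j x) = cst 0.
    by apply/funext => x; rewrite big_nil.
  by rewrite !E; exact: weak_partial0.
have [Pj|nPj] := boolP (P j); last first.
  have E (H : I -> rV -> R) : (fun x => \sum_(k <- j :: r | P k) H k x)
      = (fun x => \sum_(k <- r | P k) H k x).
    by apply/funext => x; rewrite big_cons (negbTE nPj).
  by rewrite !E.
have E (H : I -> rV -> R) : (fun x => \sum_(k <- j :: r | P k) H k x)
    = (fun x => H j x + \sum_(k <- r | P k) H k x).
  by apply/funext => x; rewrite big_cons Pj.
rewrite (E F) (E G); apply: weak_partialD => //.
- exact: LF.
- exact: L2_sum.
- exact: FG.
Qed.

Lemma weak_partialP i u : (exists g, wp i u g) -> wp i u (weak_partial D i u).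
Proof. exact: xgetPex. Qed.

Lemma weak_partial_eq i u g : wp i u g ->
  weak_partial D i u = g %[ae mu in D].
Proof.
move=> ug; have wu : wp i u (weak_partial D i u).
  by apply: weak_partialP; exists g.
exact: weak_partial_uniq wu ug.
Qed.

(** From int d_i (psi phi) = 0, the product psi phi being a test function. *)
Lemma smooth_weak_partial i psi : smooth psi -> L2 psi -> L2 (partial i psi) ->
  wp i psi (partial i psi).
Proof.
move=> spsi Lpsi Lpsi'; split => // phi tphi; have [sphi _] := tphi.
have Lphi := test_fun_L2 tphi.
have Lphi' := test_fun_L2 (test_fun_partial i tphi).
have := integral_partial_test i (test_fun_mul spsi tphi).
rewrite partialM; [|by move=> x; exact: smooth_diff|by move=> x; exact: smooth_diff].
move=> /(congr1 (@fine R)) /= e.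
have : \int[lebesgue]_(x in D) (psi x * partial i phi x + phi x * partial i psi x) = 0.
  exact: e.
rewrite RintegralD//; [|exact: L2_mul_integrable|exact: L2_mul_integrable].
move=> /eqP; rewrite addr_eq0 => /eqP ->; congr (- _).
by apply: eq_Rintegral => x _; rewrite mulrC.
Qed.

Lemma test_weak_partial E i psi : test_fun E psi -> wp i psi (partial i psi).
Proof.
move=> tpsi; have [spsi _] := tpsi; apply: smooth_weak_partial => //.
  exact: test_fun_L2 tpsi.
exact: test_fun_L2 (test_fun_partial i tpsi).
Qed.

Section bounded_domain.
Implicit Types (l : rV).
Variable M : R.
Hypothesis bD : forall x, D x -> forall i, `|x 0 i| <= M.

Lemma affine_bounded l c : exists N, forall x, D x -> `|affine l c x| <= N.
Proof.
exists (\sum_i `|l 0 i| * M + `|c|) => x Dx.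
apply: (le_trans (ler_normD _ _)); rewrite lerD2r.
apply: (le_trans (ler_norm_sum _ _ _)); apply: ler_sum => i _.
by rewrite normrM ler_wpM2l// bD.
Qed.

Lemma affine_measurable l c (E : set rV) : measurable_fun E (affine l c).
Proof.
by apply: continuous_measurable_rV => x; apply: differentiable_continuous;
  exact: affine_diff.
Qed.

Lemma affine_L2 l c : L2 (affine l c).
Proof.
have [N gN] := affine_bounded l c.
by apply: L2_bounded gN => //; exact: affine_measurable.
Qed.

Lemma affine_weak_partial i l c : wp i (affine l c) (cst (l 0 i)).
Proof.
rewrite -(partial_affine l c); apply: smooth_weak_partial.
- exact: smooth_affine.
- exact: affine_L2.
- by rewrite partial_affine; exact: L2_cst.
Qed.

Lemma affineM_L2 l c u : L2 u -> L2 (fun x => affine l c x * u x).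
Proof.
move=> Lu; have [N gN] := affine_bounded l c.
have Nu := L2M_cst mD N Lu.
apply: (@L2_dominated _ _ _ mD _ _ (cst 0) Nu); first exact: L2_cst.
- by apply: measurable_funM; [exact: affine_measurable|case: Lu].
- move=> x Dx; rewrite expr0n addr0 !exprMn ler_wpM2r ?sqr_ge0//.
  rewrite -[leLHS]real_normK ?num_real// lerXn2r ?nnegrE//; last exact: gN.
  exact: le_trans (gN x Dx).
Qed.

(** The product rule, obtained by testing the weak derivative of u against the
    product of phi and of the affine function. *)
Lemma affineM_weak_partial i l c u v : L2 u -> wp i u v ->
  wp i (fun x => affine l c x * u x)
       (fun x => affine l c x * v x + l 0 i * u x).
Proof.
move=> Lu uv; have [Lv _] := uv.
have Lgu := affineM_L2 l c Lu; have Lgv := affineM_L2 l c Lv.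
have Lu' := L2M_cst mD (l 0 i) Lu.
split; first exact: L2D.
move=> phi tphi; have Lphi := test_fun_L2 tphi.
have tphi' := test_fun_partial i tphi; have Lphi' := test_fun_L2 tphi'.
have tgphi := test_fun_mul (smooth_affine l c) tphi.
have [sphi _] := tphi.
have := weak_partialE uv tgphi; rewrite partialM; last 2 first.
- by move=> x; exact: affine_diff.
- by move=> x; exact: smooth_diff.
rewrite partial_affine.
rewrite (_ : affine l c * _ + _ * _ =
  (fun x => affine l c x * partial i phi x + l 0 i * phi x)); last first.
  by apply/funext => x; rewrite /GRing.add /GRing.mul /= [X in _ + X]mulrC.
rewrite ipDr//; [|exact: affineM_L2|exact: L2M_cst].
rewrite ipZr// => e.
have -> : \int[lebesgue]_(x in D) (affine l c x * u x * partial i phi x)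
    = ip D u (fun x => affine l c x * partial i phi x).
  by apply: eq_Rintegral => x _; rewrite mulrAC mulrC.
have -> : \int[lebesgue]_(x in D) ((affine l c x * v x + l 0 i * u x) * phi x)
    = ip D v (affine l c * phi) + l 0 i * ip D u phi.
  have := ipDl mD Lgv Lu' Lphi; rewrite ipZl// /ip => ->; congr (_ + _).
  apply: eq_Rintegral => x _.
  by rewrite (_ : (affine l c * phi) x = affine l c x * phi x)// mulrAC mulrC.
by rewrite opprD -e addrK.
Qed.

End bounded_domain.
End weak_derivatives.

(** * H^1 and H^1_0 with explicit gradients *)
Section sobolev_spaces.
Variables (R : realType) (d : nat) (D : set 'rV[R]_d).
Hypotheses (oD : open D) (fD : (@lebesgue R d D < +oo)%E).
Local Notation rV := 'rV[R]_d.
Local Notation L2 := (L2 D).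
Local Notation mu := (@lebesgue R d).
Local Notation wp := (is_weak_partial D).
Implicit Types (u v w phi psi : rV -> R) (c e : R) (i : 'I_d)
  (G H : 'I_d -> rV -> R).

Let mD : measurable D. Proof. exact: open_measurable_rV. Qed.

(** The gradient is a parameter, in order to compute with gradients that are
    known only almost everywhere. *)
Definition is_grad u G := L2 u /\ forall i, wp i u (G i).

(** The density of test functions is expressed with the given gradient and
    separately for each component.  By [H10_is_grad] and [H10_grad_H10] this is
    H^1_0(D). *)
Definition H10_grad u G := is_grad u G /\
  forall e, 0 < e -> exists phi, [/\ test_fun D phi,
    ip D (fun x => u x - phi x) (fun x => u x - phi x) <= e &
    forall i, ip D (fun x => G i x - partial i phi x)
                   (fun x => G i x - partial i phi x) <= e].

Lemma is_gradL2 u G i : is_grad u G -> L2 (G i).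
Proof. by move=> [_ /(_ i)[]]. Qed.

Lemma H1_is_grad u : H1 D u -> is_grad u (fun i => weak_partial D i u).
Proof. by move=> [Lu uG]; split => // i; exact: weak_partialP. Qed.

Lemma is_grad_H1 u G : is_grad u G -> H1 D u.
Proof. by move=> [Lu uG]; split => // i; exists (G i). Qed.

Lemma is_grad_eq u G i : is_grad u G ->
  weak_partial D i u = G i %[ae mu in D].
Proof. by move=> [_ uG]; exact: weak_partial_eq (uG i). Qed.

Lemma is_grad_uniq u G H i : is_grad u G -> is_grad u H ->
  G i = H i %[ae mu in D].
Proof. by move=> [_ uG] [_ uH]; exact: weak_partial_uniq (uG i) (uH i). Qed.

Lemma is_grad_ae_all u G H : is_grad u G -> is_grad u H ->
  \forall x \ae mu, D x -> forall i, G i x = H i x.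
Proof.
move=> uG uH.
have : \forall x \ae mu, forall i, D x -> G i x = H i x.
  refine (@filter_forall _ _ (fun i x => D x -> G i x = H i x)
    (almost_everywhere mu) _ _) => i.
  exact: is_grad_uniq uG uH.
by apply: filterS => x h Dx i; exact: h.
Qed.

Lemma is_gradD u v G H : is_grad u G -> is_grad v H ->
  is_grad (fun x => u x + v x) (fun i x => G i x + H i x).
Proof.
move=> [Lu uG] [Lv vH]; split; first exact: L2D.
by move=> i; exact: weak_partialD.
Qed.

Lemma is_gradZ c u G : is_grad u G ->
  is_grad (fun x => c * u x) (fun i x => c * G i x).
Proof.
move=> [Lu uG]; split; first exact: L2M_cst.
by move=> i; exact: weak_partialZ.
Qed.

Lemma is_gradB u v G H : is_grad u G -> is_grad v H ->
  is_grad (fun x => u x - v x) (fun i x => G i x - H i x).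
Proof.
move=> [Lu uG] [Lv vH]; split; first exact: L2B.
by move=> i; exact: weak_partialB.
Qed.

Lemma is_grad_sum (I : Type) (r : seq I) (P : pred I) (F : I -> rV -> R)
    (G : I -> 'I_d -> rV -> R) :
  (forall j, P j -> is_grad (F j) (G j)) ->
  is_grad (fun x => \sum_(j <- r | P j) F j x)
          (fun i x => \sum_(j <- r | P j) G j i x).
Proof.
move=> FG; split; first by apply: L2_sum => // j /FG[].
move=> i; apply: (@weak_partial_sum _ _ _ oD fD i _ _ _ F (fun j => G j i)) => j /FG[] //.
Qed.

Lemma is_grad_ae u v G : is_grad u G -> measurable_fun D v ->
  u = v %[ae mu in D] -> is_grad v G.
Proof.
move=> uG mv uv; have [Lu uG'] := uG; have Lv := L2_ae mD Lu mv uv.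
split => // i; apply: (weak_partial_ae oD fD Lu Lv uv _ _ (uG' i)).
  exact: ae_eq_refl.
by have [] := is_gradL2 i uG.
Qed.

Lemma test_is_grad E phi : test_fun E phi -> is_grad phi (fun i => partial i phi).
Proof.
move=> tphi; split; first exact: test_fun_L2 tphi.
by move=> i; exact: test_weak_partial tphi.
Qed.

Lemma H10_is_grad u : H10 D u -> H10_grad u (fun i => weak_partial D i u).
Proof.
move=> [H1u apx]; have uG := H1_is_grad H1u; split => // e e0.
have [phi tphi ue] := apx e e0; exists phi.
have pG := test_is_grad tphi; have upG := is_gradB uG pG.
have s0 w : (0 <= sqint D w)%E.
  by apply: integral_ge0 => x _; rewrite lee_fin sqr_ge0.
have [Lup _] := upG; split => //.
  rewrite -lee_fin -sqintE//; apply: le_trans (ltW ue).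
  by rewrite leeDl// sume_ge0.
move=> i; have LG := is_gradL2 i upG.
have LW : L2 (weak_partial D i (u \- phi)).
  by have := H1_is_grad (is_grad_H1 upG) => h; exact: is_gradL2 i h.
have E : weak_partial D i (u \- phi) =
  (fun x => weak_partial D i u x - partial i phi x) %[ae mu in D].
  exact: is_grad_eq i upG.
rewrite -(ip_ae mD LW LG LG E) ipC -(ip_ae mD LW LG LW E) -lee_fin -sqintE//.
apply: le_trans (ltW ue); rewrite /H1_sqnorm (bigD1 i)//= addeCA leeDl//.
by rewrite adde_ge0// sume_ge0.
Qed.

Lemma H10_grad_H10 u G : H10_grad u G -> H10 D u.
Proof.
move=> [uG apx]; split; first exact: is_grad_H1 uG.
move=> e e0; have [phi [tphi ue Ge]] := apx (e / d.+2%:R) (divr_gt0 e0 (ltr0Sn _ _)).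
exists phi => //.
have pG := test_is_grad tphi; have upG := is_gradB uG pG; have [Lup _] := upG.
have W i : sqint D (weak_partial D i (u \- phi)) =
  (ip D (fun x => G i x - partial i phi x) (fun x => G i x - partial i phi x))%:E.
  have LG := is_gradL2 i upG.
  have LW : L2 (weak_partial D i (u \- phi)).
    by have := H1_is_grad (is_grad_H1 upG) => h; exact: is_gradL2 i h.
  have E := is_grad_eq i upG.
  by rewrite sqintE// (ip_ae mD LW LG LW E) ipC (ip_ae mD LW LG LG E).
rewrite /H1_sqnorm sqintE//; under eq_bigr do rewrite W.
rewrite sumEFin -EFinD lte_fin.
apply: (@le_lt_trans _ _ (e / d.+2%:R + \sum_(i < d) e / d.+2%:R)).
  by apply: lerD => //; exact: ler_sum.
rewrite sumr_const card_ord -mulrS -[_ *+ d.+1]mulr_natr -mulrA gtr_pMr//.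
by rewrite mulrC ltr_pdivrMr ?ltr0Sn// mul1r ltr_nat.
Qed.

Lemma ip_sqrD u v : L2 u -> L2 v ->
  ip D (fun x => u x + v x) (fun x => u x + v x) <= 2 * ip D u u + 2 * ip D v v.
Proof.
move=> Lu Lv; have LD := L2D mD Lu Lv; have LB := L2B mD Lu Lv.
have := ip_ge0 D (fun x => u x - v x).
rewrite ipBl// !ipBr// ipDl// !ipDr// (ipC D v u); lra.
Qed.

Lemma H10_gradD u v G H : H10_grad u G -> H10_grad v H ->
  H10_grad (fun x => u x + v x) (fun i x => G i x + H i x).
Proof.
move=> [uG au] [vH av]; split; first exact: is_gradD.
move=> e e0; have e4 : 0 < e / 4 by rewrite divr_gt0.
have e2 : e = 2 * (e / 4) + 2 * (e / 4) by field.
have [phi [tphi u1 G1]] := au _ e4; have [psi [tpsi v1 H1]] := av _ e4.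
have [Lup _] := is_gradB uG (test_is_grad tphi).
have [Lvp _] := is_gradB vH (test_is_grad tpsi).
have [[sphi _] [spsi _]] := (tphi, tpsi).
exists (phi + psi); split => [||i]; first exact: test_funD.
- rewrite (_ : (fun x => _) = (fun x => (u x - phi x) + (v x - psi x))); last first.
    by apply/funext => x; rewrite (_ : (phi + psi) x = phi x + psi x)// opprD addrACA.
  apply: (le_trans (ip_sqrD Lup Lvp)); rewrite [leRHS]e2.
  by apply: lerD; apply: ler_wpM2l.
- rewrite partialD; [|by move=> x; exact: smooth_diff|by move=> x; exact: smooth_diff].
  have LGp := is_gradL2 i (is_gradB uG (test_is_grad tphi)).
  have LHp := is_gradL2 i (is_gradB vH (test_is_grad tpsi)).
  rewrite (_ : (fun x => _) = (fun x => (G i x - partial i phi x)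
      + (H i x - partial i psi x))); last first.
    by apply/funext => x; rewrite (_ : (partial i phi + partial i psi) x
      = partial i phi x + partial i psi x)// opprD addrACA.
  apply: (le_trans (ip_sqrD LGp LHp)); rewrite [leRHS]e2.
  by apply: lerD; apply: ler_wpM2l.
Qed.

Lemma H10_gradZ c u G : H10_grad u G ->
  H10_grad (fun x => c * u x) (fun i x => c * G i x).
Proof.
move=> [uG au]; split; first exact: is_gradZ.
move=> e e0; have c1 : 0 < c ^+ 2 + 1 by rewrite ltr_wpDl// sqr_ge0.
have [phi [tphi u1 G1]] := au _ (divr_gt0 e0 c1).
have upG := is_gradB uG (test_is_grad tphi); have [Lup _] := upG.
have [sphi _] := tphi.
have le w : L2 w -> ip D w w <= e / (c ^+ 2 + 1) ->
    ip D (fun x => c * w x) (fun x => c * w x) <= e.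
  move=> Lw; rewrite ler_pdivlMr// => h.
  rewrite ipZl//; last exact: L2M_cst.
  by rewrite ipZr//; have := ip_ge0 D w; nra.
exists (cst c * phi); split => [||i].
- by apply: test_fun_mul => //; exact: smooth_cst.
- rewrite (_ : (fun x => _) = (fun x => c * (u x - phi x))).
    exact: le.
  by apply/funext => x; rewrite mulrBr.
- rewrite partialM//; last by move=> x; exact: smooth_diff.
  rewrite partial_cst (_ : (fun x => _) = (fun x => c * (G i x - partial i phi x))).
    by apply: le => //; exact: is_gradL2 i upG.
  apply/funext => x; rewrite mulrBr; congr (_ - _).
  by rewrite [LHS](_ : _ = c * partial i phi x + phi x * 0)// mulr0 addr0.
Qed.

Lemma H10_gradB u v G H : H10_grad u G -> H10_grad v H ->
  H10_grad (fun x => u x - v x) (fun i x => G i x - H i x).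
Proof.
move=> uG /(H10_gradZ (-1)) /(H10_gradD uG).
rewrite (_ : (fun x => u x + -1 * v x) = (fun x => u x - v x)); last first.
  by apply/funext => x; rewrite mulN1r.
rewrite (_ : (fun i x => G i x + -1 * H i x) = (fun i x => G i x - H i x))//.
by apply/funext => i; apply/funext => x; rewrite mulN1r.
Qed.

Lemma test_H10_grad phi : test_fun D phi -> H10_grad phi (fun i => partial i phi).
Proof.
move=> tphi; split; first exact: test_is_grad tphi.
have z w : ip D (fun x => w x - w x) (fun x => w x - w x) = 0.
  by rewrite -[RHS](ip0l D (cst 0)); apply: eq_Rintegral => x _; rewrite subrr.
by move=> e e0; exists phi; split => [//||i]; rewrite z ltW.
Qed.

Lemma H10_grad_sum (I : Type) (r : seq I) (P : pred I) (F : I -> rV -> R)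
    (G : I -> 'I_d -> rV -> R) :
  (forall j, P j -> H10_grad (F j) (G j)) ->
  H10_grad (fun x => \sum_(j <- r | P j) F j x)
          (fun i x => \sum_(j <- r | P j) G j i x).
Proof.
move=> FG; elim: r => [|j r IH].
  rewrite (_ : (fun x => _) = cst 0); last first.
    by apply/funext => x; rewrite big_nil.
  rewrite (_ : (fun i => _) = (fun i => partial i (cst 0))); last first.
    by apply/funext => i; apply/funext => x; rewrite big_nil partial_cst.
  apply: test_H10_grad; split; first exact: smooth_cst.
  exists set0; split => //; first exact: compact0.
have [Pj|nPj] := boolP (P j).
  rewrite (_ : (fun x => _) = (fun x => F j x + \sum_(k <- r | P k) F k x)); last first.
    by apply/funext => x; rewrite big_cons Pj.
  rewrite (_ : (fun i => _) = (fun i x => G j i x + \sum_(k <- r | P k) G k i x)).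
    by apply: H10_gradD => //; exact: FG.
  by apply/funext => i; apply/funext => x; rewrite big_cons Pj.
rewrite (_ : (fun x => _) = (fun x => \sum_(k <- r | P k) F k x)); last first.
  by apply/funext => x; rewrite big_cons (negbTE nPj).
rewrite (_ : (fun i => _) = (fun i x => \sum_(k <- r | P k) G k i x))//.
by apply/funext => i; apply/funext => x; rewrite big_cons (negbTE nPj).
Qed.

Lemma H10_grad_ae u v G : H10_grad u G -> measurable_fun D v ->
  u = v %[ae mu in D] -> H10_grad v G.
Proof.
move=> [uG au] mv uv; have vG := is_grad_ae uG mv uv; split => // e e0.
have [phi [tphi u1 G1]] := au _ e0; exists phi; split => //.
have [Lup _] := is_gradB uG (test_is_grad tphi).
have [Lvp _] := is_gradB vG (test_is_grad tphi).
have E : (fun x => u x - phi x) = (fun x => v x - phi x) %[ae mu in D].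
  by apply: filterS uv => x h Dx; rewrite h.
by rewrite -(ip_ae mD Lup Lvp Lvp E) ipC -(ip_ae mD Lup Lvp Lup E).
Qed.

(** For a test function w this is the definition of the weak derivative.  Both
    sides are continuous in w for the norm of H^1(D), by the Cauchy-Schwarz
    inequality. *)
Lemma ip_by_parts i v w g H : L2 v -> wp i v g -> H10_grad w H ->
  ip D v (H i) = - ip D g w.
Proof.
move=> Lv vg [wH aw]; have [Lg _] := vg; have [Lw _] := wH.
have LH := is_gradL2 i wH.
apply/eqP; rewrite -addr_eq0 -sqrf_eq0; apply/eqP/le_anti; rewrite sqr_ge0 andbT.
have Cv := ip_ge0 D v; have Cg := ip_ge0 D g.
set E := _ + _; pose C := 2 * ip D v v + 2 * ip D g g + 1.
have C0 : 0 < C by rewrite /C; lra.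
apply/ler_addgt0Pr => e e0; rewrite add0r.
have [phi [tphi w1 H1]] := aw _ (divr_gt0 e0 C0).
have pG := test_is_grad tphi; have wpG := is_gradB wH pG.
have [Lphi _] := pG; have [Lwp _] := wpG.
have Lphi' := is_gradL2 i pG; have LHp := is_gradL2 i wpG.
have -> : E = ip D v (fun x => H i x - partial i phi x) +
              ip D g (fun x => w x - phi x).
  rewrite ipBr// ipBr// (weak_partialE vg tphi) /E; ring.
have := cauchy_schwarz mD Lv LHp; have := cauchy_schwarz mD Lg Lwp.
set a := ip D v _; set b := ip D g (fun x => w x - phi x) => hb ha.
have {}ha : a ^+ 2 <= ip D v v * (e / C).
  by apply: (le_trans ha); apply: ler_wpM2l => //; exact: H1.
have {}hb : b ^+ 2 <= ip D g g * (e / C).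
  by apply: (le_trans hb); exact: ler_wpM2l.
apply: (@le_trans _ _ (2 * a ^+ 2 + 2 * b ^+ 2)).
  by have := sqr_ge0 (a - b); rewrite sqrrB sqrrD; lra.
apply: (@le_trans _ _ (C * (e / C))); last by rewrite mulrCA divff ?mulr1// gt_eqF.
have : 0 <= e / C by rewrite divr_ge0// ltW.
rewrite /C; set q := e / _ in ha hb *; lra.
Qed.

(** Integration by parts against w itself: w d_i w is half the derivative of
    w^2. *)
Lemma H10_ip_partial i w H : H10_grad w H -> ip D w (H i) = 0.
Proof.
move=> wH; have [[Lw wH'] _] := wH.
by have := ip_by_parts Lw (wH' i) wH; rewrite (ipC D (H i)); lra.
Qed.

Lemma H10_integral_partial i w H : H10_grad w H -> ip D (cst 1) (H i) = 0.
Proof.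
move=> wH; have L1 : L2 (cst 1) by exact: L2_cst.
rewrite (ip_by_parts L1 _ wH (g := cst 0)) ?ip0l ?oppr0//.
rewrite -(@partial_cst R d i 1); apply: smooth_weak_partial => //.
  exact: smooth_cst.
by rewrite partial_cst; exact: L2_cst.
Qed.

End sobolev_spaces.

(** * The variational problem on one element *)
Section variational.
Variables (R : realType) (d : nat) (D : set 'rV[R]_d) (m : R) (b : 'rV[R]_d).
Hypotheses (oD : open D) (fD : (@lebesgue R d D < +oo)%E).
Local Notation rV := 'rV[R]_d.
Local Notation L2 := (L2 D).
Local Notation mu := (@lebesgue R d).
Local Notation wp := (is_weak_partial D).
Local Notation is_grad := (is_grad D).
Local Notation H10_grad := (H10_grad D).
Local Notation ip := (ip D).
Local Notation one := (cst 1 : rV -> R).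
Implicit Types (u v w phi psi : rV -> R) (c e : R) (i : 'I_d)
  (G H W : 'I_d -> rV -> R) (g h : rV).

Let mD : measurable D. Proof. exact: open_measurable_rV. Qed.

Let L1 : L2 one. Proof. exact: L2_cst. Qed.

(** The form is reduced to scalar products of L^2, on which the chosen
    representatives of the weak derivatives have no influence. *)
Lemma bilinE u v G H : is_grad u G -> is_grad v H ->
  bilin m b D u v = m * \sum_i ip (G i) (H i) + \sum_i b 0 i * ip (G i) v.
Proof.
move=> uG vH; have [Lu _] := uG; have [Lv _] := vH.
have LG i : L2 (G i) by exact: is_gradL2 uG.
have LH i : L2 (H i) by exact: is_gradL2 vH.
have uW := H1_is_grad (is_grad_H1 uG); have vW := H1_is_grad (is_grad_H1 vH).
set Wu := fun i => weak_partial D i u in uW.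
set Wv := fun i => weak_partial D i v in vW.
have LWu i : L2 (Wu i) by exact: is_gradL2 uW.
have LWv i : L2 (Wv i) by exact: is_gradL2 vW.
have EG i (w : rV -> R) : L2 w -> ip (Wu i) w = ip (G i) w.
  by move=> Lw; apply: ip_ae => //; exact: is_grad_eq.
have EH i (w : rV -> R) : L2 w -> ip w (Wv i) = ip w (H i).
  by move=> Lw; rewrite ipC [RHS]ipC; apply: ip_ae => //; exact: is_grad_eq.
pose F i x := m * (Wu i x * Wv i x) + b 0 i * (Wu i x * v x).
have I1 i : mu.-integrable D (EFin \o (fun x => m * (Wu i x * Wv i x))).
  by apply: (@integrableZl _ _ _ mu D mD m (EFin \o (fun x => Wu i x * Wv i x)));
    exact: L2_mul_integrable.
have I2 i : mu.-integrable D (EFin \o (fun x => b 0 i * (Wu i x * v x))).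
  by apply: (@integrableZl _ _ _ mu D mD (b 0 i) (EFin \o (fun x => Wu i x * v x)));
    exact: L2_mul_integrable.
have IF i : mu.-integrable D (EFin \o F i).
  by rewrite /F; apply: (@integrableD _ _ _ mu D mD _ _ (I1 i) (I2 i)).
have sumF (r : seq 'I_d) :
    mu.-integrable D (EFin \o (fun x => \sum_(i <- r) F i x)) /\
    \int[lebesgue]_(x in D) \sum_(i <- r) F i x =
    \sum_(i <- r) \int[lebesgue]_(x in D) F i x.
  elim: r => [|i r [IH1 IH2]].
    rewrite big_nil (_ : (fun x => _) = cst 0).
      by split; [exact: (@integrable0 _ _ _ mu D)|rewrite /Rintegral integral0_eq].
    by apply/funext => x; rewrite big_nil.
  rewrite big_cons -IH2 (_ : (fun x => _) = (fun x => F i x + \sum_(j <- r) F j x)).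
    split; first exact: (@integrableD _ _ _ mu D mD _ _ (IF i) IH1).
    by rewrite RintegralD.
  by apply/funext => x; rewrite big_cons.
have -> : bilin m b D u v = \int[lebesgue]_(x in D) \sum_i F i x.
  apply: eq_Rintegral => x _; rewrite /F big_split -mulr_sumr /dot; congr (_ + _).
    by congr (_ * _); apply: eq_bigr => i _; rewrite !mxE.
  rewrite mulr_sumr; apply: eq_bigr => i _; rewrite !mxE /Wu; ring.
rewrite (sumF _).2 mulr_sumr -big_split; apply: eq_bigr => i _.
rewrite /F RintegralD// RintegralZl//; last exact: L2_mul_integrable.
rewrite RintegralZl//; last exact: L2_mul_integrable.
by rewrite -/(ip _ _) EG// EH// -/(ip _ _) EG.
Qed.

Lemma bilin_ae u u' v v' G H : is_grad u G -> is_grad v H ->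
  measurable_fun D u' -> measurable_fun D v' ->
  u = u' %[ae mu in D] -> v = v' %[ae mu in D] ->
  bilin m b D u v = bilin m b D u' v'.
Proof.
move=> uG vH mu' mv' uu' vv'.
have uG' := is_grad_ae oD fD uG mu' uu'; have vH' := is_grad_ae oD fD vH mv' vv'.
have [Lv _] := vH; have [Lv' _] := vH'.
rewrite (bilinE uG vH) (bilinE uG' vH'); congr (_ + _).
apply: eq_bigr => i _; congr (_ * _); rewrite ipC [RHS]ipC.
by apply: ip_ae => //; exact: is_gradL2 uG.
Qed.

Lemma bilinDl u1 u2 v G1 G2 H : is_grad u1 G1 -> is_grad u2 G2 -> is_grad v H ->
  bilin m b D (fun x => u1 x + u2 x) v = bilin m b D u1 v + bilin m b D u2 v.
Proof.
move=> u1G u2G vH; rewrite (bilinE (is_gradD oD fD u1G u2G) vH).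
rewrite (bilinE u1G vH) (bilinE u2G vH); have [Lv _] := vH.
have LG1 i : L2 (G1 i) by exact: is_gradL2 u1G.
have LG2 i : L2 (G2 i) by exact: is_gradL2 u2G.
have LH i : L2 (H i) by exact: is_gradL2 vH.
rewrite addrACA -mulrDr -!big_split; congr (_ * _ + _).
  by apply: eq_bigr => i _; rewrite ipDl.
by apply: eq_bigr => i _; rewrite ipDl// mulrDr.
Qed.

Lemma bilinDr u v1 v2 G H1 H2 : is_grad u G -> is_grad v1 H1 -> is_grad v2 H2 ->
  bilin m b D u (fun x => v1 x + v2 x) = bilin m b D u v1 + bilin m b D u v2.
Proof.
move=> uG v1H v2H; rewrite (bilinE uG (is_gradD oD fD v1H v2H)).
rewrite (bilinE uG v1H) (bilinE uG v2H); have [Lv1 _] := v1H; have [Lv2 _] := v2H.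
have LH1 i : L2 (H1 i) by exact: is_gradL2 v1H.
have LH2 i : L2 (H2 i) by exact: is_gradL2 v2H.
have LG i : L2 (G i) by exact: is_gradL2 uG.
rewrite addrACA -mulrDr -!big_split; congr (_ * _ + _).
  by apply: eq_bigr => i _; rewrite ipDr.
by apply: eq_bigr => i _; rewrite ipDr// mulrDr.
Qed.

Lemma bilinZl c u v G H : is_grad u G -> is_grad v H ->
  bilin m b D (fun x => c * u x) v = c * bilin m b D u v.
Proof.
move=> uG vH; rewrite (bilinE (is_gradZ oD fD c uG) vH) (bilinE uG vH).
have [Lv _] := vH.
have LG i : L2 (G i) by exact: is_gradL2 uG.
have LH i : L2 (H i) by exact: is_gradL2 vH.
rewrite mulrDr mulrCA [c * \sum_i ip _ _]mulr_sumr mulr_sumr.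
congr (_ * _ + _); apply: eq_bigr => i _; rewrite ipZl//; ring.
Qed.

Lemma bilin_suml (I : Type) (r : seq I) (F : I -> rV -> R)
    (G : I -> 'I_d -> rV -> R) v H :
  (forall j, is_grad (F j) (G j)) -> is_grad v H ->
  bilin m b D (fun x => \sum_(j <- r) F j x) v = \sum_(j <- r) bilin m b D (F j) v.
Proof.
move=> FG vH; elim: r => [|j r IH].
  rewrite big_nil (_ : (fun x => _) = (fun x => 0 * one x)); last first.
    by apply/funext => x; rewrite big_nil mul0r.
  have oneG : is_grad one (fun=> cst 0).
    split=> // i; rewrite -(@partial_cst R d i 1); apply: smooth_weak_partial => //.
      exact: smooth_cst.
    by rewrite partial_cst; exact: L2_cst.
  by rewrite (bilinZl 0 oneG vH) mul0r.
rewrite (_ : (fun x => _) = (fun x => F j x + \sum_(k <- r) F k x)); last first.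
  by apply/funext => x; rewrite big_cons.
have rG := is_grad_sum oD fD (P := predT) r (fun j _ => FG j).
by rewrite (bilinDl (FG j) rG vH) big_cons IH.
Qed.

Variable M : R.
Hypothesis bD : forall x, D x -> forall i, `|x 0 i| <= M.

Lemma affine_is_grad g c : is_grad (affine g c) (fun i => cst (g 0 i)).
Proof.
by split; [exact: affine_L2 bD _ _|move=> i; exact: affine_weak_partial bD _ _ _].
Qed.

(** A form of the Poincare inequality.  If d_i w = 0 then x_i w has weak
    derivative w in direction i; integrating by parts against w gives
    int w^2 = - int (x_i w) d_i w = 0. *)
Lemma H10_partial0 i w W : H10_grad w W -> W i = cst 0 %[ae mu in D] ->
  w = cst 0 %[ae mu in D].
Proof.
move=> wW W0; have [[Lw wW'] _] := wW; have LW := is_gradL2 i wW.1.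
apply: ip_eq0 => //.
pose l : rV := delta_mx 0 i.
have Lxw := affineM_L2 oD fD bD l 0 Lw.
have LxW := affineM_L2 oD fD bD l 0 LW.
have L0 : L2 (cst 0) by exact: L2_cst.
have := ip_by_parts oD fD Lxw (affineM_weak_partial oD fD bD l 0 Lw (wW' i)) wW.
rewrite ipC (ip_ae mD LW L0 Lxw W0) ip0l ipDl//; last exact: L2M_cst.
have E : (fun x => affine l 0 x * W i x) = cst 0 %[ae mu in D].
  by apply: filterS W0 => x h Dx; rewrite h// mulr0.
rewrite (ip_ae mD LxW L0 Lw E) ip0l add0r ipZl// mxE !eqxx mul1r.
by move=> /eqP; rewrite eq_sym oppr_eq0 => /eqP.
Qed.

Hypotheses (d_gt0 : (0 < d)%N) (m_gt0 : 0 < m).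

(** Coercivity: the advection term of a(w, w) vanishes by [H10_ip_partial], and
    the diffusion term controls the gradient. *)
Lemma variational_uniq w W : H10_grad w W ->
  (forall v, H10 D v -> bilin m b D w v = 0) -> w = cst 0 %[ae mu in D].
Proof.
move=> wW w0; have wg := wW.1.
have := w0 w (H10_grad_H10 oD fD wW); rewrite (bilinE wg wg).
rewrite [X in _ + X]big1 ?addr0; last first.
  by move=> i _; rewrite ipC (H10_ip_partial oD fD i wW) mulr0.
move=> /eqP; rewrite mulf_eq0 gt_eqF//= psumr_eq0; last by move=> i _; exact: ip_ge0.
move=> /allP h; pose i0 := Ordinal d_gt0.
have /eqP Wi0 := h i0 (mem_index_enum _).
apply: (H10_partial0 (i := i0) wW); apply: ip_eq0 => //; exact: is_gradL2 wg.
Qed.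

Lemma bilin_affine_H10 g c w W : H10_grad w W ->
  bilin m b D (affine g c) w = dot b g * ip one w.
Proof.
move=> wW; have [Lw _] := wW.1; have LW i : L2 (W i) := is_gradL2 i wW.1.
have cE (c' : R) : cst c' = (fun x => c' * one x) :> (rV -> R).
  by apply/funext => x; rewrite mulr1.
rewrite (bilinE (affine_is_grad g c) wW.1) big1 ?mulr0 ?add0r; last first.
  by move=> i _; rewrite cE ipZl// (H10_integral_partial oD fD i wW) mulr0.
rewrite /dot mulr_suml; apply: eq_bigr => i _.
by rewrite cE ipZl// mulrA.
Qed.

Lemma bilin_H10_affine g c w W : H10_grad w W ->
  bilin m b D w (affine g c) = - dot b g * ip one w.
Proof.
move=> wW; have [Lw _] := wW.1; have LW i : L2 (W i) := is_gradL2 i wW.1.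
have cE (c' : R) : cst c' = (fun x => c' * one x) :> (rV -> R).
  by apply/funext => x; rewrite mulr1.
rewrite (bilinE wW.1 (affine_is_grad g c)) big1 ?mulr0 ?add0r; last first.
  by move=> i _; rewrite cE ipZr// ipC (H10_integral_partial oD fD i wW) mulr0.
rewrite /dot -sumrN mulr_suml; apply: eq_bigr => i _.
have [La ga] := affine_is_grad g c.
rewrite ipC (ip_by_parts oD fD La (ga i) wW) cE ipZl//; ring.
Qed.

Variables (B : rV -> R) (chi : 'I_d -> rV -> R).
Hypothesis H10B : H10 D B.
Hypothesis BE : forall v, H10 D v ->
  bilin m b D B v = \int[lebesgue]_(x in D) v x.
Hypothesis H10chi : forall i, H10 D (chi i).
Hypothesis chiE : forall i v, H10 D v ->
  bilin m b D (chi i) v = - bilin m b D (fun x => x 0 i) v.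

Let B_grad := H10_is_grad oD fD H10B.
Let chi_grad i := H10_is_grad oD fD (H10chi i).

Lemma coord_affine i : (fun x : rV => x 0 i) = affine (delta_mx 0 i) 0.
Proof. by apply/funext => x; rewrite /affine dot_deltal addr0. Qed.

Lemma bilin_chi i v W : H10_grad v W ->
  bilin m b D (chi i) v = - (b 0 i * ip one v).
Proof.
move=> vW; rewrite chiE; last exact: H10_grad_H10 vW.
by rewrite coord_affine (bilin_affine_H10 _ _ vW) dot_delta.
Qed.

(** The correctors are multiples of the bubble: chi_i + b_i B solves the
    homogeneous problem. *)
Lemma chi_bubble i : ip one (chi i) = - (b 0 i * ip one B).
Proof.
have LB := B_grad.1.1; have Lchi := (chi_grad i).1.1.
have LbB := L2M_cst mD (b 0 i) LB.
have wW := H10_gradD oD fD (chi_grad i) (H10_gradZ oD fD (b 0 i) B_grad).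
have w0 : (fun x => chi i x + b 0 i * B x) = cst 0 %[ae mu in D].
  apply: (variational_uniq wW) => v H10v.
  have vV := H10_is_grad oD fD H10v.
  rewrite (bilinDl (chi_grad i).1 (is_gradZ oD fD (b 0 i) B_grad.1) vV.1).
  rewrite (bilinZl _ B_grad.1 vV.1) (bilin_chi i vV) BE//.
  by rewrite -(@ip_cstr _ _ D v) (ipC D v) addNr.
have L0 : L2 (cst 0) by exact: L2_cst.
have := ip_ae mD wW.1.1 L0 L1 w0; rewrite ip0l ipC ipDr// ipZr//.
by move/eqP; rewrite addr_eq0 => /eqP.
Qed.

(** The multiscale function with affine part x |-> g . x + c. *)
Definition corrected g c : rV -> R :=
  fun x => affine g c x + \sum_i g 0 i * chi i x.

Lemma corrector_part_grad g : exists W,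
  H10_grad (fun x => \sum_i g 0 i * chi i x) W.
Proof.
exists (fun k x => \sum_i g 0 i * weak_partial D k (chi i) x).
apply: (@H10_grad_sum _ _ _ oD fD _ _ predT (fun i x => g 0 i * chi i x)
  (fun i k x => g 0 i * weak_partial D k (chi i) x)) => i _.
exact: H10_gradZ (chi_grad i).
Qed.

Lemma corrected_is_grad g c : exists G, is_grad (corrected g c) G.
Proof.
have [W hW] := corrector_part_grad g.
by eexists; apply: is_gradD (affine_is_grad g c) hW.1.
Qed.

Lemma bilin_corrector_part g v H : is_grad v H ->
  bilin m b D (fun x => \sum_i g 0 i * chi i x) v
  = \sum_i g 0 i * bilin m b D (chi i) v.
Proof.
move=> vH.
rewrite (bilin_suml (F := fun i x => g 0 i * chi i x)
  (G := fun i k x => g 0 i * weak_partial D k (chi i) x) _ _ vH).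
  by apply: eq_bigr => i _; rewrite (bilinZl _ (chi_grad i).1 vH).
by move=> i; exact: is_gradZ (chi_grad i).1.
Qed.

(** The correctors solve L chi_i = - L x_i, so the sum solves L u = 0. *)
Lemma corrected_harmonic g c v : H10 D v -> bilin m b D (corrected g c) v = 0.
Proof.
move=> H10v; have vV := H10_is_grad oD fD H10v.
have [W hW] := corrector_part_grad g.
rewrite (bilinDl (affine_is_grad g c) hW.1 vV.1) (bilin_affine_H10 _ _ vV).
rewrite (bilin_corrector_part _ vV.1) /dot mulr_suml -big_split big1// => i _.
by rewrite /= (bilin_chi i vV); ring.
Qed.

(** The corrector part of the second argument is in H^1_0(D) and is discarded by
    [corrected_harmonic]. *)
Lemma bilin_corrected g c h e :
  bilin m b D (corrected g c) (corrected h e) =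
  m * dot g h * fine (mu D) + dot b g * ip one (affine h e)
  + dot b g * dot b h * ip one B.
Proof.
have [G uG] := corrected_is_grad g c.
have [V hV] := corrector_part_grad h; have [W hW] := corrector_part_grad g.
have hh := affine_is_grad h e; have hg := affine_is_grad g c.
rewrite (bilinDr uG hh hV.1) (corrected_harmonic _ _ (H10_grad_H10 oD fD hV)) addr0.
rewrite (bilinDl hg hW.1 hh) (bilin_corrector_part _ hh); congr (_ + _).
  have cE (c' : R) : cst c' = (fun x => c' * one x) :> (rV -> R).
    by apply/funext => x; rewrite mulr1.
  have Lh := hh.1.
  rewrite (bilinE hg hh); congr (_ + _).
    rewrite -mulrA; congr (_ * _); rewrite /dot mulr_suml; apply: eq_bigr => i _.
    rewrite (cE (g 0 i)) (cE (h 0 i)) ipZl ?ipZr ?ip_cst1//; last exact: L2M_cst.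
    by rewrite mulrA.
  rewrite /dot mulr_suml; apply: eq_bigr => i _.
  by rewrite (cE (g 0 i)) ipZl// mulrA.
rewrite [dot b g]/dot !mulr_suml; apply: eq_bigr => i _.
by rewrite (bilin_H10_affine _ _ (chi_grad i)) chi_bubble; ring.
Qed.

Lemma integral_corrected h e :
  ip one (corrected h e) = ip one (affine h e) - dot b h * ip one B.
Proof.
have hh := affine_is_grad h e; have Lh := hh.1.
have Lc i : L2 (chi i) := (chi_grad i).1.1.
rewrite /corrected ipDr//; last by apply: L2_sum => // i _; exact: L2M_cst.
congr (_ + _); rewrite ip_sumr//; last by move=> i _; exact: L2M_cst.
rewrite /dot mulr_suml -sumrN; apply: eq_bigr => i _.
by rewrite ipZr// chi_bubble; ring.
Qed.

Hypothesis D_gt0 : (0 < mu D)%E.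

Let fine_gt0 : 0 < fine (mu D).
Proof. by rewrite fine_gt0// D_gt0. Qed.

(** Derivatives of functions in H^1_0(D) have mean value zero, so g = 0; then
    [H10_partial0] applies. *)
Lemma affine_H10_eq0 g c W : H10_grad (affine g c) W -> g = 0 /\ c = 0.
Proof.
move=> gW; have hg := affine_is_grad g c.
have cE (c' : R) : cst c' = (fun x => c' * one x) :> (rV -> R).
  by apply/funext => x; rewrite mulr1.
have g0 : g = 0.
  apply/rowP => i; rewrite mxE.
  have L0 : L2 (cst (g 0 i)) by exact: L2_cst.
  have := ip_ae mD (is_gradL2 i gW.1) L0 L1 (is_grad_uniq oD fD i gW.1 hg).
  rewrite ipC (H10_integral_partial oD fD i gW) cE ipZl// ip_cst1// => /esym/eqP.
  by rewrite mulf_eq0 [X in _ || X]gt_eqF// orbF => /eqP.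
split => //; subst g.
have W0 : W (Ordinal d_gt0) = cst 0 %[ae mu in D].
  have := is_grad_uniq oD fD (Ordinal d_gt0) gW.1 hg.
  by rewrite mxE.
have a0 := H10_partial0 gW W0.
have L0 : L2 (cst 0) by exact: L2_cst.
have := ip_ae mD hg.1 L0 L1 a0; rewrite ip0l.
have -> : affine 0 c = (fun x => c * one x).
  apply/funext => x; rewrite /affine /dot big1 ?add0r ?mulr1// => i _.
  by rewrite mxE mul0r.
rewrite ipZl// ip_cst1// => /eqP.
by rewrite mulf_eq0 [X in _ || X]gt_eqF// orbF => /eqP.
Qed.

(** The affine part is the opposite of the corrector part, so it is in H^1_0(D). *)
Lemma corrected_eq0 g c : corrected g c = cst 0 %[ae mu in D] ->
  g = 0 /\ c = 0.
Proof.
move=> h; have [W hW] := corrector_part_grad g.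
have := H10_gradZ oD fD (-1) hW; set w := (fun x => _ ) => hw.
apply: (@affine_H10_eq0 g c); apply: (H10_grad_ae oD fD hw).
  exact: affine_measurable.
apply: filterS h => x hx Dx; rewrite /w mulN1r.
by have /eqP := hx Dx; rewrite /corrected addr_eq0 => /eqP.
Qed.

End variational.

(** * Simplices and their barycentric coordinates *)
Lemma negligible_fin (R : realType) d (I : finType) (P : pred I)
    (F : I -> set 'rV[R]_d) :
  (forall i, P i -> (@lebesgue R d).-negligible (F i)) ->
  (@lebesgue R d).-negligible [set x | exists2 i, P i & F i x].
Proof.
move=> F0.
have : \forall x \ae (@lebesgue R d), forall i, P i -> ~ F i x.
  refine (@filter_forall _ _ (fun i x => P i -> ~ F i x)
    (almost_everywhere (@lebesgue R d)) _ _) => i.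
  have [Pi|nPi] := boolP (P i); last exact: aeW.
  by apply: (negligibleS _ (F0 i Pi)) => x /= h; apply: contrapT => nF; apply: h.
by apply: negligibleS => x [i Pi Fx] /= h; exact: h Fx.
Qed.

Section barycentric_coordinates.
Variables (R : realType) (d n : nat) (p : 'I_n -> 'rV[R]_d) (K : {set 'I_n}).
Hypotheses (cardK : #|K| = d.+1) (indK : affinely_independent p K).
Local Notation rV := 'rV[R]_d.

(** The rows are the homogeneous coordinates (p_i, 1) of the vertices.  Affine
    independence of the vertices is linear independence of the rows. *)
Let A : 'M[R]_(#|K|, d + 1) :=
  row_mx (\matrix_k p (enum_val k)) (const_mx 1).

(** The rows are indexed by the elements of K; weights are indexed by all the
    vertices. *)
Let spread (u : 'rV[R]_#|K|) (i : 'I_n) : R :=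
  \sum_k (if enum_val k == i then u 0 k else 0).

Let spread_notin u i : i \notin K -> spread u i = 0.
Proof.
move=> iK; rewrite /spread big1// => k _; case: eqP => // ki.
by move: iK; rewrite -ki enum_valP.
Qed.

Let spread_sum (V : lmodType R) u (F : 'I_n -> V) :
  \sum_i spread u i *: F i = \sum_k u 0 k *: F (enum_val k).
Proof.
under eq_bigr do rewrite scaler_suml.
rewrite exchange_big; apply: eq_bigr => k _ /=.
rewrite (bigD1 (enum_val k))//= eqxx big1 ?addr0// => i /negbTE ik.
by rewrite eq_sym ik scale0r.
Qed.

Let spread_enum u k : spread u (enum_val k) = u 0 k.
Proof.
rewrite /spread (bigD1 k)//= eqxx big1 ?addr0// => l lk.
by rewrite (inj_eq enum_val_inj) (negbTE lk).
Qed.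

Let mul_A u : u *m A =
  row_mx (\sum_i spread u i *: p i) (\sum_i spread u i)%:M.
Proof.
rewrite mul_mx_row; congr row_mx.
  rewrite spread_sum mulmx_sum_row; apply: eq_bigr => k _.
  by rewrite rowK.
have := spread_sum u (fun=> (1 : R^o)).
rewrite (eq_bigr (spread u)); last by move=> i _; exact: mulr1.
move=> ->; apply/rowP => j; rewrite !ord1 !mxE eqxx mulr1n.
by apply: eq_bigr => k _; rewrite mxE.
Qed.

Let row_free_A : row_free A.
Proof.
apply: inj_row_free => u; rewrite mul_A -[X in _ = X](@row_mx0 R 1 d 1).
move=> /eq_row_mx[e1 /matrixP/(_ 0 0)]; rewrite !mxE eqxx mulr1n => e2.
apply/rowP => k; rewrite mxE -spread_enum.
exact: indK (@spread_notin u) e2 e1 (enum_val k).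
Qed.

Let row_full_A : row_full A.
Proof. by rewrite /row_full (eqP row_free_A) cardK addn1. Qed.

(** The rows span the whole space, and the coordinates of (x, 1) on them are
    affine in x. *)
Lemma barycentric_exists : exists (l : 'I_n -> rV) (c : 'I_n -> R), forall x,
  [/\ forall i, i \notin K -> affine (l i) (c i) x = 0,
      \sum_i affine (l i) (c i) x = 1 & x = \sum_i affine (l i) (c i) x *: p i].
Proof.
pose P := pinvmx A.
pose cf (i : 'I_n) (j : 'I_(d + 1)) : R :=
  \sum_k (if enum_val k == i then P j k else 0).
exists (fun i => \row_j cf i (lshift 1 j)), (fun i => cf i (rshift d ord0)) => x.
pose u := row_mx x 1%:M *m P.
have uE i : affine (\row_j cf i (lshift 1 j)) (cf i (rshift d ord0)) x = spread u i.
  rewrite /spread /u /affine /dot.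
  under eq_bigr do rewrite mxE mulr_suml.
  rewrite exchange_big -big_split; apply: eq_bigr => k _ /=.
  case: eqP => _; last by rewrite addr0 big1// => j _; rewrite mul0r.
  rewrite [in RHS]mxE big_split_ord /= big_ord1 row_mxEr.
  rewrite [1%:M _ _]mxE eqxx mul1r; congr (_ + _).
  by apply: eq_bigr => j _; rewrite row_mxEl mulrC.
have uA : u *m A = row_mx x 1%:M by rewrite mulmxKpV// submx_full.
have := mul_A u; rewrite uA => /eq_row_mx[e1 /matrixP/(_ 0 0)].
rewrite !mxE eqxx !mulr1n => e2; split.
- by move=> i iK; rewrite uE spread_notin.
- by under eq_bigr do rewrite uE.
- by under eq_bigr do rewrite uE.
Qed.

Definition bary_l : 'I_n -> rV := sval (cid barycentric_exists).
Definition bary_c : 'I_n -> R := sval (cid (svalP (cid barycentric_exists))).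
Definition bary i : rV -> R := affine (bary_l i) (bary_c i).

Lemma baryP x : [/\ forall i, i \notin K -> bary i x = 0,
      \sum_i bary i x = 1 & x = \sum_i bary i x *: p i].
Proof.
exact: (svalP (cid (svalP (cid barycentric_exists))) x).
Qed.

Lemma bary_uniq (w : 'I_n -> R) x : (forall i, i \notin K -> w i = 0) ->
  \sum_i w i = 1 -> x = \sum_i w i *: p i -> forall i, bary i x = w i.
Proof.
move=> wK w1 xw i; have [b0 b1 xb] := baryP x.
apply/eqP; rewrite -subr_eq0; apply/eqP.
apply: (indK (w := fun i => bary i x - w i)).
- by move=> j jK; rewrite b0// wK// subrr.
- by rewrite sumrB b1 w1 subrr.
- under eq_bigr do rewrite scalerBl.
  by rewrite sumrB -xb -xw subrr.
Qed.

Lemma bary_vertex i j : i \in K -> bary j (p i) = (j == i)%:R.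
Proof.
move=> iK; apply: (bary_uniq (w := fun j => (j == i)%:R)).
- by move=> k kK; case: eqP => // ki; rewrite -ki (negbTE kK) in iK *.
- by rewrite (bigD1 i)//= eqxx big1 ?addr0// => k /negbTE ->.
- by rewrite (bigD1 i)//= eqxx scale1r big1 ?addr0// => k /negbTE ->; rewrite scale0r.
Qed.

Lemma bary_continuous i : continuous (bary i).
Proof. by move=> x; apply: differentiable_continuous; exact: affine_diff. Qed.

Lemma bary_l_neq0 i : (0 < d)%N -> i \in K -> bary_l i != 0.
Proof.
move=> d0 iK; apply/eqP => l0.
have [j jK ji] : exists2 j, j \in K & j != i.
  have : (0 < #|K :\ i|)%N by have := cardsD1 i K; rewrite iK cardK add1n => -[<-].
  by move=> /card_gt0P[j]; rewrite !inE => /andP[ji jK]; exists j.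
have := bary_vertex i iK; have := bary_vertex i jK.
rewrite /bary /affine l0 eqxx eq_sym (negbTE ji).
have d00 y : dot (0 : rV) y = 0 by rewrite /dot big1// => k _; rewrite mxE mul0r.
by rewrite !d00 => -> /esym/eqP; rewrite oner_eq0.
Qed.

Lemma hull_bary (S : {set 'I_n}) x : S \subset K -> hull p S x ->
  [/\ forall i, 0 <= bary i x & forall i, i \notin S -> bary i x = 0].
Proof.
move=> SK [w [w0 wS w1 xw]].
have E : forall i, bary i x = w i.
  apply: (bary_uniq (w := w)) => // i iK; apply: wS.
  by apply: contra iK => /(fintype.subsetP SK).
by split => i; rewrite E//; exact: wS.
Qed.

Lemma bary_hull x : (forall i, i \in K -> 0 <= bary i x) -> hull p K x.
Proof.
move=> h; have [b0 b1 xb] := baryP x; exists (fun i => bary i x); split => // i.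
by have [/h//|/b0 ->] := boolP (i \in K).
Qed.

Lemma bary_interior x : (forall i, i \in K -> 0 < bary i x) -> (hull p K)° x.
Proof.
move=> h; rewrite /interior /=.
have : \forall y \near x, forall i, i \in K -> 0 < bary i y.
  refine (@filter_forall _ _ (fun i y => i \in K -> 0 < bary i y) (nbhs x) _ _) => i.
  have [iK|iK] := boolP (i \in K); last exact: nearW.
  have := @bary_continuous i x; move/cvgr_gt => /(_ 0 (h i iK)).
  by apply: filterS => y y0 _.
by apply: filterS => y y0; apply: bary_hull => i iK; exact/ltW/y0.
Qed.

Lemma hull_interior_nonempty : (hull p K)° !=set0.
Proof.
pose w i : R := if i \in K then d.+1%:R^-1 else 0.
exists (\sum_i w i *: p i); apply: bary_interior => i iK.
rewrite (bary_uniq (w := w))// /w ?iK ?invr_gt0 ?ltr0Sn//.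
  by move=> j /negbTE ->.
rewrite -big_mkcond sumr_const cardK -[_ *+ _]mulr_natr mulVf// pnatr_eq0//.
Qed.

Lemma hull_boundary x : hull p K x -> ~ (hull p K)° x ->
  exists2 i, i \in K & dot (bary_l i) x = - bary_c i.
Proof.
move=> hx nx; have [b0 _] := hull_bary (subxx K) hx.
apply: contrapT => h; apply: nx; apply: bary_interior => i iK.
rewrite lt_neqAle b0 andbT; apply/eqP => /esym /eqP e; apply: h; exists i => //.
by move: e; rewrite /bary /affine addr_eq0 => /eqP.
Qed.

(** A boundary point has a vanishing barycentric coordinate, and lies in a
    hyperplane. *)
Lemma hull_boundary_null : (0 < d)%N ->
  (@lebesgue R d).-negligible (hull p K `\` (hull p K)°).
Proof.
move=> d0.
suff : (@lebesgue R d).-negligible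
    [set x | exists2 i, i \in K & dot (bary_l i) x = - bary_c i].
  by apply: negligibleS => x [hx nx]; exact: hull_boundary.
apply: (negligible_fin (F := fun i => [set x | dot (bary_l i) x = - bary_c i])).
move=> i iK.
apply/negligibleP; last exact: null_hyperplane (bary_l_neq0 d0 iK).
apply: closed_measurable_rV.
rewrite (_ : mkset _ = dot (bary_l i) @^-1` [set - bary_c i])//.
by apply: preimage_closed => [x _|]; [exact: continuous_dot|exact: closed_eq].
Qed.

(** On a proper face some barycentric coordinate vanishes, whereas a nonempty open
    set has positive measure. *)
Lemma open_not_in_face (U : set rV) (S : {set 'I_n}) : (0 < d)%N ->
  open U -> S \proper K -> U `<=` hull p S -> U = set0.
Proof.
move=> d0 oU /properP[SK [i iK iS]] US.
apply/seteqP; split => // x Ux.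
have := lebesgue_open_gt0 oU (ex_intro _ x Ux); rewrite ltNge => /negP[].
rewrite -(null_hyperplane (- bary_c i) (bary_l_neq0 d0 iK)).
apply: le_measure; rewrite ?inE.
- exact: open_measurable_rV.
- apply: closed_measurable_rV.
  rewrite (_ : mkset _ = dot (bary_l i) @^-1` [set - bary_c i])//.
  by apply: preimage_closed => [y _|]; [exact: continuous_dot|exact: closed_eq].
move=> y Uy; have [_ /(_ i iS)] := hull_bary SK (US y Uy).
by rewrite /bary /affine => /eqP; rewrite addr_eq0 => /eqP.
Qed.

End barycentric_coordinates.

(** The topology of R^d is that of the product. *)
Lemma continuous_rV (R : realType) n d (F : 'rV[R]_n -> 'rV[R]_d) :
  (forall j, continuous (fun w => F w 0 j)) -> continuous F.
Proof.
move=> cF w U /nbhs_ballP[e /= e0 eU].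
have : \forall z \near w, forall j, ball (F w 0 j) e (F z 0 j).
  refine (@filter_forall _ _ (fun j z => ball (F w 0 j) e (F z 0 j)) (nbhs w) _ _) => j.
  by apply: (cF j w); exact: nbhsx_ballx.
by apply: filterS => z h; apply: eU; split => // i j; rewrite !ord1.
Qed.

Section hulls.
Variables (R : realType) (d n : nat) (p : 'I_n -> 'rV[R]_d).
Local Notation rV := 'rV[R]_d.
Implicit Types (S : {set 'I_n}).

Lemma vertex_in_hull S i : i \in S -> hull p S (p i).
Proof.
move=> iS; exists (fun j => (j == i)%:R); split.
- by move=> j; case: eqP.
- by move=> j jS; case: eqP => // ji; rewrite -ji (negbTE jS) in iS.
- by rewrite (bigD1 i)//= eqxx big1 ?addr0// => k /negbTE ->.
- rewrite (bigD1 i)//= eqxx scale1r big1 ?addr0// => k /negbTE ->.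
  by rewrite scale0r.
Qed.

(** The image of a compact set of weights. *)
Lemma hull_compact S : compact (hull p S).
Proof.
pose hi : 'rV[R]_n := \row_i (if i \in S then 1 else 0).
pose W := cbox 0 hi `&` dot (const_mx 1) @^-1` [set (1 : R)].
have cW : compact W.
  apply: compact_closedI; first exact: cbox_compact.
  by apply: preimage_closed => [y _|]; [exact: continuous_dot|exact: closed_eq].
pose F (w : 'rV[R]_n) : rV := \sum_i w 0 i *: p i.
have cF : continuous F.
  apply: continuous_rV => j.
  rewrite (_ : (fun w => _) = dot (\row_i p i 0 j)); first exact: continuous_dot.
  apply/funext => w; rewrite /F summxE; apply: eq_bigr => i _.
  by rewrite !mxE mulrC.
rewrite (_ : hull p S = F @` W).
  by apply: continuous_compact => //; exact: continuous_subspaceT.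
have dot1 (w : 'rV[R]_n) : dot (const_mx 1) w = \sum_i w 0 i.
  by apply: eq_bigr => i _; rewrite mxE mul1r.
apply/seteqP; split => [x [w [w0 wS w1 xw]]|_ [w [wb w1] <-]].
  exists (\row_i w i); last first.
    by rewrite xw; apply: eq_bigr => i _; rewrite mxE.
  split; last first.
    by rewrite /= dot1 -w1; apply: eq_bigr => i _; rewrite mxE.
  move=> i; rewrite !mxE w0 /=; case: ifPn => [_|/wS ->//].
  by rewrite -w1 (bigD1 i)//= lerDl sumr_ge0.
exists (w 0); split => //.
- by move=> i; have /andP[] := wb i; rewrite mxE.
- move=> i /negbTE iS; have := wb i; rewrite !mxE iS => /andP[h1 h2].
  by apply/le_anti; rewrite h1 h2.
- by move: w1; rewrite /= dot1.
Qed.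

Lemma hull_closed S : closed (hull p S).
Proof. exact: compact_closed (@rV_hausdorff R d) (@hull_compact S). Qed.

End hulls.

Lemma bounded_lebesgue_lty (R : realType) d (D : set 'rV[R]_d) (M : R) :
  measurable D -> (forall x, D x -> forall i, `|x 0 i| <= M) ->
  (lebesgue D < +oo)%E.
Proof.
move=> mD bD.
apply: le_lt_trans (lebesgue_box_lty (const_mx (- M - 1)) (const_mx (M + 1))).
apply: le_measure; rewrite ?inE//; first exact: measurable_box.
move=> x Dx i; rewrite !mxE; have := bD x Dx i; rewrite ler_norml; lra.
Qed.

(** * Restriction, extension by zero and decomposition *)
Section change_of_domain.
Variables (R : realType) (d : nat) (D E : set 'rV[R]_d).
Hypotheses (oD : open D) (fD : (@lebesgue R d D < +oo)%E).
Hypotheses (oE : open E) (ED : E `<=` D).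
Local Notation rV := 'rV[R]_d.
Local Notation mu := (@lebesgue R d).
Implicit Types (u v w g : rV -> R).

Let mD : measurable D. Proof. exact: open_measurable_rV. Qed.
Let mE : measurable E. Proof. exact: open_measurable_rV. Qed.

Let fE : (mu E < +oo)%E.
Proof. by apply: le_lt_trans fD; apply: le_measure; rewrite ?inE. Qed.

Lemma Rintegral_supp u : (forall x, ~ E x -> u x = 0) ->
  \int[lebesgue]_(x in D) u x = \int[lebesgue]_(x in E) u x.
Proof.
move=> u0; rewrite Rintegral_mkcond [RHS]Rintegral_mkcond.
congr Rintegral; apply/funext => x; rewrite !patchE.
have [Ex|nEx] := pselect (E x); first by rewrite !mem_set//; exact: ED.
by rewrite [in RHS]memNset// u0//; case: ifP.
Qed.

Lemma L2_sub u : L2 D u -> L2 E u.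
Proof.
move=> [mu_ u2]; split; first exact: measurable_funS mu_.
apply: le_lt_trans u2; apply: ge0_subset_integral => //.
- by apply/measurable_EFinP; exact: measurable_funX.
- by move=> x _; rewrite lee_fin sqr_ge0.
Qed.

Lemma L2_patch u : L2 E u -> L2 D (u \_ E).
Proof.
move=> [mu_ u2]; split.
  apply: (@measurable_funS _ _ _ _ setT) => //.
  exact/(measurable_restrictT u mE).
apply: le_lt_trans u2; rewrite /sqint integral_mkcond [leRHS]integral_mkcond.
rewrite le_eqVlt; apply/orP; left; apply/eqP; congr (integral _ _ _).
apply/funext => x; rewrite !patchE.
have [Ex|nEx] := pselect (E x); first by rewrite !mem_set//; exact: ED.
by rewrite [in RHS]memNset// [x \in E]memNset// expr0n; case: ifP.
Qed.

Lemma is_grad_sub u G : is_grad D u G -> is_grad E u G.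
Proof.
move=> uG; have [Lu uG'] := uG; split; first exact: L2_sub.
move=> i; split; first exact: L2_sub (is_gradL2 i uG).
move=> phi tphi; have tphi' := test_fun_partial i tphi.
have [_ h] := uG' i; have := h phi (test_funS ED tphi).
rewrite Rintegral_supp; last first.
  by move=> x nEx; rewrite (test_fun_notin tphi' nEx) mulr0.
move=> ->; rewrite Rintegral_supp// => x nEx.
by rewrite (test_fun_notin tphi nEx) mulr0.
Qed.

(** On E, a test function phi of D has weak derivative d_i phi even though it does
    not vanish on the boundary of E; the other factor w does, which is enough for
    integrating by parts. *)
Lemma H10_grad_patch w W : H10_grad E w W ->
  is_grad D (w \_ E) (fun i => W i \_ E).
Proof.
move=> wW; have [Lw _] := wW.1; split; first exact: L2_patch.
move=> i; have LW := is_gradL2 i wW.1; split; first exact: L2_patch.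
move=> phi tphi.
have patchM (u v : rV -> R) : \int[lebesgue]_(x in D) ((u \_ E) x * v x)
    = ip E u v.
  rewrite Rintegral_supp; last by move=> x nEx; rewrite patchE memNset// mul0r.
  by apply: eq_Rintegral => x; rewrite patchE => ->.
rewrite !patchM; have Lphi := test_fun_L2 oE fE tphi.
have := ip_by_parts oE fE Lphi (test_weak_partial oE fE i tphi) wW.
by rewrite (ipC E phi) => ->; rewrite opprK ipC.
Qed.

End change_of_domain.

Lemma Rintegral_ae (R : realType) d (D : set 'rV[R]_d) (f g : 'rV[R]_d -> R) :
  measurable D -> measurable_fun D f -> measurable_fun D g ->
  f = g %[ae (@lebesgue R d) in D] ->
  \int[lebesgue]_(x in D) f x = \int[lebesgue]_(x in D) g x.
Proof.
move=> mD mf mg fg; congr fine; apply: ae_eq_integral => //.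
- exact/measurable_EFinP.
- exact/measurable_EFinP.
- by apply: filterS fg => x h Dx; rewrite h.
Qed.

Section pieces.
Variables (R : realType) (d : nat) (D : set 'rV[R]_d).
Variables (I : finType) (P : pred I) (E : I -> set 'rV[R]_d).
Local Notation rV := 'rV[R]_d.
Local Notation mu := (@lebesgue R d).
Hypotheses (oD : open D) (oE : forall i, P i -> open (E i)).
Hypotheses (ED : forall i, P i -> E i `<=` D).
Hypothesis disj : forall i j x, P i -> P j -> E i x -> E j x -> i = j.
Hypothesis cover : \forall x \ae mu, D x -> exists2 i, P i & E i x.
Implicit Types (f g : rV -> R).

Let mD : measurable D. Proof. exact: open_measurable_rV. Qed.
Let mE i : P i -> measurable (E i).
Proof. by move=> Pi; apply: open_measurable_rV; exact: oE. Qed.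

(** The pieces cover D up to a null set, and they are finitely many. *)
Lemma ae_pieces (Q : rV -> Prop) :
  (forall i, P i -> \forall x \ae mu, E i x -> Q x) ->
  \forall x \ae mu, D x -> Q x.
Proof.
move=> h.
have : \forall x \ae mu, forall i, P i -> E i x -> Q x.
  refine (@filter_forall _ _ (fun i x => P i -> E i x -> Q x)
    (almost_everywhere mu) _ _) => i.
  by have [/h|nPi] := boolP (P i); [apply: filterS => x hx _|exact: aeW].
move=> hQ; apply: filterS2 cover hQ => x cx hx Dx.
by have [i Pi Eix] := cx Dx; exact: hx Eix.
Qed.

Lemma sum_pieces i (F : I -> rV -> R) x : P i -> E i x ->
  (forall j, P j -> ~ E j x -> F j x = 0) ->
  \sum_(j | P j) F j x = F i x.
Proof.
move=> Pi Eix F0; rewrite (bigD1 i)//= big1 ?addr0// => j /andP[Pj ji].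
by apply: F0 => // Ejx; move/eqP: ji; apply; exact: disj Ejx Eix.
Qed.

Lemma sum_patch i f x : P i -> E i x ->
  \sum_(j | P j) (f \_ (E j)) x = f x.
Proof.
move=> Pi Eix; rewrite (sum_pieces (F := fun j => f \_ (E j)) Pi Eix).
  by rewrite patchE mem_set.
by move=> j Pj nEj; rewrite patchE memNset.
Qed.

Lemma sum_patch_ae f :
  (fun x => \sum_(j | P j) (f \_ (E j)) x) = f %[ae mu in D].
Proof.
by apply: ae_pieces => i Pi; apply: aeW => x Eix; exact: sum_patch Eix.
Qed.

Lemma integral_pieces f : mu.-integrable D (EFin \o f) ->
  \int[lebesgue]_(x in D) f x = \sum_(i | P i) \int[lebesgue]_(x in E i) f x.
Proof.
move=> If; have mf : measurable_fun D f.
  by apply/measurable_EFinP; exact: measurable_int If.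
have patchI i : P i -> mu.-integrable D (EFin \o (f \_ (E i))).
  move=> Pi; have mfE : measurable_fun (E i) f by exact: measurable_funS (ED Pi) mf.
  apply: le_integrable If => //.
    apply/measurable_EFinP; apply: (@measurable_funS _ _ _ _ setT) => //.
    exact/(measurable_restrictT f (mE Pi)).
  move=> x Dx; rewrite /= patchE; case: ifP => // _.
  by rewrite lee_fin normr0.
have sumI (r : seq I) :
    mu.-integrable D (EFin \o (fun x => \sum_(i <- r | P i) (f \_ (E i)) x)) /\
    \int[lebesgue]_(x in D) \sum_(i <- r | P i) (f \_ (E i)) x =
    \sum_(i <- r | P i) \int[lebesgue]_(x in E i) f x.
  elim: r => [|i r [IH1 IH2]].
    rewrite big_nil (_ : (fun x => _) = cst 0).
      by split; [exact: (@integrable0 _ _ _ mu D)|rewrite /Rintegral integral0_eq].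
    by apply/funext => x; rewrite big_nil.
  rewrite big_cons; have [Pi|nPi] := boolP (P i); last first.
    rewrite (_ : (fun x => _) = (fun x => \sum_(j <- r | P j) (f \_ (E j)) x)) //.
    by apply/funext => x; rewrite big_cons (negbTE nPi).
  rewrite (_ : (fun x => _) =
    (fun x => (f \_ (E i)) x + \sum_(j <- r | P j) (f \_ (E j)) x)).
    split; first exact: (@integrableD _ _ _ mu D mD _ _ (patchI i Pi) IH1).
    rewrite RintegralD//; last exact: patchI.
    rewrite IH2; congr (_ + _).
    rewrite (@Rintegral_supp _ _ D (E i) (ED Pi)).
      by apply: eq_Rintegral => x; rewrite patchE => ->.
    by move=> x nE; rewrite patchE memNset.
  by apply/funext => x; rewrite big_cons Pi.
have [I1 <-] := sumI (index_enum I); apply: Rintegral_ae => //.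
- by apply/measurable_EFinP; exact: measurable_int I1.
- by apply: filterS (sum_patch_ae f) => x h Dx; rewrite h.
Qed.

(** Measurability is a hypothesis because f is arbitrary on the null set left by
    the pieces. *)
Lemma L2_piecewise_cst f (c : I -> R) : (mu D < +oo)%E -> measurable_fun D f ->
  (forall i x, P i -> E i x -> f x = c i) -> L2 D f.
Proof.
move=> fD mf fc.
have Lpatch i : P i -> L2 D (cst (c i) \_ (E i)).
  move=> Pi; apply: L2_patch => //; [exact: oE|exact: ED|].
  apply: L2_cst; first exact: mE.
  by apply: le_lt_trans fD; apply: le_measure; rewrite ?inE//; [exact: mE|exact: ED].
apply: (L2_ae mD (L2_sum mD (index_enum I) Lpatch) mf).
apply: ae_pieces => i Pi; apply: aeW => x Eix.
rewrite (fc i)// (sum_pieces (F := fun j => cst (c j) \_ (E j)) Pi Eix).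
  by rewrite patchE mem_set.
by move=> j Pj nEj; rewrite patchE memNset.
Qed.

Lemma ip_pieces f g : L2 D f -> L2 D g ->
  ip D f g = \sum_(i | P i) ip (E i) f g.
Proof. by move=> Lf Lg; apply: integral_pieces; exact: L2_mul_integrable. Qed.

Lemma bilin_pieces m b u v G H : (mu D < +oo)%E ->
  is_grad D u G -> is_grad D v H ->
  bilin m b D u v = \sum_(i | P i) bilin m b (E i) u v.
Proof.
move=> fD uG vH; rewrite (bilinE m b oD fD uG vH).
have [Lv _] := vH.
have fE i : P i -> (mu (E i) < +oo)%E.
  move=> Pi; apply: le_lt_trans fD; apply: le_measure; rewrite ?inE//.
    exact: mE.
  exact: ED.
rewrite (eq_bigr (fun k => m * \sum_i ip (E k) (G i) (H i)
    + \sum_i b 0 i * ip (E k) (G i) v)); last first.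
  move=> k Pk; apply: (bilinE m b (oE Pk) (fE _ Pk)).
    exact: is_grad_sub oD (oE Pk) (ED Pk) _ _ uG.
  exact: is_grad_sub oD (oE Pk) (ED Pk) _ _ vH.
rewrite big_split -mulr_sumr; congr (_ * _ + _).
  rewrite exchange_big; apply: eq_bigr => i _; apply: ip_pieces.
    exact: is_gradL2 uG.
  exact: is_gradL2 vH.
rewrite exchange_big; apply: eq_bigr => i _; rewrite -mulr_sumr ip_pieces//.
exact: is_gradL2 uG.
Qed.

End pieces.

(** * Meshes and continuous piecewise affine functions *)
Section mesh_geometry.
Variables (R : realType) (d : nat) (Omega : set 'rV[R]_d) (T : mesh R d).
Hypotheses (d_gt0 : (0 < d)%N).
Hypothesis polytope_Omega : open_bounded_polytope Omega.
Hypothesis mesh_T : conforming_simplicial_mesh Omega T.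
Local Notation rV := 'rV[R]_d.
Local Notation mu := (@lebesgue R d).
Local Notation elts := (elements T).
Implicit Types (K : {set 'I_(nvert T)}) (v : rV -> R).

Let cardK K : K \in elts -> #|K| = d.+1.
Proof. by have [_ _ h _ _] := mesh_T => /h[]. Qed.

Let indK K : K \in elts -> affinely_independent (@vert _ _ T) K.
Proof. by have [_ _ h _ _] := mesh_T => /h[]. Qed.

Lemma elt_open K : open (elt K).
Proof. exact: open_interior. Qed.

Lemma elt_measurable K : measurable (elt K).
Proof. by apply: open_measurable_rV; exact: elt_open. Qed.

Lemma elt_closed_elt K : elt K `<=` closed_elt K.
Proof. exact: interior_subset. Qed.

Lemma elt_bounded K : exists M, forall x, elt K x -> forall i, `|x 0 i| <= M.
Proof.
have [M _ KM] := compact_in_box (@hull_compact _ _ _ (@vert _ _ T) K).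
by exists M => x /elt_closed_elt Kx i; exact/ltW/KM.
Qed.

Lemma elt_lty K : (mu (elt K) < +oo)%E.
Proof.
have [M KM] := elt_bounded K.
exact: bounded_lebesgue_lty (elt_measurable K) KM.
Qed.

Lemma elt_nonempty K : K \in elts -> elt K !=set0.
Proof. by move=> KT; exact: (hull_interior_nonempty (cardK KT) (indK KT)). Qed.

Lemma elt_gt0 K : K \in elts -> (0 < mu (elt K))%E.
Proof.
by move=> KT; apply: lebesgue_open_gt0; [exact: elt_open|exact: elt_nonempty].
Qed.

Lemma Omega_open : open Omega.
Proof. by have [n [p [F ->]]] := polytope_Omega; exact: open_interior. Qed.

Lemma Omega_measurable : measurable Omega.
Proof. by apply: open_measurable_rV; exact: Omega_open. Qed.

Lemma closure_elts : closure Omega = \bigcup_(K in [set` elts]) closed_elt K.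
Proof. by have [_ _ _ h _] := mesh_T. Qed.

Lemma closed_elt_closure K : K \in elts -> closed_elt K `<=` closure Omega.
Proof. by move=> KT x Kx; rewrite closure_elts; exists K. Qed.

(** The polytope is the interior of a closed set, hence the interior of its
    closure, which contains all the elements. *)
Lemma elt_sub_Omega K : K \in elts -> elt K `<=` Omega.
Proof.
move=> KT; have cl : elt K `<=` closure Omega.
  exact: subset_trans (@elt_closed_elt K) (closed_elt_closure KT).
have [n [p [F OmegaE]]] := polytope_Omega.
have cF : closed (\bigcup_(S in [set` F]) hull p S).
  apply: closed_bigcup => //.
  by move=> S _; exact: hull_closed.
rewrite [X in _ `<=` X]OmegaE -open_subsetE; last exact: elt_open.
apply: subset_trans cl _; rewrite [X in _ `<=` X]((closure_id _).1 cF).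
apply: closureS.
by rewrite [X in X `<=` _]OmegaE; exact: interior_subset.
Qed.

Lemma Omega_lty : (mu Omega < +oo)%E.
Proof.
pose MK K := sval (cid2 (compact_in_box (@hull_compact _ _ _ (@vert _ _ T) K))).
have MKP K : 0 < MK K /\ forall x, closed_elt K x -> forall i, `|x 0 i| < MK K.
  by rewrite /MK; case: cid2.
apply: (bounded_lebesgue_lty (M := \sum_K MK K) Omega_measurable) => x Ox i.
have : closure Omega x by exact: subset_closure.
rewrite closure_elts => -[K /= KT Kx].
apply: (le_trans (ltW ((MKP K).2 x Kx i))).
by rewrite (bigD1 K)//= lerDl sumr_ge0// => L _; exact: ltW (MKP L).1.
Qed.

(** By conformity the intersection is contained in a common proper face. *)
Lemma elt_disjoint K K' x : K \in elts -> K' \in elts ->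
  elt K x -> elt K' x -> K = K'.
Proof.
move=> KT K'T Kx K'x; apply: contrapT => KK'.
have prop : K :&: K' \proper K.
  rewrite properE finset.subsetIl /= finset.subsetI subxx /=.
  apply/negP => KsubK'; apply: KK'; apply/eqP.
  by rewrite eqEcard KsubK' (cardK KT) (cardK K'T) leqnn.
have oKK' : open (elt K `&` elt K') by apply: openI; exact: elt_open.
have e : elt K `&` elt K' = set0.
  apply: (open_not_in_face (cardK KT) (indK KT) d_gt0 oKK' prop).
  have [_ _ _ _ h] := mesh_T; have := h K K' KT K'T; rewrite /closed_elt => <-.
  by move=> y [/elt_closed_elt Ky /elt_closed_elt K'y].
by have : (elt K `&` elt K') x by []; rewrite e.
Qed.

Lemma Omega_cover : \forall x \ae mu, Omega x -> exists2 K, K \in elts & elt K x.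
Proof.
have : mu.-negligible [set x | exists2 K, K \in elts &
    (closed_elt K `\` elt K) x].
  apply: (negligible_fin (F := fun K => closed_elt K `\` elt K)) => K KT.
  by exact: (hull_boundary_null (cardK KT) (indK KT)).
apply: negligibleS => x /= /not_implyP[Ox nx].
have : closure Omega x by exact: subset_closure.
rewrite closure_elts => -[K /= KT Kx]; exists K => //; split => // Kx'.
by apply: nx; exists K.
Qed.

Lemma ae_elts (Q : rV -> Prop) :
  (forall K, K \in elts -> \forall x \ae mu, elt K x -> Q x) ->
  \forall x \ae mu, Omega x -> Q x.
Proof.
exact: (@ae_pieces _ _ _ _ (fun K => K \in elts) (@elt _ _ T) Omega_cover Q).
Qed.

Lemma vert_closure i : closure Omega (@vert _ _ T i).
Proof.
have [_ h _ _ _] := mesh_T; have [K KT iK] := h i.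
by apply: (closed_elt_closure KT); exact: vertex_in_hull.
Qed.

(** A relation rather than a choice of coefficients, so that it is visibly
    linear. *)
Definition affine_rep v K g c := forall x, closed_elt K x -> v x = affine g c x.

Lemma P1_affine_rep v K : P1_space Omega T v -> K \in elts ->
  exists g c, affine_rep v K g c.
Proof. by move=> [_ h _] /h[g [c hgc]]; exists g, c. Qed.

(** On each of the finitely many closed elements, v coincides with an affine
    function. *)
Lemma P1_measurable v : P1_space Omega T v -> measurable_fun Omega v.
Proof.
move=> vP _ Y mY.
rewrite (_ : _ `&` _ = \bigcup_(K in [set` elts])
    (Omega `&` closed_elt K `&` v @^-1` Y)).
  apply: fin_bigcup_measurable => // K KT.
  have [g [c vgc]] := P1_affine_rep vP KT.
  rewrite (_ : _ `&` _ = Omega `&` (closed_elt K `&` affine g c @^-1` Y)).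
    apply: measurableI; first exact: Omega_measurable.
    apply: affine_measurable => //; apply: closed_measurable_rV.
    exact: hull_closed.
  by apply/seteqP; split => x [] => [[Ox Kx]|Ox [Kx]] /= => [|h];
    rewrite ?vgc// => h; split => //; split.
apply/seteqP; split => [x [Ox Yx]|x [K KT [[Ox _] Yx]]]; last by split.
have : closure Omega x by exact: subset_closure.
by rewrite closure_elts => -[K /= KT Kx]; exists K.
Qed.

Lemma P1_0 : P1_space Omega T (cst 0).
Proof.
split => //; first by move=> x; exact: cvg_cst.
move=> K KT; exists 0, 0 => x _; rewrite addr0 /dot big1// => i _.
by rewrite mxE mul0r.
Qed.

Lemma P1_addZ c u v : P1_space Omega T u -> P1_space Omega T v ->
  P1_space Omega T (fun x => c * u x + v x).
Proof.
move=> [cu au u0] [cv av v0]; split.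
- move=> x; apply: cvgD; last exact: cv.
  by apply: cvgM; [exact: cvg_cst|exact: cu].
- move=> K KT; have [g [e ue]] := au K KT; have [h [k vk]] := av K KT.
  exists (c *: g + h), (c * e + k) => x Kx; rewrite ue// vk//.
  by rewrite dotDZl; ring.
- by move=> x xO; rewrite u0// v0// mulr0 addr0.
Qed.

Lemma P1_sum (I : Type) (r : seq I) (P : pred I) (c : I -> R)
    (F : I -> rV -> R) : (forall i, P i -> P1_space Omega T (F i)) ->
  P1_space Omega T (fun x => \sum_(i <- r | P i) c i * F i x).
Proof.
move=> PF; elim: r => [|i r IH].
  rewrite (_ : (fun x => _) = cst 0); first exact: P1_0.
  by apply/funext => x; rewrite big_nil.
have [Pi|nPi] := boolP (P i).
  rewrite (_ : (fun x => _) =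
    (fun x => c i * F i x + \sum_(j <- r | P j) c j * F j x)).
    exact: P1_addZ (PF i Pi) IH.
  by apply/funext => x; rewrite big_cons Pi.
rewrite (_ : (fun x => _) = (fun x => \sum_(j <- r | P j) c j * F j x))//.
by apply/funext => x; rewrite big_cons (negbTE nPi).
Qed.

(** Both sides are affine on the closed elements and agree at all vertices; at the
    boundary vertices they vanish. *)
Lemma P1_nodal phi v x : nodal_basis Omega phi -> P1_space Omega T v ->
  closure Omega x ->
  v x = \sum_(i < nvert T | vert i \in Omega) v (vert i) * phi i x.
Proof.
move=> phiN vP.
set s := fun x => \sum_(i < nvert T | vert i \in Omega) v (vert i) * phi i x.
have sE y : s y = \sum_(i < nvert T | vert i \in Omega) v (vert i) * phi i y by [].
have sP : P1_space Omega T s.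
  by apply: P1_sum => i; rewrite inE => /phiN[].
have wP : P1_space Omega T (fun x => -1 * s x + v x) := P1_addZ (-1) sP vP.
have w0 (i : 'I_(nvert T)) : -1 * s (vert i) + v (vert i) = 0.
  have [Oi|nOi] := pselect (Omega (vert i)).
    rewrite sE (bigD1 i) /=; rewrite ?mem_set//= big1 => [|j /andP[]].
      by have [_ ->//] := phiN i Oi; rewrite eqxx /= mulr1 addr0 mulN1r addNr.
    rewrite inE => Oj ji; have [_ ->//] := phiN j Oj.
    by rewrite (negbTE ji) mulr0.
  have bi : (closure Omega `\` Omega) (vert i) by split => //; exact: vert_closure.
  by case: sP => _ _ ->//; case: vP => _ _ ->//; rewrite mulr0 addr0.
rewrite closure_elts => -[K /= KT Kx].
have [g [c wgc]] := P1_affine_rep wP KT.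
suff : -1 * s x + v x = 0.
  by move/eqP; rewrite mulN1r addrC subr_eq0 => /eqP.
rewrite wgc//; case: Kx => w [_ wK w1 ->].
have affE : affine g c (\sum_i w i *: vert i) = \sum_i w i * affine g c (vert i).
  rewrite /affine; under [RHS]eq_bigr do rewrite mulrDr.
  rewrite big_split -mulr_suml w1 mul1r; congr (_ + _).
  have dotS (r : seq 'I_(nvert T)) :
      dot g (\sum_(i <- r) w i *: vert i) = \sum_(i <- r) w i * dot g (vert i).
    elim: r => [|i r IH]; last by rewrite !big_cons dotDr dotZr IH.
    by rewrite !big_nil /dot big1// => i _; rewrite mxE mulr0.
  exact: dotS.
rewrite affE big1// => i _.
have [iK|iK] := boolP (i \in K); last by rewrite wK// mul0r.
by rewrite -wgc ?w0 ?mulr0//; exact: vertex_in_hull.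
Qed.

End mesh_geometry.

(** * The multiscale space and the stabilized scheme *)
Section msfem.
Variables (R : realType) (d : nat) (Omega : set 'rV[R]_d) (T : mesh R d).
Variables (m : R) (b : 'rV[R]_d) (f : 'rV[R]_d -> R).
Variables (phi phiadv : 'I_(nvert T) -> 'rV[R]_d -> R).
Variables (B : {set 'I_(nvert T)} -> 'rV[R]_d -> R).
Variables (chi : {set 'I_(nvert T)} -> 'I_d -> 'rV[R]_d -> R).
Hypotheses (d_gt0 : (0 < d)%N).
Hypothesis polytope_Omega : open_bounded_polytope Omega.
Hypothesis mesh_T : conforming_simplicial_mesh Omega T.
Hypothesis m_gt0 : 0 < m.
Hypothesis f_pc : piecewise_constant Omega T f.
Hypothesis phi_nodal : nodal_basis Omega phi.
Hypothesis phiadv_def : forall i : 'I_(nvert T), Omega (vert i) ->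
  is_adv_basis_fun m b Omega T (phi i) (phiadv i).
Hypothesis B_def : forall K, K \in elements T -> is_bubble m b K (B K).
Hypothesis chi_def : forall K i, K \in elements T ->
  is_corrector m b K i (chi K i).
Local Notation rV := 'rV[R]_d.
Local Notation mu := (@lebesgue R d).
Local Notation elts := (elements T).
Local Notation one := (cst 1 : rV -> R).
Implicit Types (K : {set 'I_(nvert T)}) (u v w : rV -> R) (g h : rV) (c e : R).

Let oO : open Omega := Omega_open polytope_Omega.
Let mO : measurable Omega := Omega_measurable polytope_Omega.
Let fO : (mu Omega < +oo)%E := Omega_lty polytope_Omega mesh_T.
Let oK K : K \in elts -> open (elt K). Proof. by move=> _; exact: elt_open. Qed.
Let mK K : measurable (elt K) := elt_measurable K.
Let fK K : (mu (elt K) < +oo)%E := elt_lty K.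
Let KO K : K \in elts -> elt K `<=` Omega.
Proof. exact: (elt_sub_Omega polytope_Omega mesh_T). Qed.
Let disj K K' x : K \in elts -> K' \in elts -> elt K x -> elt K' x -> K = K'.
Proof. exact: (elt_disjoint d_gt0 mesh_T). Qed.
Let cover : \forall x \ae mu, Omega x -> exists2 K, K \in elts & elt K x
  := Omega_cover d_gt0 mesh_T.

Let H10chi K : K \in elts -> forall i, H10 (elt K) (chi K i).
Proof. by move=> KT i; have [] := chi_def i KT. Qed.

Let chiE K : K \in elts -> forall i v, H10 (elt K) v ->
  bilin m b (elt K) (chi K i) v = - bilin m b (elt K) (fun x => x 0 i) v.
Proof. by move=> KT i; have [] := chi_def i KT. Qed.

Let chi0 K i x : K \in elts -> ~ elt K x -> chi K i x = 0.
Proof. by move=> KT; have [_ _] := chi_def i KT; apply. Qed.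

(** The relation between a multiscale function u and its piecewise affine part v,
    on each element.  By [corrected_repP] it is u = add_correctors chi v almost
    everywhere, but it mentions no weak derivative. *)
Definition corrected_rep u v := forall K, K \in elts -> exists g c,
  affine_rep v K g c /\ u = corrected (chi K) g c %[ae mu in elt K].

Lemma affine_rep_is_grad v K g c : affine_rep v K g c ->
  is_grad (elt K) v (fun i => cst (g 0 i)).
Proof.
move=> vgc; have [M bM] := elt_bounded K.
have vE x : elt K x -> v x = affine g c x by move=> /elt_closed_elt; exact: vgc.
have aG := affine_is_grad (@elt_open R d T K) (fK K) bM g c.
refine (is_grad_ae (@elt_open R d T K) (fK K) aG _ _).
  apply: (eq_measurable_fun (affine g c)); last exact: affine_measurable.
  by move=> x; rewrite inE => Kx; rewrite vE.
by apply: aeW => x Kx; rewrite vE.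
Qed.

Lemma add_correctors_elt v K g c : K \in elts -> affine_rep v K g c ->
  add_correctors chi v = corrected (chi K) g c %[ae mu in elt K].
Proof.
move=> KT vgc; have vG := affine_rep_is_grad vgc.
have := is_grad_ae_all (@elt_open R d T K) (fK K)
  (H1_is_grad (is_grad_H1 vG)) vG.
apply: filterS => x hx Kx; rewrite /add_correctors /corrected.
rewrite (vgc x (elt_closed_elt Kx)); congr (_ + _).
rewrite (sum_pieces (E := @elt _ _ T) (P := fun L => L \in elts)
  (F := fun L x => \sum_i weak_partial (elt L) i v x * chi L i x) disj KT Kx).
  by apply: eq_bigr => i _; rewrite hx.
by move=> L LT nLx; rewrite big1// => i _; rewrite chi0// mulr0.
Qed.

Lemma corrected_repP u v : P1_space Omega T v ->
  u = add_correctors chi v %[ae mu in Omega] <-> corrected_rep u v.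
Proof.
move=> vP; split => [uv K KT|uv].
  have [g [c vgc]] := P1_affine_rep vP KT; exists g, c; split => //.
  apply: filterS2 uv (add_correctors_elt KT vgc) => x h1 h2 Kx.
  by rewrite h1 ?h2//; exact: KO Kx.
apply: (ae_elts d_gt0 mesh_T) => K KT; have [g [c [vgc ugc]]] := uv K KT.
by apply: filterS2 ugc (add_correctors_elt KT vgc) => x h1 h2 Kx; rewrite h1 ?h2.
Qed.

Lemma corrected_addZ K c g g' e e' x :
  corrected (chi K) (c *: g + g') (c * e + e') x =
  c * corrected (chi K) g e x + corrected (chi K) g' e' x.
Proof.
rewrite /corrected /affine dotDZl.
have -> : \sum_i (c *: g + g') 0 i * chi K i x =
    c * (\sum_i g 0 i * chi K i x) + \sum_i g' 0 i * chi K i x.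
  rewrite mulr_sumr -big_split; apply: eq_bigr => i _.
  by rewrite !mxE mulrDl mulrA.
by ring.
Qed.

Lemma corrected_rep_addZ c u u' v v' : corrected_rep u v -> corrected_rep u' v' ->
  corrected_rep (fun x => c * u x + u' x) (fun x => c * v x + v' x).
Proof.
move=> uv uv' K KT; have [g [e [vg ug]]] := uv K KT.
have [g' [e' [vg' ug']]] := uv' K KT.
exists (c *: g + g'), (c * e + e'); split.
  by move=> x Kx; rewrite vg// vg'// /affine dotDZl; ring.
by apply: filterS2 ug ug' => x h h' Kx; rewrite h// h'// corrected_addZ.
Qed.

Lemma corrected_rep0 : corrected_rep (cst 0) (cst 0).
Proof.
move=> K KT; exists 0, 0; split.
  by move=> x _; rewrite /affine addr0 /dot big1// => i _; rewrite mxE mul0r.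
apply: aeW => x _; rewrite /corrected /affine addr0 /dot !big1 ?addr0//;
  by move=> i _; rewrite mxE mul0r.
Qed.

Lemma corrected_rep_sum (I : Type) (r : seq I) (P : pred I) (a : I -> R)
    (F G : I -> rV -> R) : (forall i, P i -> corrected_rep (F i) (G i)) ->
  corrected_rep (fun x => \sum_(i <- r | P i) a i * F i x)
                (fun x => \sum_(i <- r | P i) a i * G i x).
Proof.
move=> FG; elim: r => [|i r IH].
  have E (H : I -> rV -> R) : (fun x => \sum_(i <- [::] | P i) a i * H i x) = cst 0.
    by apply/funext => x; rewrite big_nil.
  by rewrite !E; exact: corrected_rep0.
have [Pi|nPi] := boolP (P i).
  have E (H : I -> rV -> R) : (fun x => \sum_(j <- i :: r | P j) a j * H j x) =
      (fun x => a i * H i x + \sum_(j <- r | P j) a j * H j x).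
    by apply/funext => x; rewrite big_cons Pi.
  by rewrite (E F) (E G); apply: corrected_rep_addZ => //; exact: FG.
have E (H : I -> rV -> R) : (fun x => \sum_(j <- i :: r | P j) a j * H j x) =
    (fun x => \sum_(j <- r | P j) a j * H j x).
  by apply/funext => x; rewrite big_cons (negbTE nPi).
by rewrite (E F) (E G).
Qed.

Lemma phiadv_grad i : Omega (vert i) -> exists G, is_grad Omega (phiadv i) G.
Proof.
by move=> /phiadv_def[[H1w _] _]; eexists; exact: H1_is_grad H1w.
Qed.

(** On K the two functions solve the same equation, and their difference is in
    H^1_0(K). *)
Lemma phiadv_corrected i : Omega (vert i) -> corrected_rep (phiadv i) (phi i).
Proof.
move=> Oi K KT; have [phiP _] := phi_nodal Oi.
have [g [c vgc]] := P1_affine_rep phiP KT; exists g, c; split => //.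
have [_ /(_ K KT)[H10w harm]] := phiadv_def Oi.
have [M bM] := elt_bounded K; have opK := @elt_open R d T K.
have wW := H10_is_grad opK (fK K) H10w.
have [C hC] := corrector_part_grad opK (fK K) (H10chi KT) g.
have zZ := H10_gradB opK (fK K) wW hC.
set z := (fun x => _) in zZ.
have zE x : elt K x -> z x = phiadv i x + -1 * corrected (chi K) g c x.
  move=> Kx; rewrite /z /= (vgc x (elt_closed_elt Kx)) /corrected; ring.
have [G uG] := phiadv_grad Oi.
have uK := is_grad_sub oO opK (KO KT) uG.
have [H cH] := corrected_is_grad opK (fK K) bM (H10chi KT) g c.
have cN := is_gradZ opK (fK K) (-1) cH.
have sumG := is_gradD opK (fK K) uK cN.
have z0 : z = cst 0 %[ae mu in elt K].
  apply: (variational_uniq opK (fK K) bM d_gt0 m_gt0 zZ (b := b)) => v H10v.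
  have vV := (H10_is_grad opK (fK K) H10v).1.
  have mz : measurable_fun (elt K) (fun x => phiadv i x + -1 * corrected (chi K) g c x).
    by have [[]] := sumG.
  have zE' : z = (fun x => phiadv i x + -1 * corrected (chi K) g c x) %[ae mu in elt K].
    by apply: aeW => x Kx; exact: zE.
  have mv : measurable_fun (elt K) v by have [[]] := vV.
  rewrite (bilin_ae m b opK (fK K) zZ.1 vV mz mv zE' (ae_eq_refl _ _ _)).
  rewrite (bilinDl m b opK (fK K) uK cN vV) (bilinZl m b opK (fK K) (-1) cH vV).
  rewrite harm// (corrected_harmonic opK (fK K) bM (H10chi KT) (chiE KT) _ _ H10v).
  by rewrite mulr0 addr0.
apply: filterS z0 => x hx Kx; have := hx Kx; rewrite zE//.
by move=> /eqP; rewrite mulN1r subr_eq0 => /eqP.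
Qed.

(** phi_i is phi_i^adv minus the sum of the differences phi_i^adv - phi_i on the
    elements, extended by zero from K; they are in H^1_0(K). *)
Lemma phi_grad i : Omega (vert i) -> exists G, is_grad Omega (phi i) G.
Proof.
move=> Oi; have [phiP _] := phi_nodal Oi; have [G uG] := phiadv_grad Oi.
have [_ hK] := phiadv_def Oi.
pose w := phiadv i \- phi i.
pose W K := fun j => weak_partial (elt K) j w.
have wW K : K \in elts -> is_grad Omega (w \_ (elt K)) (fun j => W K j \_ (elt K)).
  move=> KT; have H10w : H10 (elt K) w := (hK K KT).1.
  have wG := H10_is_grad (@elt_open R d T K) (fK K) H10w.
  exact: (H10_grad_patch oO fO (@elt_open R d T K) (KO KT) wG).
have sW := is_grad_sum oO fO (index_enum _) wW.
have pG := is_gradB oO fO uG sW.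
eexists; apply: (is_grad_ae oO fO pG).
  exact: (P1_measurable polytope_Omega mesh_T phiP).
apply: filterS (sum_patch_ae disj cover w) => x hx Ox.
by rewrite hx// /w /=; ring.
Qed.

Lemma P1_is_grad v : P1_space Omega T v -> exists G, is_grad Omega v G.
Proof.
move=> vP.
have gr i : exists G, vert i \in Omega -> is_grad Omega (phi i) G.
  have [Oi|nOi] := boolP (vert i \in Omega); last by exists (fun _ _ => 0).
  by have [|G hG] := @phi_grad i; [rewrite inE in Oi|exists G].
pose G i := sval (cid (gr i)).
have GP i : vert i \in Omega -> is_grad Omega (fun x => v (vert i) * phi i x)
    (fun k x => v (vert i) * G i k x).
  by move=> Oi; apply: is_gradZ => //; exact: (svalP (cid (gr i))).
have sG := is_grad_sum oO fO (index_enum _) GP.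
eexists; apply: (is_grad_ae oO fO sG).
  exact: (P1_measurable polytope_Omega mesh_T vP).
apply: aeW => x Ox; rewrite [RHS](P1_nodal mesh_T phi_nodal vP)//.
exact: subset_closure.
Qed.

Lemma adv_space_rep u : adv_space Omega phiadv u ->
  exists2 v, P1_space Omega T v & corrected_rep u v.
Proof.
move=> [mu_ [c uc]].
exists (fun x => \sum_(i < nvert T | vert i \in Omega) c i * phi i x).
  by apply: P1_sum => i; rewrite inE => /phi_nodal[].
have := @corrected_rep_sum _ (index_enum _) (fun i => vert i \in Omega) c phiadv phi.
move=> H K KT; have [|g [e [vg ug]]] := H _ K KT.
  by move=> i; rewrite inE; exact: phiadv_corrected.
exists g, e; split => //; apply: filterS2 uc ug => x h1 h2 Kx.
by rewrite h1 ?h2//; exact: KO Kx.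
Qed.

Lemma interpolant_rep v : P1_space Omega T v -> corrected_rep
  (fun x => \sum_(i < nvert T | vert i \in Omega) v (vert i) * phiadv i x) v.
Proof.
move=> vP K KT.
have [|g [e [sg ug]]] := @corrected_rep_sum _ (index_enum _)
    (fun i => vert i \in Omega) (fun i => v (vert i)) phiadv phi _ K KT.
  by move=> i; rewrite inE; exact: phiadv_corrected.
exists g, e; split => // x Kx; rewrite -sg//; apply: (P1_nodal mesh_T phi_nodal vP).
exact: (closed_elt_closure mesh_T KT).
Qed.

Lemma rep_adv_space u v : measurable_fun Omega u -> P1_space Omega T v ->
  corrected_rep u v -> adv_space Omega phiadv u.
Proof.
move=> mu_ vP uv; split => //; exists (fun i => v (vert i)).
have /(corrected_repP _ vP) h1 := uv.
have /(corrected_repP _ vP) h2 := interpolant_rep vP.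
by apply: filterS2 h1 h2 => x e1 e2 Ox; rewrite e1// e2.
Qed.

Lemma P1_adv_space v : P1_space Omega T v ->
  exists2 w, adv_space Omega phiadv w & corrected_rep w v.
Proof.
move=> vP; eexists; last exact: (interpolant_rep vP).
apply: (rep_adv_space _ vP (interpolant_rep vP)).
have mi i : vert i \in Omega -> L2 Omega (phiadv i).
  by rewrite inE => /phiadv_grad[G []].
have [] : L2 Omega (fun x =>
    \sum_(i < nvert T | vert i \in Omega) v (vert i) * phiadv i x) => //.
by apply: (L2_sum mO) => i Oi; apply: (L2M_cst mO); exact: mi.
Qed.

Lemma adv_is_grad u : adv_space Omega phiadv u -> exists G, is_grad Omega u G.
Proof.
move=> [mu_ [c uc]].
have gr i : exists G, vert i \in Omega -> is_grad Omega (phiadv i) G.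
  have [Oi|nOi] := boolP (vert i \in Omega); last by exists (fun _ _ => 0).
  by have [|G hG] := @phiadv_grad i; [rewrite inE in Oi|exists G].
pose G i := sval (cid (gr i)).
have GP i : vert i \in Omega -> is_grad Omega (fun x => c i * phiadv i x)
    (fun k x => c i * G i k x).
  by move=> Oi; apply: is_gradZ => //; exact: (svalP (cid (gr i))).
have sG := is_grad_sum oO fO (index_enum _) GP.
eexists; apply: (is_grad_ae oO fO sG mu_).
by apply: filterS uc => x h Ox; rewrite h.
Qed.

Lemma corrected_rep_uniq u v v' : P1_space Omega T v -> P1_space Omega T v' ->
  corrected_rep u v -> corrected_rep u v' -> {in closure Omega, v =1 v'}.
Proof.
move=> vP vP' uv uv' x; rewrite inE (closure_elts mesh_T) => -[K /= KT Kx].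
have [g [e [vg ug]]] := uv K KT; have [g' [e' [vg' ug']]] := uv' K KT.
have [M bM] := elt_bounded K; have opK := @elt_open R d T K.
have : corrected (chi K) (-1 *: g + g') (-1 * e + e') = cst 0 %[ae mu in elt K].
  apply: filterS2 ug ug' => y h h' Ky; rewrite corrected_addZ -h// -h'//.
  by rewrite mulN1r addNr.
move=> /(corrected_eq0 opK (fK K) bM d_gt0 (H10chi KT) (elt_gt0 mesh_T KT))[g0 e0].
rewrite vg// vg'//; congr (affine _ _ x).
  by apply/eqP; rewrite eq_sym -subr_eq0 addrC -scaleN1r g0.
by apply/eqP; rewrite eq_sym -subr_eq0 addrC -mulN1r e0.
Qed.

Let tau K : R := (\int[lebesgue]_(y in elt K) B K y) / fine (mu (elt K)).

Lemma tauB_elt K x : K \in elts -> elt K x -> tauB B x = tau K.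
Proof.
move=> KT Kx; rewrite /tauB.
rewrite (sum_pieces (E := @elt _ _ T) (P := fun L => L \in elts)
  (F := fun L x => tau L * \1_(elt L) x) disj KT Kx).
  by rewrite indicE mem_set// mulr1.
by move=> L LT nLx; rewrite indicE memNset// mulr0.
Qed.

Lemma tauB_measurable D : measurable_fun D (tauB B).
Proof.
apply: (@measurable_funS _ _ _ _ setT) => //.
rewrite (_ : tauB B = (fun x => \sum_(K <- enum elts) tau K * \1_(elt K) x)).
  apply: measurable_sum => K; apply: measurable_funM; first exact: measurable_cst.
  exact: measurable_indic (mK K).
by apply/funext => x; rewrite big_enum.
Qed.

Lemma tau_bubble K : K \in elts ->
  tau K * fine (mu (elt K)) = ip (elt K) one (B K).
Proof.
move=> KT; have f0 : fine (mu (elt K)) != 0.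
  by rewrite gt_eqF//; apply: fine_gt0; rewrite (elt_gt0 mesh_T KT)/=; exact: fK.
by rewrite (ipC (elt K) one (B K)) (@ip_cstr R d (elt K) (B K)) divfK.
Qed.

Let bilin_elt K g c h e : K \in elts ->
  bilin m b (elt K) (corrected (chi K) g c) (corrected (chi K) h e) =
  m * dot g h * fine (mu (elt K)) + dot b g * ip (elt K) one (affine h e)
  + dot b g * dot b h * ip (elt K) one (B K).
Proof.
move=> KT; have [M bM] := elt_bounded K; have [H10B BE] := B_def KT.
exact: (bilin_corrected (@elt_open R d T K) (fK K) bM d_gt0 m_gt0
  H10B BE (H10chi KT) (chiE KT)).
Qed.

Let integral_elt K h e : K \in elts ->
  ip (elt K) one (corrected (chi K) h e) =
  ip (elt K) one (affine h e) - dot b h * ip (elt K) one (B K).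
Proof.
move=> KT; have [M bM] := elt_bounded K; have [H10B BE] := B_def KT.
exact: (integral_corrected (@elt_open R d T K) (fK K) bM d_gt0 m_gt0
  H10B BE (H10chi KT) (chiE KT)).
Qed.

Lemma dot_measurable (D : set rV) (F G : rV -> rV) :
  (forall i, measurable_fun D (fun x => F x 0 i)) ->
  (forall i, measurable_fun D (fun x => G x 0 i)) ->
  measurable_fun D (fun x => dot (F x) (G x)).
Proof.
by move=> mF mG; apply: measurable_sum => i; exact: measurable_funM.
Qed.

Lemma weak_grad_measurable (D : set rV) u G : is_grad D u G ->
  forall i, measurable_fun D (fun x => weak_grad D u x 0 i).
Proof.
move=> uG i; rewrite (_ : (fun x => _) = weak_partial D i u).
  by have [] := is_gradL2 i (H1_is_grad (is_grad_H1 uG)).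
by apply/funext => x; rewrite mxE.
Qed.

Lemma weak_grad_elt v K g c : affine_rep v K g c ->
  \forall x \ae mu, elt K x -> weak_grad (elt K) v x = g.
Proof.
move=> vgc; have vG := affine_rep_is_grad vgc.
have := is_grad_ae_all (@elt_open R d T K) (fK K)
  (H1_is_grad (is_grad_H1 vG)) vG.
by apply: filterS => x hx Kx; apply/rowP => i; rewrite mxE hx.
Qed.

(** Both sides are computed on each element; the value of tauB is such that its
    integral over K is that of the bubble. *)
Lemma bilin_stabilized u uH v vH G H :
  is_grad Omega u G -> is_grad Omega v H ->
  corrected_rep u uH -> corrected_rep v vH ->
  bilin m b Omega u v =
  \sum_(K in elts) \int[lebesgue]_(x in elt K)
      (m * dot (weak_grad (elt K) uH x) (weak_grad (elt K) vH x)
       + vH x * dot b (weak_grad (elt K) uH x)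
       + tauB B x * dot b (weak_grad (elt K) uH x)
                    * dot b (weak_grad (elt K) vH x)).
Proof.
move=> uG vG urep vrep.
rewrite (bilin_pieces oO oK KO disj cover m b fO uG vG).
apply: eq_bigr => K KT; have opK := @elt_open R d T K.
have [g [c [ug uE]]] := urep K KT; have [h [e [vh vE]]] := vrep K KT.
have uK := is_grad_sub oO opK (KO KT) uG; have vK := is_grad_sub oO opK (KO KT) vG.
have [M bM] := elt_bounded K.
have mcor g' c' : measurable_fun (elt K) (corrected (chi K) g' c').
  by have [W [[]]] := corrected_is_grad opK (fK K) bM (H10chi KT) g' c'.
rewrite (bilin_ae m b opK (fK K) uK vK (mcor g c) (mcor h e) uE vE) bilin_elt//.
have uHG := affine_rep_is_grad ug; have vHG := affine_rep_is_grad vh.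
have mvH : measurable_fun (elt K) vH by case: vHG => -[].
have mb (w : rV -> R) G' : is_grad (elt K) w G' ->
    measurable_fun (elt K) (fun x => dot b (weak_grad (elt K) w x)).
  move=> wG; apply: dot_measurable => [i|]; first exact: measurable_cst.
  exact: weak_grad_measurable wG.
pose C := m * dot g h + tau K * dot b g * dot b h.
have La : L2 (elt K) (affine h e) := affine_L2 opK (fK K) bM h e.
have L1 c' : L2 (elt K) (cst c' : rV -> R) by exact: L2_cst.
rewrite (@Rintegral_ae _ _ _ _ (fun x => dot b g * affine h e x + cst C x)) //.
- rewrite RintegralD//; last 2 first.
  + exact: (L2_integrable (mK K) (fK K) (L2M_cst (mK K) _ La)).
  + exact: (L2_integrable (mK K) (fK K) (L1 C)).
  rewrite RintegralZl//; last exact: (L2_integrable (mK K) (fK K) La).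
  rewrite Rintegral_cst// -(@ip_cstr _ _ (elt K) (affine h e)) [ip _ (affine h e) _]ipC.
  by rewrite -tau_bubble// /C; ring.
- apply: measurable_funD; first apply: measurable_funD.
  + apply: measurable_funM; first exact: measurable_cst.
    apply: dot_measurable; first exact: weak_grad_measurable uHG.
    exact: weak_grad_measurable vHG.
  + by apply: measurable_funM => //; exact: mb uHG.
  + apply: measurable_funM; last exact: mb vHG.
    by apply: measurable_funM; [exact: tauB_measurable|exact: mb uHG].
- apply: measurable_funD; last exact: measurable_cst.
  by apply: measurable_funM; [exact: measurable_cst|exact: affine_measurable].
- apply: filterS2 (weak_grad_elt ug) (weak_grad_elt vh) => x hu hv Kx.
  rewrite hu// hv// (tauB_elt KT Kx) (vh x (elt_closed_elt Kx)) /C /=; ring.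
Qed.

(** On K the weak gradient of vH on Omega coincides with the constant gradient of
    vH on K, and f and tauB are constant. *)
Lemma rhs_stabilized v vH H : P1_space Omega T vH ->
  is_grad Omega v H -> corrected_rep v vH ->
  \int[lebesgue]_(x in Omega) (f x * v x) =
  \int[lebesgue]_(x in Omega)
    (f x * vH x - tauB B x * f x * dot b (weak_grad Omega vH x)).
Proof.
move=> vHP vG vrep; have [Lv _] := vG.
have [mf fc] := f_pc.
have fc' K : exists c, K \in elts -> forall x, elt K x -> f x = c.
  by have [/fc[c hc]|nK] := boolP (K \in elts); [exists c|exists 0].
pose cf K := sval (cid (fc' K)).
have cfE K x : K \in elts -> elt K x -> f x = cf K.
  by move=> KT Kx; exact: (svalP (cid (fc' K))).
have Lf : L2 Omega f := L2_piecewise_cst oO oK KO disj cover fO mf cfE.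
have [G vHG] := P1_is_grad vHP; have [LvH _] := vHG.
pose P x := tauB B x * f x.
have PE K x : K \in elts -> elt K x -> P x = tau K * cf K.
  by move=> KT Kx; rewrite /P (tauB_elt KT Kx) (cfE K x KT Kx).
have LP : L2 Omega P.
  apply: (L2_piecewise_cst oO oK KO disj cover fO _ PE).
  by apply: measurable_funM => //; exact: tauB_measurable.
pose Q x := \sum_i b 0 i * weak_partial Omega i vH x.
have WG := H1_is_grad (is_grad_H1 vHG).
have LQ : L2 Omega Q.
  by apply: (L2_sum mO) => i _; apply: (L2M_cst mO); exact: is_gradL2 i WG.
have QE x : dot b (weak_grad Omega vH x) = Q x.
  by apply: eq_bigr => i _; rewrite mxE.
have -> : \int[lebesgue]_(x in Omega)
    (f x * vH x - tauB B x * f x * dot b (weak_grad Omega vH x)) =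
    ip Omega f vH - ip Omega P Q.
  rewrite /ip -RintegralB//; [|exact: L2_mul_integrable|exact: L2_mul_integrable].
  by apply: eq_Rintegral => x _; rewrite QE.
rewrite -/(ip Omega f v) !(ip_pieces oO oK KO disj cover)//.
rewrite -sumrB; apply: eq_bigr => K KT; have opK := @elt_open R d T K.
have [M bM] := elt_bounded K.
have [h [e [vh vE]]] := vrep K KT.
have sub w : L2 Omega w -> L2 (elt K) w by exact: (L2_sub oO opK (KO KT)).
have L1 c' : L2 (elt K) (cst c' : rV -> R) by exact: L2_cst.
have cE (c' : R) : cst c' = (fun x => c' * one x) :> (rV -> R).
  by apply/funext => x; rewrite mulr1.
have fE : f = cst (cf K) %[ae mu in elt K] by apply: aeW => x Kx; exact: cfE.
have PE' : P = cst (tau K * cf K) %[ae mu in elt K] by apply: aeW => x Kx; exact: PE.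
have QE' : Q = cst (dot b h) %[ae mu in elt K].
  have wG := is_grad_sub oO opK (KO KT) WG; have aG := affine_rep_is_grad vh.
  have := is_grad_ae_all opK (fK K) wG aG.
  by apply: filterS => x hx Kx; apply: eq_bigr => i _; rewrite hx.
have Lc : L2 (elt K) (corrected (chi K) h e).
  by have [W []] := corrected_is_grad opK (fK K) bM (H10chi KT) h e.
have La : L2 (elt K) (affine h e) := affine_L2 opK (fK K) bM h e.
have one1 : L2 (elt K) one := L1 1.
have vHE : vH = affine h e %[ae mu in elt K].
  by apply: aeW => x Kx; exact: vh (elt_closed_elt Kx).
rewrite (ip_ae (mK K) (sub _ Lf) (L1 (cf K)) (sub _ Lv) fE).
rewrite (ip_ae (mK K) (sub _ Lf) (L1 (cf K)) (sub _ LvH) fE).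
rewrite (ip_ae (mK K) (sub _ LP) (L1 (tau K * cf K)) (sub _ LQ) PE').
rewrite ipC (ip_ae (mK K) (sub _ Lv) Lc (L1 (cf K)) vE).
rewrite [ip _ _ vH]ipC (ip_ae (mK K) (sub _ LvH) La (L1 (cf K)) vHE).
rewrite [ip _ _ Q]ipC (ip_ae (mK K) (sub _ LQ) (L1 (dot b h)) (L1 _) QE').
rewrite (cE (cf K)) (cE (dot b h)) (cE (tau K * cf K)).
rewrite !(ipZr (mK K) (cf K) one1)// (ipZr (mK K) (tau K * cf K) one1); last first.
  exact: L2M_cst.
rewrite (ipZl (mK K) (dot b h) one1 one1) (ip_cst1 (mK K)).
rewrite [ip _ (corrected _ _ _) _]ipC [ip _ (affine _ _) _]ipC integral_elt//.
by rewrite -tau_bubble//; ring.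
Qed.

End msfem.

(** * Equivalence of the two problems *)
Theorem mainTheorem4 (R : realType) (d : nat)
  (Omega : set 'rV[R]_d) (T : mesh R d)
  (m : R) (b : 'rV[R]_d) (f : 'rV[R]_d -> R)
  (phi phiadv : 'I_(nvert T) -> 'rV[R]_d -> R)
  (B : {set 'I_(nvert T)} -> 'rV[R]_d -> R)
  (chi : {set 'I_(nvert T)} -> 'I_d -> 'rV[R]_d -> R)
  (d_gt0 : (0 < d)%N)
  (polytope_Omega : open_bounded_polytope Omega)
  (mesh_T : conforming_simplicial_mesh Omega T)
  (m_gt0 : 0 < m)
  (f_pc : piecewise_constant Omega T f)
  (phi_nodal : nodal_basis Omega phi)
  (phiadv_def : forall i : 'I_(nvert T), Omega (vert i) ->
    is_adv_basis_fun m b Omega T (phi i) (phiadv i))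
  (B_def : forall K, K \in elements T -> is_bubble m b K (B K))
  (chi_def : forall K i, K \in elements T -> is_corrector m b K i (chi K i)) :
  (forall u, adv_space Omega phiadv u ->
     exists uH, [/\ P1_space Omega T uH,
       u = add_correctors chi uH %[ae lebesgue in Omega] &
       forall wH, P1_space Omega T wH ->
         u = add_correctors chi wH %[ae lebesgue in Omega] ->
         {in closure Omega, wH =1 uH}]) /\
  (forall u uH, measurable_fun Omega u -> P1_space Omega T uH ->
     u = add_correctors chi uH %[ae lebesgue in Omega] ->
     (adv_msfem_lin_solution m b Omega phiadv f u <->
      stabilized_P1_solution m b Omega T (tauB B) f uH)).
Proof.
have repP u v (vP : P1_space Omega T v) :=
  corrected_repP d_gt0 polytope_Omega mesh_T chi_def u vP.
have advP v := @adv_is_grad _ _ _ _ _ _ _ _ polytope_Omega mesh_T phiadv_def v.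
have advR v := adv_space_rep d_gt0 polytope_Omega mesh_T m_gt0 phi_nodal
  phiadv_def chi_def (u := v).
split=> [u uadv|u uH mu_ uHP /(repP _ _ uHP) urep].
  have [uH uHP urep] := advR u uadv; exists uH; split => //.
    exact/(repP _ _ uHP).
  move=> wH wHP /(repP _ _ wHP) wrep.
  exact: (corrected_rep_uniq d_gt0 mesh_T chi_def wHP uHP wrep urep).
have uadv : adv_space Omega phiadv u.
  exact: (rep_adv_space d_gt0 polytope_Omega mesh_T m_gt0 phi_nodal
    phiadv_def chi_def mu_ uHP urep).
have [G uG] := advP u uadv.
have core v vH : adv_space Omega phiadv v -> P1_space Omega T vH ->
    corrected_rep chi v vH -> 
    (bilin m b Omega u v = \int[lebesgue]_(x in Omega) (f x * v x)) <->
    (\sum_(K in elements T) \int[lebesgue]_(x in elt K)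
      (m * dot (weak_grad (elt K) uH x) (weak_grad (elt K) vH x)
       + vH x * dot b (weak_grad (elt K) uH x)
       + tauB B x * dot b (weak_grad (elt K) uH x)
                  * dot b (weak_grad (elt K) vH x))
    = \int[lebesgue]_(x in Omega)
        (f x * vH x - tauB B x * f x * dot b (weak_grad Omega vH x))).
  move=> vadv vHP vrep; have [H vH'] := advP v vadv.
  rewrite (bilin_stabilized d_gt0 polytope_Omega mesh_T m_gt0 B_def chi_def
    uG vH' urep vrep).
  by rewrite (rhs_stabilized d_gt0 polytope_Omega mesh_T m_gt0 f_pc phi_nodal
    phiadv_def B_def chi_def vHP vH' vrep).
split=> [[_ sol]|[_ sol]]; split => // v vP.
- have [w wadv wrep] := P1_adv_space d_gt0 polytope_Omega mesh_T m_gt0 phi_nodal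
    phiadv_def chi_def vP.
  by apply/(core w v wadv vP wrep); exact: sol.
- have [vH vHP vrep] := advR v vP.
  by apply/(core v vH vP vHP vrep); exact: sol.
Qed.
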